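(* Let $t, k$ be two integers with $t\ge 1$ and $k\ge 3$. For sufficiently large $n$ (in terms of $t,k$), let $G\in \mathrm{Spex}(n, t(P_1\vee P_{2k}))$. Then $G=K_{t-1}\vee H$ with $H\in \mathcal{K}_{n_1,\,n-n_1-t+1}^{k-1}(P_{2k})$, where if $t=1$, then $$n_1=\begin{cases} \frac{n}{2} & \text{if } k \text{ is odd and } n \text{ is even, or } k \text{ is even and } n\equiv 0\pmod 4,\\ \frac{n\pm1}{2} & \text{if } k \text{ and } n \text{ are both odd},\\ \frac{n-1}{2} & \text{if } k \text{ is even and } n\equiv 1\pmod 4,\\ \frac{n+1}{2} & \text{if } k \text{ is even and } n\equiv 3\pmod 4,\\ \frac{n}{2}\pm1 & \text{if } k \text{ is even and } n\equiv 2\pmod 4, \end{cases}$$ and if $t\ge 2$, then $$n_1=\begin{cases} \left\lceil\frac{n-t+1}{2}\right\rceil & \text{if } k \text{ is odd, or if } k \text{ is even and } n-t\equiv 2,3\pmod 4,\\ \left\lfloor\frac{n-t+1}{2}\right\rfloor & \text{if } k \text{ is even and } n-t\equiv 0\pmod 4,\\ \left\lceil\frac{n-t+2}{2}\right\rceil & \text{if } k \text{ is even and } n-t\equiv 1\pmod 4. \end{cases}$$ (Here $n_1=\frac{n\pm 1}{2}$, respectively $n_1=\frac n2\pm1$, means that $n_1$ is one of the two indicated values.)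
   Context: All graphs are finite, simple and undirected; graphs are considered up to isomorphism. The order of a graph is its number of vertices. The spectral radius $\rho(G)$ is the largest eigenvalue of the adjacency matrix of $G$. $P_m$ is the path with $m$ vertices, $K_m$ the complete graph on $m$ vertices, $G\vee H$ the join (the disjoint union of $G$ and $H$ with all edges between $V(G)$ and $V(H)$ added), and $tG$ the disjoint union of $t$ copies of $G$. For $t=1$, $K_{t-1}$ is the empty (null) graph and $K_0\vee H=H$. A graph is $F$-free if it does not contain $F$ as a (not necessarily induced) subgraph. $\mathrm{spex}(n,F)$ is the maximum spectral radius of an $F$-free graph of order $n$, and $\mathrm{Spex}(n,F)$ is the set of $F$-free graphs of order $n$ with spectral radius $\mathrm{spex}(n,F)$. A nearly $d$-regular graph is a graph in which each vertex has degree $d$ except for one vertex, which has degree $d-1$. For positive integers $n_1,n_2$, let $K_{n_1,n_2}$ be the complete bipartite graph with bipartition $(V_1,V_2)$, $|V_i|=n_i$. $\mathcal{K}_{n_1,n_2}^{k-1}(P_{2k})$ is the set of graphs $G$ obtained from a copy of $K_{n_1,n_2}$ by adding edges between vertices of $V_1$ so that the induced subgraph $G[V_1]$ is $P_{2k}$-free and is $(k-1)$-regular or nearly $(k-1)$-regular. *)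

(* Defs.v *)
From mathcomp Require Import all_boot all_order all_algebra.
From mathcomp Require Import boolp classical_sets reals.

Set Implicit Arguments.
Unset Strict Implicit.
Unset Printing Implicit Defensive.

Local Open Scope nat_scope.
Local Open Scope classical_set_scope.

Record sgraph (V : finType) := SGraph {
  adj :> rel V;
  adj_sym : symmetric adj;
  adj_irr : irreflexive adj }.

Section Constructions.
Variables U V : finType.

Lemma sgraph_pull_sym (f : U -> V) (G : sgraph V) :
  symmetric (fun x y => G (f x) (f y)).
Proof. by move=> x y; rewrite adj_sym. Qed.

Lemma sgraph_pull_irr (f : U -> V) (G : sgraph V) :
  irreflexive (fun x y => G (f x) (f y)).
Proof. by move=> x; rewrite adj_irr. Qed.

(* For injective f this is the subgraph of G induced by the image of f. *)
Definition induced (f : U -> V) (G : sgraph V) : sgraph U :=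
  SGraph (sgraph_pull_sym f G) (sgraph_pull_irr f G).

Definition join_rel (G : sgraph U) (H : sgraph V) : rel (U + V)%type :=
  fun x y => match x, y with
  | inl a, inl b => G a b
  | inr a, inr b => H a b
  | _, _ => true
  end.

Lemma join_sym G H : symmetric (join_rel G H).
Proof. by move=> [a|a] [b|b] //=; rewrite adj_sym. Qed.

Lemma join_irr G H : irreflexive (join_rel G H).
Proof. by move=> [a|a] /=; rewrite adj_irr. Qed.

Definition join (G : sgraph U) (H : sgraph V) : sgraph (U + V)%type :=
  SGraph (join_sym G H) (join_irr G H).

Definition copies_rel (t : nat) (G : sgraph V) : rel ('I_t * V)%type :=
  fun x y => (x.1 == y.1) && G x.2 y.2.

Lemma copies_sym t G : symmetric (@copies_rel t G).
Proof. by move=> x y; rewrite /copies_rel eq_sym adj_sym. Qed.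

Lemma copies_irr t G : irreflexive (@copies_rel t G).
Proof. by move=> x; rewrite /copies_rel adj_irr andbF. Qed.

Definition copies (t : nat) (G : sgraph V) : sgraph ('I_t * V)%type :=
  SGraph (copies_sym (t := t) G) (copies_irr (t := t) G).

Definition giso (G : sgraph U) (H : sgraph V) : Prop :=
  exists2 f : U -> V, bijective f & forall x y, H (f x) (f y) = G x y.

(* Subgraphs are not required to be induced. *)
Definition gfree (F : sgraph U) (G : sgraph V) : Prop :=
  ~ exists2 f : U -> V, injective f & forall x y, F x y -> G (f x) (f y).

End Constructions.

Section Basic.
Variable m : nat.

Definition empty_rel : rel 'I_m := fun _ _ => false.
Lemma empty_sym : symmetric empty_rel. Proof. by []. Qed.
Lemma empty_irr : irreflexive empty_rel. Proof. by []. Qed.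
Definition edgeless : sgraph 'I_m := SGraph empty_sym empty_irr.

Definition complete_rel : rel 'I_m := fun x y => x != y.
Lemma complete_sym : symmetric complete_rel.
Proof. by move=> x y; rewrite /complete_rel eq_sym. Qed.
Lemma complete_irr : irreflexive complete_rel.
Proof. by move=> x; rewrite /complete_rel eqxx. Qed.
Definition complete : sgraph 'I_m := SGraph complete_sym complete_irr.

Definition pathg_rel : rel 'I_m :=
  fun x y => (x.+1 == y :> nat) || (y.+1 == x :> nat).
Lemma pathg_sym : symmetric pathg_rel.
Proof. by move=> x y; rewrite /pathg_rel orbC. Qed.
Lemma pathg_irr : irreflexive pathg_rel.
Proof. by move=> x; rewrite /pathg_rel orbb gtn_eqF. Qed.
Definition pathg : sgraph 'I_m := SGraph pathg_sym pathg_irr.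

End Basic.

Definition complete_bipartite (n1 n2 : nat) : sgraph ('I_n1 + 'I_n2)%type :=
  join (edgeless n1) (edgeless n2).

Definition degree (V : finType) (G : sgraph V) (x : V) : nat :=
  #|[set y | G x y]%SET|.

Definition regular (V : finType) (d : nat) (G : sgraph V) : Prop :=
  forall x, degree G x = d.

Definition nearly_regular (V : finType) (d : nat) (G : sgraph V) : Prop :=
  exists2 v, (degree G v).+1 = d & forall x, x != v -> degree G x = d.

(* The family K_{n1,n2}^d(F); the part V_1 is the left summand. *)
Definition bip_family (n1 n2 d : nat) (U : finType) (F : sgraph U) :
    set (sgraph ('I_n1 + 'I_n2)%type) :=
  [set H : sgraph _ |
    [/\ forall x y, complete_bipartite n1 n2 x y -> H x y,
        forall j j' : 'I_n2, ~~ H (inr j) (inr j'),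
        gfree F (induced (fun i : 'I_n1 => inl i) H)
      & regular d (induced (fun i : 'I_n1 => inl i) H) \/
        nearly_regular d (induced (fun i : 'I_n1 => inl i) H)]].
Arguments bip_family : clear implicits.
Arguments bip_family n1 n2 d {U} F.

Section Spectral.
Variable R : realType.

Definition adj_mx (n : nat) (G : sgraph 'I_n) : 'M[R]_n :=
  \matrix_(i, j) ((G i j)%:R)%R.

(* A real symmetric matrix has a finite spectrum, nonempty when n > 0, so this
   supremum is the largest eigenvalue. *)
Definition spectral_radius (n : nat) (G : sgraph 'I_n) : R :=
  sup [set a | eigenvalue (adj_mx G) a].

(* There are finitely many graphs on 'I_n, so this supremum is a maximum
   whenever an F-free graph of order n exists. *)
Definition spex (n : nat) (U : finType) (F : sgraph U) : R :=
  sup [set spectral_radius G | G in [set G : sgraph 'I_n | gfree F G]].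

Definition Spex (n : nat) (U : finType) (F : sgraph U) : set (sgraph 'I_n) :=
  [set G | gfree F G /\ spectral_radius G = spex n F].

End Spectral.
Arguments spex R n {U} F.
Arguments Spex R n {U} F.

(* n_1 is the order of the part that carries the added edges; t = 1 here. *)
Definition part_sizes_one (k n : nat) : seq nat :=
  if odd k then
    if odd n then [:: (n - 1)./2; (n + 1)./2] else [:: n./2]
  else
    match n %% 4 with
    | 0 => [:: n./2]
    | 1 => [:: (n - 1)./2]
    | 2 => [:: n./2 - 1; n./2 + 1]
    | _ => [:: (n + 1)./2]
    end.

(* t >= 2; uphalf m is the ceiling of m / 2. *)
Definition part_size_many (t k n : nat) : nat :=
  if odd k then uphalf (n - t + 1)
  else
    match (n - t) %% 4 with
    | 0 => (n - t + 1)./2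
    | 1 => uphalf (n - t + 2)
    | _ => uphalf (n - t + 1)
    end.

Definition part_sizes (t k n : nat) : seq nat :=
  if t == 1 then part_sizes_one k n else [:: part_size_many t k n].

(* Main.v *)
(* Write [s = t - 1], let [x] be a nonnegative eigenvector of the extremal graph
   [G] for its spectral radius [rho], and call a copy of [P_1 \/ P_{2k}] a fan.
   By the Rayleigh principle no graph of order [n] without [t] disjoint fans has
   a Rayleigh quotient above [rho]; all structure is extracted by comparing [G]
   with explicit competitors.

   Removing a maximal packing of fans leaves neighbourhoods free of [P_{2k}],
   hence sparse, and counting walks of length two then yields a cut of [G] with
   [n^2/4 - O(n)] edges.  So up to boundedly many vertices [G] is bipartite with
   almost equal parts and almost constant eigenvector entries.  A vertex with
   linearly many neighbours in both parts lies on many fans; moving vertices and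
   making vertices dominating shows that there are exactly [s] of these, that
   they are dominating, and that every other vertex joins a part [V1] or [V2],
   with fewer than [k] neighbours in its own part and fewer than [k]
   non-neighbours in the other.

   If both parts had inner edges, fans built from stars or matchings of one part
   and paths zigzagging between the parts would leave too few inner edges to
   compete with [K_s] joined to a complete bipartite graph carrying a
   [(k-1)]-regular [P_{2k}]-free graph on one part.  So say [V2] is independent;
   then all cross edges are present.

   Finally [x] is constant on [V2] and on the dominating vertices, and the test
   vector that keeps these two values against a competitor with [|V1| + j]
   vertices in the regular part gives, with [g = |V2| - |V1|] and [E] the
   weighted degree defect of [V1], an inequality whose main term is
   [j (g - j) + E <= 0].  Choosing [j] among [0, 1, -1, 2, -2] subject to the
   parity of [(|V1| + j)(k - 1)] forces [E = 0] and leaves only the listed sizes;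
   for [t >= 2] a lower-order term from the dominating vertices breaks the tie. *)
Require Import Defs.
From mathcomp Require Import all_boot all_order all_algebra.
From mathcomp Require Import boolp classical_sets reals.
From mathcomp Require Import topology normedtype derive.
From mathcomp Require Import fintype finset lra zify.

Set Implicit Arguments.
Unset Strict Implicit.
Unset Printing Implicit Defensive.

Import Order.TTheory GRing.Theory Num.Theory.
Import numFieldNormedType.Exports.

Local Open Scope ring_scope.


(** * Spectral radius and Rayleigh quotients *)

(** Every competitor must again contain no [t] disjoint fans. This is certified by fewer than [t]
    vertices that meet all fans, or by carrying a packing of the competitor back to [G], or by both
    together. Carrying back works because a packing covers boundedly many vertices: each altered
    vertex is exchanged for a typical vertex that sees the same covered vertices. So changes can be
    made at vertices whose own neighbourhoods are not yet understood.

    Two cases have no slack in the leading term. For [k = 3], perfect matchings in both parts have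
    as many inner edges as a 2-regular graph on one part, so the edge count that settles [k >= 4]
    gives way to a finer test vector. For parts of equal size [n1] with [n1 (k - 1)] odd, the shift
    [j = 1] has main term [E - 1], while a single vertex of degree [k - 2] has a defect close to
    [1]; its entry must be shown to exceed the entry on [V2].

    Positivity of the eigenvector also comes from moving vertices: a vertex with too small an entry
    could be moved with profit. *)

Section AdjacencyForm.
Variables (R : realType) (T : finType).
Implicit Types (G : sgraph T) (x y : T -> R) (A B : {set T}).

Definition nbr G u : {set T} := [set v | G u v]%SET.

Definition wt x A : R := \sum_(u in A) x u.

Definition bform G x y : R := \sum_u x u * wt y (nbr G u).

Definition sqn x : R := \sum_u x u ^+ 2.

Lemma in_nbr G u v : (v \in nbr G u) = G u v.
Proof. by rewrite inE. Qed.

Lemma wt_nbr G x u : wt x (nbr G u) = \sum_v (G u v)%:R * x v.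
Proof.
rewrite /wt big_mkcond; apply: eq_bigr => v _; rewrite inE.
by case: (G u v); rewrite ?mul1r ?mul0r.
Qed.

Lemma bformE G x y : bform G x y = \sum_u \sum_v (G u v)%:R * (x u * y v).
Proof.
apply: eq_bigr => u _; rewrite wt_nbr mulr_sumr; apply: eq_bigr => v _.
by rewrite mulrCA.
Qed.

Lemma bform_sym G x y : bform G x y = bform G y x.
Proof.
rewrite !bformE exchange_big; apply: eq_bigr => u _; apply: eq_bigr => v _.
by rewrite adj_sym [x v * _]mulrC.
Qed.

Lemma bformD G x y z : bform G (fun u => x u + y u) z = bform G x z + bform G y z.
Proof. by rewrite /bform -big_split; apply: eq_bigr => u _; rewrite mulrDl. Qed.

Lemma bformZ G a x z : bform G (fun u => a * x u) z = a * bform G x z.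
Proof. by rewrite /bform mulr_sumr; apply: eq_bigr => u _; rewrite mulrA. Qed.

Lemma bform_delta G w y : bform G (fun u => (u == w)%:R) y = wt y (nbr G w).
Proof.
rewrite /bform (bigD1 w) //= eqxx mul1r big1 ?addr0 // => u /negbTE ->.
by rewrite mul0r.
Qed.

Lemma sqn_ge0 x : 0 <= sqn x.
Proof. by apply: sumr_ge0 => u _; apply: sqr_ge0. Qed.

Lemma sqn_eq0 x : sqn x = 0 -> forall u, x u = 0.
Proof.
move=> /eqP; rewrite psumr_eq0; last by move=> u _; apply: sqr_ge0.
by move=> /allP h u; apply/eqP; rewrite -sqrf_eq0; apply: h; rewrite mem_index_enum.
Qed.

Lemma sqn_pos x u : x u != 0 -> 0 < sqn x.
Proof.
move=> h; rewrite lt_neqAle sqn_ge0 andbT; apply/eqP => /esym /sqn_eq0 e.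
by rewrite e eqxx in h.
Qed.

Lemma bform_abs G x : bform G x x <= bform G (fun u => `|x u|) (fun u => `|x u|).
Proof.
rewrite !bformE; apply: ler_sum => u _; apply: ler_sum => v _.
by apply: ler_wpM2l => //; rewrite -normrM ler_norm.
Qed.

Lemma bform_shift G c w eps :
  bform G (fun u => c u + eps * (u == w)%:R) (fun u => c u + eps * (u == w)%:R) =
  bform G c c + 2 * eps * wt c (nbr G w).
Proof.
rewrite bformD bformZ bform_delta [bform G c _]bform_sym bformD bformZ bform_delta.
have -> : wt (fun u => c u + eps * (u == w)%:R) (nbr G w) = wt c (nbr G w); last by lra.
apply: eq_bigr => u; rewrite inE => h.
by case: eqP => [uw|]; rewrite ?mulr0 ?addr0 //; rewrite uw adj_irr in h.
Qed.

Lemma sqn_shift c w eps :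
  sqn (fun u => c u + eps * (u == w)%:R) = sqn c + 2 * eps * c w + eps ^+ 2.
Proof.
rewrite /sqn (bigD1 w) //= [in RHS](bigD1 w) //= eqxx mulr1.
under eq_bigr => u /negbTE -> do rewrite mulr0 addr0.
by lra.
Qed.

(** Varying one coordinate suffices: with [a] the error of the eigenvalue equation at [w], a change
    by [eps] gains [2 * eps * a] in the form and raises the bound by only [rho * eps ^+ 2] beyond
    the matching linear term. *)
Lemma rayleigh_max_eigen G rho c :
  (forall y, bform G y y <= rho * sqn y) -> bform G c c = rho * sqn c ->
  forall w, wt c (nbr G w) = rho * c w.
Proof.
move=> hmax hc w; set a := wt c (nbr G w) - rho * c w.
have key eps : 2 * eps * a <= rho * eps ^+ 2.
  have := hmax (fun u => c u + eps * (u == w)%:R).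
  by rewrite bform_shift sqn_shift hc /a; nra.
suff a0 : a = 0 by apply/eqP; rewrite -subr_eq0; apply/eqP.
have r1 : 0 < `|rho| + 1 by rewrite ltr_wpDl.
(* A change by [a * r] is small enough for the linear gain to beat the quadratic cost, whatever the
   sign of [rho]. *)
set r := (`|rho| + 1)^-1.
have r0 : 0 < r by rewrite invr_gt0.
have rr : (`|rho| + 1) * r = 1 by rewrite divff ?gt_eqF.
have rho1 : rho * r <= 1.
  by rewrite -rr ler_pM2r //; have := ler_norm rho; lra.
have ka := key (a * r).
have a2 : 0 <= a ^+ 2 * r by rewrite mulr_ge0 ?sqr_ge0 // ltW.
have a3 : rho * r * (a ^+ 2 * r) <= 1 * (a ^+ 2 * r) by apply: ler_wpM2r.
have : a ^+ 2 * r <= 0 by lra.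
by rewrite pmulr_lle0 // => h; apply/eqP; rewrite -sqrf_eq0 eq_le h sqr_ge0.
Qed.

End AdjacencyForm.

Section SpectralRadius.
Variables (R : realType).

Lemma eigenvalue_adj n (G : sgraph 'I_n) (a : R) :
  eigenvalue (adj_mx R G) a <->
  exists2 x : 'I_n -> R, (exists u, x u != 0) & forall u, wt x (nbr G u) = a * x u.
Proof.
have mulE (v : 'rV[R]_n) j : (v *m adj_mx R G) 0 j = wt (v 0) (nbr G j).
  by rewrite !mxE wt_nbr; apply: eq_bigr => i _; rewrite mxE adj_sym mulrC.
split.
  move=> /eigenvalueP [v hv v0]; exists (v 0); last first.
    by move=> u; rewrite -mulE hv mxE.
  by have /rV0Pn [j hj] := v0; exists j.
move=> [x [u xu] hx]; apply/eigenvalueP; exists (\row_i x i).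
  apply/rowP => j; rewrite mulE mxE mxE -hx.
  by apply: eq_bigr => i _; rewrite mxE.
by apply/rV0Pn; exists u; rewrite mxE.
Qed.

(** The unit sphere is closed in the cube [[-1, 1]^n], so the form has a maximiser on it;
    homogeneity extends the bound to all vectors. *)
Lemma rayleigh_attained n (G : sgraph 'I_n) : (0 < n)%N ->
  exists2 c : 'I_n -> R, sqn c = 1 &
    forall y, bform G y y <= bform G c c * sqn y.
Proof.
move=> n0.
pose S := [set v : 'rV[R]_n | sqn (v 0) = 1]%classic.
pose f (v : 'rV[R]_n) : R := bform G (v 0) (v 0).
have coordC i : continuous (fun v : 'rV[R]_n => v 0 i) by exact: coord_continuous.
have addC : continuous (fun z : R * R => z.1 + z.2) by exact: add_continuous.
have fC : continuous f.
  have -> : f = fun v => \sum_u \sum_w (G u w)%:R * (v 0 u * v 0 w).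
    by apply/funext => v; exact: bformE.
  apply: (@continuous_big _ _ _ 0 predT addC) => u _.
  apply: (@continuous_big _ _ _ 0 predT addC) => w _ v.
  have h : {for v, continuous (fun v : 'rV[R]_n => v 0 u * v 0 w)}.
    apply: (@continuousM _ _ (fun v : 'rV[R]_n => v 0 u) (fun v : 'rV[R]_n => v 0 w)); exact: coordC.
  apply: (@continuousM _ _ (fun=> (G u w)%:R) _ v _ h); exact: cst_continuous.
have sC : continuous (fun v : 'rV[R]_n => sqn (v 0)).
  apply: (@continuous_big _ _ _ 0 predT addC) => u _ v.
  apply: (@continuousM _ _ (fun v : 'rV[R]_n => v 0 u) (fun v : 'rV[R]_n => v 0 u)); exact: coordC.
have Sclosed : closed S.
  apply: (@preimage_closed _ _ (fun v : 'rV[R]_n => sqn (v 0)) [set z | z = 1]%classic).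
    by move=> v _; exact: sC.
  exact: closed_eq.
have Scompact : compact S.
  have box : compact [set v : 'rV[R]_n | forall i, (v ord0 i \in `[(-1), 1])%R]%classic.
    have := @rV_compact R n (fun=> `[(-1), 1]%classic) (fun=> @segment_compact R (-1) 1).
    exact.
  apply: subclosed_compact Sclosed box _ => v Sv i; rewrite in_itv /=.
  have : (v 0 i) ^+ 2 <= 1.
    rewrite -[X in _ <= X]Sv /sqn (bigD1 i) //= lerDl.
    by apply: sumr_ge0 => j _; apply: sqr_ge0.
  by rewrite -ler_norml => h; rewrite -(@ler_sqr R) ?nnegrE // real_normK ?num_real // expr1n.
have Sne : (S !=set0)%classic.
  exists (\row_i (i == Ordinal n0)%:R) => /=.
  rewrite /S /= /sqn (bigD1 (Ordinal n0)) //= mxE eqxx expr1n big1 ?addr0 // => i /negbTE h.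
  by rewrite mxE h expr0n.
have [v Sv vmax] := EVT_max_rV Sne Scompact (continuous_subspaceT fC).
exists (v 0) => [|y]; first exact: set_mem Sv.
have [y0 | ypos] := boolP [forall u, y u == 0].
  have y0' u : y u = 0 by apply/eqP; move/forallP: y0.
  have -> : bform G y y = 0 by apply: big1 => u _; rewrite y0' mul0r.
  have -> : sqn y = 0 by apply: big1 => u _; rewrite y0' expr0n.
  by rewrite mulr0.
have sp : 0 < sqn y.
  by move: ypos; rewrite negb_forall => /existsP [u hu]; exact: sqn_pos hu.
pose r := (Num.sqrt (sqn y))^-1.
have r2 : r ^+ 2 * sqn y = 1.
  by rewrite /r exprVn sqr_sqrtr ?sqn_ge0 // mulVf // gt_eqF.
have : f (\row_i (r * y i)) <= f v.
  apply: vmax; apply/mem_set; rewrite /S /= -r2 /sqn mulr_sumr; apply: eq_bigr => i _.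
  by rewrite mxE exprMn.
have -> : f (\row_i (r * y i)) = r ^+ 2 * bform G y y.
  rewrite /f !bformE mulr_sumr; apply: eq_bigr => i _.
  rewrite mulr_sumr; apply: eq_bigr => j _; rewrite !mxE; lra.
rewrite -/(f v) => h.
by rewrite -(ler_pM2l (_ : 0 < r ^+ 2)) ?exprn_gt0 ?invr_gt0 ?sqrtr_gt0 // mulrCA r2 mulr1.
Qed.

(** A maximiser [c] of the Rayleigh quotient is an eigenvector whose value bounds every eigenvalue.
    Taking absolute values does not lower the form, so [|c|] is a maximiser as well, hence a
    nonnegative eigenvector. *)
Lemma spectral_radiusP n (G : sgraph 'I_n) : (0 < n)%N ->
  (forall y, bform G y y <= spectral_radius R G * sqn y) /\
  exists x : 'I_n -> R, [/\ forall u, 0 <= x u, exists u, x u != 0 &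
    forall u, wt x (nbr G u) = spectral_radius R G * x u].
Proof.
move=> n0; have [c c1 cmax] := rayleigh_attained G n0.
have ceig := rayleigh_max_eigen cmax (esym (etrans (congr1 _ c1) (mulr1 _))).
have cn0 : exists u, c u != 0.
  apply: contrapT => /forallNP h; have : sqn c = 0.
    by apply: big1 => u _; have /negP := h u; rewrite negbK => /eqP ->; rewrite expr0n.
  by rewrite c1 => /eqP; rewrite oner_eq0.
have -> : spectral_radius R G = bform G c c.
  have ub : ubound [set a | eigenvalue (adj_mx R G) a]%classic (bform G c c).
    move=> a /eigenvalue_adj [y [u yu] ye].
    rewrite -(ler_pM2r (sqn_pos yu)); apply: le_trans (cmax y).
    rewrite /bform /sqn mulr_sumr le_eqVlt; apply/orP; left; apply/eqP.
    by apply: eq_bigr => v _; rewrite ye; lra.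
  have eg : [set a | eigenvalue (adj_mx R G) a]%classic (bform G c c).
    by apply/eigenvalue_adj; exists c.
  apply/eqP; rewrite eq_le; apply/andP; split.
    by apply: ge_sup => //; exists (bform G c c).
  by apply: ub_le_sup => //; exists (bform G c c).
split=> //.
have absE : bform G (fun u => `|c u|) (fun u => `|c u|) =
    bform G c c * sqn (fun u => `|c u|).
  apply/eqP; rewrite eq_le cmax /=.
  have -> : sqn (fun u => `|c u|) = 1.
    by rewrite -c1; apply: eq_bigr => u _; rewrite real_normK ?num_real.
  by rewrite mulr1 bform_abs.
exists (fun u => `|c u|); split=> //.
- by have [u hu] := cn0; exists u; rewrite normr_eq0.
- exact: rayleigh_max_eigen absE.
Qed.

(** A crude bound read off at the largest entry; it makes the set behind [spex] bounded, so that its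
    supremum is an upper bound. *)
Lemma spectral_radius_le n (G : sgraph 'I_n) : (0 < n)%N ->
  spectral_radius R G <= n%:R.
Proof.
move=> n0; have [_ [x [x0 [w xw] xe]]] := spectral_radiusP G n0.
have [u _ umax] := @arg_maxP _ _ _ w predT x isT.
have xu : 0 < x u by apply: lt_le_trans (umax w isT); rewrite lt_neqAle eq_sym xw x0.
rewrite -(ler_pM2r xu) -xe /wt.
apply: le_trans (_ : \sum_(v in nbr G u) x u <= _).
  by apply: ler_sum => v _; exact: umax.
rewrite sumr_const -(mulr_natl (x u)) ler_wpM2r // ler_nat.
by rewrite -[X in (_ <= X)%N](card_ord n) max_card.
Qed.

Lemma spex_le n (U : finType) (F : sgraph U) (G : sgraph 'I_n) : (0 < n)%N ->
  gfree F G -> spectral_radius R G <= spex R n F.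
Proof.
move=> n0 h; apply: ub_le_sup; last by exists G.
by exists n%:R => _ [G' _ <-]; exact: spectral_radius_le.
Qed.

End SpectralRadius.

(** * Regular graphs without long paths *)

Section RegularGraphs.
Local Open Scope nat_scope.

Definition no_path (T : finType) (G : sgraph T) (m : nat) :=
  forall p : seq T, uniq p -> sorted G p -> size p < m.

Lemma degree_sum (T : finType) (G : sgraph T) x : degree G x = \sum_y G x y.
Proof.
rewrite /degree -sum1_card big_mkcond; apply: eq_bigr => y _.
by rewrite inE; case: (G x y).
Qed.

Section Circulant.
Variables m d : nat.

(** Steps of a circulant graph of degree [d]: the [d./2] nearest residues on either side and, for
    odd [d], the antipode, which exists only for even [m]. *)
Definition circ_step (c : nat) : bool :=
  (0 < c) && [|| c <= d./2, m - c <= d./2 | odd d && (c.*2 == m)].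

Definition circ_rel : rel 'I_m := fun i j => circ_step ((i + m - j) %% m).

Lemma circ_diff (i j : 'I_m) : i != j ->
  (j + m - i) %% m = m - (i + m - j) %% m /\ 0 < (i + m - j) %% m.
Proof.
move=> ij; have {}ij : (i : nat) <> j by move=> e; case/eqP: ij; apply: val_inj.
have hi := ltn_ord i; have hj := ltn_ord j.
have aux (a b : nat) : a < m -> b < m -> (a + m - b) %% m = if b <= a then a - b else a + m - b.
  move=> ha hb; case: leqP => h; last by rewrite modn_small //; lia.
  by rewrite -addnBAC // modnDr modn_small //; lia.
by rewrite !aux //; case: (leqP i j) => h1; case: (leqP j i) => h2; lia.
Qed.

Lemma circ_irr : irreflexive circ_rel.
Proof. by move=> i; rewrite /circ_rel addnC addnK modnn. Qed.

Lemma circ_sym : symmetric circ_rel.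
Proof.
move=> i j; have [->//|ij] := eqVneq i j.
rewrite /circ_rel; have [-> h] := circ_diff ij.
have h2 : (i + m - j) %% m < m by rewrite ltn_mod; case: m i {j h ij} => [[]|].
rewrite /circ_step; move: {ij}(_ %% _) h h2 => c h h2.
have -> : m - (m - c) = c by lia.
rewrite h subn_gt0 h2 /= orbCA; congr [|| _, _ | _ && _].
by apply/eqP/eqP; lia.
Qed.

Definition circulant : sgraph 'I_m := SGraph circ_sym circ_irr.

Lemma circ_step_count : d < m -> ~~ odd (m * d) -> count circ_step (iota 0 m) = d.
Proof.
move=> dm; rewrite oddM => par; set h := d./2.
have hd : d = odd d + h.*2 by rewrite odd_double_half.
(* Residues are cut into [0], the [h] short forward steps, the middle, and the [h] short backward
   steps; in the middle only the antipode can count. *)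
have -> : iota 0 m = iota 0 1 ++ iota 1 h ++ iota h.+1 (m - h.*2.+1) ++ iota (m - h) h.
  have {1}-> : m = 1 + (h + ((m - h.*2.+1) + h)) by lia.
  rewrite iotaD iotaD iotaD; congr (_ ++ (_ ++ (_ ++ iota _ _))); lia.
rewrite !count_cat /= add0n.
have -> : count circ_step (iota 1 h) = h.
  rewrite -[RHS](size_iota 1); apply/eqP; rewrite -all_count; apply/allP => c.
  by rewrite mem_iota => hc; rewrite /circ_step -/h; apply/andP; split; [lia | apply/orP; left; lia].
have -> : count circ_step (iota (m - h) h) = h.
  rewrite -[RHS](size_iota (m - h)); apply/eqP; rewrite -all_count; apply/allP => c.
  rewrite mem_iota => hc; rewrite /circ_step -/h; apply/andP; split; first lia.
  by apply/or3P; apply: Or32; lia.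
have -> : count circ_step (iota h.+1 (m - h.*2.+1)) = odd d.
  rewrite (@eq_in_count _ _ (fun c => odd d && (c == m./2))); last first.
    move=> c; rewrite mem_iota => hc; rewrite /circ_step -/h.
    have -> : (0 < c) = true by lia.
    have -> : (c <= h) = false by lia.
    have -> : (m - c <= h) = false by lia.
    rewrite /=; case od: (odd d) => //=.
    have mo : ~~ odd m by rewrite od andbT in par.
    by apply/eqP/eqP => [<-|->]; rewrite ?doubleK // halfK (negbTE mo) subn0.
  case od: (odd d) => /=; last by rewrite count_pred0.
  rewrite (count_uniq_mem _ (iota_uniq _ _)) mem_iota.
  rewrite od andbT in par; rewrite od in hd.
  have : m = m./2.*2 by rewrite halfK (negbTE par) subn0.
  move=> mE; apply/eqP; rewrite eqb1; lia.
by rewrite /circ_step /=; lia.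
Qed.

Lemma degree_circulant i : d < m -> ~~ odd (m * d) -> degree circulant i = d.
Proof.
move=> dm par; rewrite -[RHS](circ_step_count dm par).
have m0 : 0 < m by lia.
pose g (j : 'I_m) := Ordinal (ltn_pmod (i + m - j) m0).
have ginj : injective g.
  move=> j j' /(congr1 val) /= e; apply: val_inj => /=.
  have hi := ltn_ord i; have hj := ltn_ord j; have hj' := ltn_ord j'.
  have : (i + m - j + (j + j')) %% m = (i + m - j' + (j + j')) %% m by rewrite -modnDml e modnDml.
  have -> : i + m - j + (j + j') = j' + i + m by lia.
  have -> : i + m - j' + (j + j') = j + i + m by lia.
  rewrite !modnDr; move: (j : nat) (j' : nat) (i : nat) hi hj hj' => a b c hi hj hj'.
  move=> /eqP; rewrite eqn_modDr => /eqP; by rewrite !modn_small.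
transitivity (\sum_(c < m) circ_step c).
  by rewrite degree_sum [RHS](reindex_inj ginj).
have -> : iota 0 m = index_iota 0 m by rewrite /index_iota subn0.
by rewrite -sum1_count [RHS]big_mkcond big_mkord; apply: eq_bigr => c _; case: circ_step.
Qed.

End Circulant.

Definition union_rel (U V : finType) (G : sgraph U) (H : sgraph V) : rel (U + V)%type :=
  fun x y => match x, y with
  | inl a, inl b => G a b
  | inr a, inr b => H a b
  | _, _ => false
  end.

Lemma union_sym (U V : finType) (G : sgraph U) (H : sgraph V) : symmetric (union_rel G H).
Proof. by move=> [a|a] [b|b] //=; rewrite adj_sym. Qed.

Lemma union_irr (U V : finType) (G : sgraph U) (H : sgraph V) : irreflexive (union_rel G H).
Proof. by move=> [a|a] /=; rewrite adj_irr. Qed.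

Definition union (U V : finType) (G : sgraph U) (H : sgraph V) : sgraph (U + V)%type :=
  SGraph (union_sym G H) (union_irr G H).

Lemma degree_union_inl (U V : finType) (G : sgraph U) (H : sgraph V) x :
  degree (union G H) (inl x) = degree G x.
Proof. by rewrite !degree_sum big_sumType /= [X in _ + X]big1 ?addn0. Qed.

Lemma degree_union_inr (U V : finType) (G : sgraph U) (H : sgraph V) x :
  degree (union G H) (inr x) = degree H x.
Proof. by rewrite !degree_sum big_sumType /= [X in X + _]big1 ?add0n. Qed.

Lemma no_path_union (U V : finType) (G : sgraph U) (H : sgraph V) m :
  no_path G m -> no_path H m -> no_path (union G H) m.
Proof.
move=> hG hH [|[a|a] p] up sp.
- exact: (hG [::]).
- have [q pE] : exists q, p = map inl q.
    move: sp {up}; rewrite /=; elim: p a => [|[b|b] p IH] a //=; first by exists [::].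
    by case/andP=> _ /IH [q ->]; exists (b :: q).
  rewrite pE -[_ :: _]/(map inl (a :: q)) size_map; apply: hG.
    by move: up; rewrite pE -[_ :: _]/(map inl (a :: q)) map_inj_uniq // => x y [].
  by move: sp; rewrite pE /= path_map.
- have [q pE] : exists q, p = map inr q.
    move: sp {up}; rewrite /=; elim: p a => [|[b|b] p IH] a //=; first by exists [::].
    by case/andP=> _ /IH [q ->]; exists (b :: q).
  rewrite pE -[_ :: _]/(map inr (a :: q)) size_map; apply: hH.
    by move: up; rewrite pE -[_ :: _]/(map inr (a :: q)) map_inj_uniq // => x y [].
  by move: sp; rewrite pE /= path_map.
Qed.

Lemma no_path_small (T : finType) (G : sgraph T) m : #|T| < m -> no_path G m.
Proof. by move=> h p /card_uniqP <- _; apply: leq_ltn_trans h; exact: max_card. Qed.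

(** Copies of [K_k] are split off until fewer than [2k] vertices remain, where a circulant graph is
    too small to hold the path. Since [k * k.-1] is even, the parity condition survives each
    step. *)
Lemma regular_no_path_exists k N : 0 < k <= N -> ~~ odd (N * k.-1) ->
  exists (T : finType) (G : sgraph T),
    [/\ #|T| = N, regular k.-1 G & no_path G k.*2].
Proof.
have [b] := ubnP N; elim: b N => // b IH N Nb /andP [k0 kN] par.
case: (ltnP N k.*2) => N2.
  exists 'I_N, (circulant N k.-1); split; first exact: card_ord.
    by move=> x; apply: degree_circulant => //; lia.
  by apply: no_path_small; rewrite card_ord.
have [|||T [G [cT rG pG]]] := IH (N - k).
- lia.
- lia.
- have -> : odd ((N - k) * k.-1) = odd (N * k.-1); last by [].
  by rewrite mulnBl oddB ?leq_mul2r ?kN ?orbT // oddM -[odd (k * _)]negbK;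
    case: k k0 {IH kN par N2} => //= k _; rewrite oddM /=; case: (odd k); rewrite /= ?andbF ?addbF.
have pk : ~~ odd (k * k.-1) by case: k k0 {IH kN par N2 rG pG cT} => //= k _; rewrite oddM /=;
  case: (odd k).
exists (T + 'I_k)%type, (union G (circulant k k.-1)); split.
- by rewrite card_sum cT card_ord subnK.
- move=> [x|x]; first by rewrite degree_union_inl.
  by rewrite degree_union_inr degree_circulant //; lia.
- by apply: no_path_union => //; apply: no_path_small; rewrite card_ord; lia.
Qed.

(** If parity forbids regularity on [N] vertices, an isolated vertex is added to a regular graph on
    [N.-1] vertices. *)
Lemma bounded_no_path_exists k N : 0 < k < N ->
  exists (T : finType) (G : sgraph T),
    [/\ #|T| = N, forall x, degree G x <= k.-1,
        N.-1 * k.-1 <= \sum_x degree G x & no_path G k.*2].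
Proof.
move=> /andP [k0 kN]; have [par|par] := boolP (odd (N * k.-1)); last first.
  have [||T [G [cT rG pG]]] := @regular_no_path_exists k N; [lia|by []|].
  exists T, G; split=> //; first by move=> x; rewrite rG.
  under eq_bigr do rewrite rG.
  by rewrite sum_nat_const cT leq_mul2r leq_pred orbT.
have [||T [G [cT rG pG]]] := @regular_no_path_exists k N.-1; first lia.
  by move: par; case: (N) kN => //= M _; rewrite !oddM /= => /andP [/negbTE ->].
exists (T + 'I_1)%type, (union G (edgeless 1)); split.
- by rewrite card_sum cT card_ord; lia.
- move=> [x|x]; first by rewrite degree_union_inl rG.
  by rewrite degree_union_inr degree_sum big1.
- rewrite big_sumType /=; under eq_bigr do rewrite degree_union_inl rG.
  by rewrite sum_nat_const cT leq_addr.
- by apply: no_path_union => //; apply: no_path_small; rewrite card_ord; lia.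
Qed.

End RegularGraphs.

(** * Fans and packings *)

Section Fans.
Local Open Scope nat_scope.
Variables (k : nat).

(* [c :: p] lists a copy of [P_1 \/ P_{2k}]: its centre, then its path. *)
Definition isfan (T : finType) (G : sgraph T) (A : {set T}) (w : seq T) : bool :=
  if w is c :: p then
    [&& uniq w, size p == k.*2, sorted G p, all (G c) p & all [in A] w]
  else false.

Definition packing (T : finType) (G : sgraph T) (A : {set T}) (L : seq (seq T)) : bool :=
  all (isfan G A) L && uniq (flatten L).

Lemma size_fan (T : finType) (G : sgraph T) A w : isfan G A w -> size w = k.*2.+1.
Proof. by case: w => // c p /and5P [_ /eqP h _ _ _] /=; rewrite h. Qed.

Lemma size_flatten_packing (T : finType) (G : sgraph T) A L :
  packing G A L -> size (flatten L) = size L * k.*2.+1.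
Proof.
case/andP=> h _; elim: L h => //= w L IH /andP [hw hL].
by rewrite size_cat (size_fan hw) IH // mulSn.
Qed.

Lemma fan_sub (T : finType) (G : sgraph T) (A : {set T}) w x :
  isfan G A w -> x \in w -> x \in A.
Proof. by case: w => // c p /and5P [_ _ _ _ /allP h]; exact: h. Qed.

Lemma packing_sub (T : finType) (G : sgraph T) (A : {set T}) L x :
  packing G A L -> x \in flatten L -> x \in A.
Proof.
move=> /andP [/allP h _] /flattenP [w wL xw]; exact: fan_sub (h _ wL) xw.
Qed.

Lemma fan_subset (T : finType) (G : sgraph T) (A B : {set T}) w :
  isfan G A w -> {in w, forall x, x \in B} -> isfan G B w.
Proof.
by case: w => // c p /and5P [h1 h2 h3 h4 _] h; apply/and5P; split=> //; apply/allP.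
Qed.

Lemma packing_subset (T : finType) (G : sgraph T) (A B : {set T}) L :
  packing G A L -> {subset A <= B} -> packing G B L.
Proof.
move=> pL AB; case/andP: (pL) => /allP h u; rewrite /packing u andbT; apply/allP => w wL.
by apply: fan_subset (h _ wL) _ => x xw; apply: AB; exact: fan_sub (h _ wL) xw.
Qed.

Lemma fan_of_path (T : finType) (G : sgraph T) (A : {set T}) v p :
  v \in A -> {in p, forall x, G v x /\ x \in A} -> uniq p -> sorted G p ->
  k.*2 <= size p -> isfan G A (v :: take k.*2 p).
Proof.
move=> vA hp up sp szp; have sub x : x \in take k.*2 p -> x \in p by exact: mem_take.
apply/and5P; split.
- rewrite /= take_uniq // andbT.
  by apply/negP => /sub /hp [h _]; rewrite adj_irr in h.
- by rewrite size_takel.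
- exact: take_sorted.
- by apply/allP => x /sub /hp [].
- by rewrite /= vA; apply/allP => x /sub /hp [].
Qed.

Lemma uniq_flatten_nth (T : eqType) (L : seq (seq T)) i j x :
  uniq (flatten L) -> x \in nth [::] L i -> x \in nth [::] L j -> i = j.
Proof.
have mem M l : x \in nth [::] M l -> x \in flatten M.
  move=> h; apply/flattenP; exists (nth [::] M l) => //; rewrite mem_nth // ltnNge.
  by apply/negP => hl; rewrite nth_default in h.
elim: L i j => [|w L IH] [|i] [|j] //=; rewrite cat_uniq => /and3P [_ /hasPn h u].
- by move=> xw /mem /h; rewrite /= xw.
- by move=> /mem /h /= xw; rewrite (negbTE xw).
- by move=> xi xj; congr S; exact: IH xi xj.
Qed.

(** With its converse [packing_gfree], this replaces embeddings of [t] fans by lists of disjoint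
    fans, on which all later surgery is done. *)
Lemma gfree_packing (T : finType) (G : sgraph T) t : 0 < t ->
  gfree (copies t (join (pathg 1) (pathg k.*2))) G ->
  forall L, packing G [set: T]%SET L -> size L < t.
Proof.
move=> t0 free L pL; rewrite ltnNge; apply/negP => tL; apply: free.
case/andP: (pL) => /allP hL uL.
have fanL i : i < t -> isfan G [set: T]%SET (nth [::] L i).
  by move=> it; apply: hL; apply: mem_nth; exact: leq_trans it tL.
have x0 : T by case: L {pL hL uL fanL} tL (fanL 0 t0) => [|[|x w] L] //; rewrite leqNgt t0.
pose idx (u : 'I_1 + 'I_k.*2) : nat := match u with inl _ => 0 | inr j => j.+1 end.
have idx_lt u : idx u < k.*2.+1 by case: u => //= j; exact: ltn_ord.
have idx_inj : injective idx.
  move=> [a|a] [b|b] //= => [_|[e]]; first by rewrite [a]ord1 [b]ord1.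
  by congr inr; apply: val_inj.
pose f (z : 'I_t * ('I_1 + 'I_k.*2)) := nth x0 (nth [::] L z.1) (idx z.2).
have memf z : f z \in nth [::] L z.1.
  by apply: mem_nth; rewrite (size_fan (fanL _ (ltn_ord z.1))).
exists f.
  move=> [i a] [j b] e; have ij : i = j.
    apply: val_inj; apply: (uniq_flatten_nth uL (memf (i, a))) => /=.
    by rewrite e; exact: memf (j, b).
  subst j; congr (_, _); apply: idx_inj; apply/eqP; move: e => /eqP; rewrite /f /=.
  have fi := fanL _ (ltn_ord i); rewrite nth_uniq ?(size_fan fi) //.
  by case: (nth [::] L i) fi => // c p /and5P [].
move=> [i a] [j b] /andP [/= /eqP <-] {j}.
have := fanL _ (ltn_ord i); rewrite /f /=.
case: (nth [::] L i) => // c p /and5P [_ /eqP szp srt /allP adjc _].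
have adj_ord (j : 'I_k.*2) : G c (nth x0 p j) by apply: adjc; rewrite mem_nth // szp.
have step (j j' : 'I_k.*2) : j.+1 = j' -> G (nth x0 p j) (nth x0 p j').
  by move=> e; rewrite -e; apply: (sortedP x0 srt); rewrite szp e.
case: a b => [a|a] [b|b]; rewrite /idx /= => h //.
- by move: h; rewrite [a]ord1 [b]ord1 adj_irr.
- by rewrite adj_sym; exact: adj_ord.
- by case/orP: h => /eqP h; [|rewrite adj_sym]; exact: step.
Qed.

Lemma packing_gfree (T : finType) (G : sgraph T) t :
  (forall L, packing G [set: T]%SET L -> size L < t) ->
  gfree (copies t (join (pathg 1) (pathg k.*2))) G.
Proof.
move=> h [f finj fhom].
pose us : seq ('I_1 + 'I_k.*2) := inl ord0 :: map inr (enum 'I_k.*2).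
pose fib (i : 'I_t) := [seq (i, u) | u <- us].
have uus : uniq us.
  rewrite /= map_inj_uniq ?enum_uniq ?andbT => [|x y [] //].
  by apply/negP => /mapP [].
suff /h : packing G [set: T]%SET [seq map f (fib i) | i <- enum 'I_t].
  by rewrite size_map size_enum_ord ltnn.
apply/andP; split.
  apply/allP => _ /mapP [i _ ->].
  have E : map f (fib i) = f (i, inl ord0) :: map f (map (pair i) (map inr (enum 'I_k.*2))).
    by [].
  rewrite E; apply/and5P; split.
  - by rewrite -E /fib !map_inj_uniq // => x y [->].
  - by rewrite 3!size_map size_enum_ord.
  - rewrite -map_comp -map_comp sorted_map.
    have : sorted (relpre val (fun a b : nat => a.+1 == b)) (enum 'I_k.*2).
      rewrite -sorted_map val_enum_ord; apply/(sortedP 0) => j.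
      by rewrite size_iota => hj; rewrite !nth_iota //; lia.
    by apply: sub_sorted => a b /= e; apply: fhom; rewrite /= /copies_rel /= eqxx /pathg_rel e.
  - apply/allP => _ /mapP [_ /mapP [_ /mapP [j _ ->] ->] ->].
    by apply: fhom; rewrite /= /copies_rel /= eqxx.
  - by apply/allP => x _; rewrite inE.
have -> : [seq map f (fib i) | i <- enum 'I_t] = map (map f) [seq fib i | i <- enum 'I_t].
  exact: (map_comp (map f) fib).
rewrite -map_flatten map_inj_uniq //.
apply: allpairs_uniq; first exact: enum_uniq.
  exact: uus.
by move=> [a b] [c d] _ _ /= [-> ->].
Qed.

Lemma packing_hit (T : finType) (G : sgraph T) (A W : {set T}) L :
  (forall w, isfan G A w -> has [in W] w) -> packing G A L -> size L <= #|W|.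
Proof.
move=> hit /andP [/allP hL uL].
apply: (@leq_trans (count [in W] (flatten L))).
  elim: L hL {uL} => //= w L IH hL; rewrite count_cat -add1n.
  apply: leq_add; first by rewrite -has_count; apply: hit; apply: hL; rewrite mem_head.
  by apply: IH => v vL; apply: hL; rewrite inE vL orbT.
rewrite -size_filter -(card_uniqP (filter_uniq _ uL)).
by apply: subset_leq_card; apply/subsetP => x; rewrite mem_filter => /andP [].
Qed.

(** The certificate for competitors: disjoint fans need distinct vertices of [W], and there are
    fewer than [t] of them. *)
Lemma gfree_hit (T : finType) (G : sgraph T) (W : {set T}) t :
  #|W| < t -> (forall w, isfan G (~: W) w -> False) ->
  gfree (copies t (join (pathg 1) (pathg k.*2))) G.
Proof.
move=> Wt h; apply: packing_gfree => L pL; apply: leq_ltn_trans Wt.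
apply: packing_hit pL => w fw; apply/negPn/negP => /hasPn hw; apply: (h w).
by apply: fan_subset fw _ => x xw; rewrite inE; exact: hw.
Qed.

Lemma max_packing (T : finType) (G : sgraph T) (A : {set T}) t :
  0 < t -> (forall L, packing G A L -> size L < t) ->
  exists2 L, packing G A L & forall w, isfan G A w -> has [in flatten L] w.
Proof.
move=> t0 h; apply: contrapT => no.
suff [L pL sL] : exists2 L, packing G A L & size L = t by have := h _ pL; rewrite sL ltnn.
elim: t {h t0} => [|t [L pL sL]]; first by exists [::].
have [w fw dis] : exists2 w, isfan G A w & ~~ has [in flatten L] w.
  apply: contrapT => no2; apply: no; exists L => // w fw.
  by apply/negPn/negP => hw; apply: no2; exists w.
exists (w :: L); last by rewrite /= sL.
case/andP: pL => hL uL; rewrite /packing /= fw hL /= cat_uniq uL andbT.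
apply/andP; split; first by case: (w) fw => // c p /and5P [].
by apply/hasPn => x xL; apply/negP => xw; case/hasP: dis; exists x.
Qed.

Section Substitution.
Variables (T : finType) (G G' : sgraph T).

Lemma fan_map (A A' : {set T}) (r : T -> T) w :
  {in w &, injective r} -> {in w &, forall x y, G' x y -> G (r x) (r y)} ->
  {in w, forall x, r x \in A'} -> isfan G' A w -> isfan G A' (map r w).
Proof.
case: w => // c p rinj rhom rA /and5P [uw szp srt adjc _]; apply/and5P; split.
- by rewrite map_inj_in_uniq.
- by rewrite size_map.
- rewrite sorted_map; apply: (sub_in_sorted (P := [in c :: p])) srt => //.
    by apply/allP => x xp; rewrite inE xp orbT.
- apply/allP => _ /mapP [x xp ->]; apply: rhom; rewrite ?mem_head ?inE ?xp ?orbT //.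
  exact: (allP adjc).
- by apply/allP => _ /mapP [x xw ->]; exact: rA.
Qed.

Lemma packing_map (A A' : {set T}) (r : T -> T) L :
  {in flatten L &, injective r} ->
  {in flatten L &, forall x y, G' x y -> G (r x) (r y)} ->
  {in flatten L, forall x, r x \in A'} -> packing G' A L ->
  packing G A' (map (map r) L).
Proof.
move=> rinj rhom rA /andP [/allP hL uL]; apply/andP; split; last first.
  by rewrite -map_flatten map_inj_in_uniq.
apply/allP => _ /mapP [w wL ->].
have sub x : x \in w -> x \in flatten L by move=> xw; apply/flattenP; exists w.
apply: fan_map (hL _ wL).
- by move=> x y xw yw; apply: rinj; exact: sub.
- by move=> x y xw yw; apply: rhom; exact: sub.
- by move=> x xw; apply: rA; exact: sub.
Qed.

(* Vertices of [U] are exchanged, one at a time, for fresh vertices that see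
   in [G] everything which the old ones saw in [G'] inside the finite set [Z]. *)
Lemma substitution (U Z : {set T}) c :
  (forall x y, x \notin U -> y \notin U -> G' x y -> G x y) ->
  (forall x y, x \in U -> y \in U -> ~~ G' x y) ->
  (forall u (Y : {set T}), u \in U -> #|Y| <= c ->
     exists u', [/\ u' \notin Y, u' \notin U &
       {in Z, forall y, y \notin U -> G' u y -> G u' y}]) ->
  #|Z| + #|U| <= c ->
  exists r : T -> T, [/\ forall x, x \notin U -> r x = x,
    {in U, forall x, (r x \notin Z) && (r x \notin U)}, {in Z &, injective r} &
    {in Z &, forall x y, G' x y -> G (r x) (r y)}].
Proof.
move=> hout hin hsub hc.
suff [r [r1 r2 r3 r4]] : exists r : T -> T, [/\ forall x, x \notin enum U -> r x = x,
    {in enum U, forall x, (r x \notin Z) && (r x \notin U)},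
    {in enum U &, injective r} &
    {in enum U & Z, forall x y, y \notin U -> G' x y -> G (r x) y}].
  have e x : (x \in U) = (x \in enum U) by rewrite mem_enum.
  exists r; split.
  - by move=> x; rewrite e; exact: r1.
  - by move=> x; rewrite e; exact: r2.
  - move=> x y xZ yZ; case: (boolP (x \in U)) => xU; case: (boolP (y \in U)) => yU.
    + by apply: r3; rewrite -e.
    + by rewrite (r1 y) -?e // => E; have := r2 x; rewrite -e xU E yZ => /(_ isT).
    + by rewrite (r1 x) -?e // => E; have := r2 y; rewrite -e yU -E xZ => /(_ isT).
    + by rewrite !r1 -?e.
  - move=> x y xZ yZ g; case: (boolP (x \in U)) => xU; case: (boolP (y \in U)) => yU.
    + by have := hin _ _ xU yU; rewrite g.
    + by rewrite (r1 y) -?e //; apply: r4 => //; rewrite -e.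
    + rewrite (r1 x) -?e // adj_sym; apply: r4 => //; first by rewrite -e.
      by rewrite adj_sym.
    + by rewrite !r1 -?e //; exact: hout.
have : {subset enum U <= U} by move=> x; rewrite mem_enum.
have : size (enum U) <= #|U| by rewrite -cardE.
have := enum_uniq U.
elim: (enum U) => [|u us IH] /=; first by exists id.
case/andP=> unot uus sz sub.
have [||r [r1 r2 r3 r4]] := IH uus; first exact: ltnW.
  by move=> x xus; apply: sub; rewrite inE xus orbT.
have uU : u \in U by apply: sub; rewrite mem_head.
have [|u' [u'Y u'U u'adj]] := hsub u (Z :|: [set x in map r us]%SET) uU.
  apply: leq_trans (leq_card_setU _ _) _; apply: leq_trans hc; rewrite leq_add2l.
  apply: leq_trans (ltnW sz); rewrite cardsE; apply: leq_trans (card_size _) _.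
  by rewrite size_map.
move: u'Y; rewrite !inE negb_or => /andP [u'Z u'us].
have nu x : x \in us -> (x == u) = false.
  by move=> xus; apply/eqP => xu; rewrite -xu xus in unot.
exists (fun x => if x == u then u' else r x); split.
- by move=> x; rewrite inE negb_or => /andP [/negbTE -> h]; exact: r1.
- move=> x; rewrite inE => /orP [/eqP ->|xus]; first by rewrite eqxx u'Z.
  by rewrite nu //; exact: r2.
- move=> x y; rewrite !inE => /orP [/eqP ->|xus] /orP [/eqP ->|yus] //.
  + by rewrite eqxx nu // => E; case/negP: u'us; rewrite E map_f.
  + by rewrite eqxx nu // => E; case/negP: u'us; rewrite -E map_f.
  + by rewrite !nu //; exact: r3.
- move=> x y; rewrite inE => /orP [/eqP ->|xus] yZ yU g; first by rewrite eqxx; exact: u'adj.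
  by rewrite nu //; exact: r4.
Qed.

End Substitution.

(** * Paths glued from segments, and graphs without fans *)

Section PathBuilding.
Variables (T : finType) (G : sgraph T).

(** The path alternates between the prescribed vertices [a] and fresh segments of [l + 1] vertices,
    so each entry of [a] adds [l + 2]. The pool is quantified over forbidden sets [Z] so that
    everything already used can be excluded at each step. *)
Lemma glue_path (P : pred T) l c (a : seq T) y r :
  path G y r -> uniq (y :: r ++ a) -> all (G (last y r)) a ->
  (forall Z : {set T}, #|Z| <= c -> exists z q,
     [/\ size q = l, path G z q, uniq (z :: q), all P (z :: q) &
       {in a, forall b, G b z && G (last z q) b} /\ {in z :: q, forall x, x \notin Z}]) ->
  (size r).+1 + size a * l.+2 <= c ->
  exists p, [/\ size p = (size r).+1 + size a * l.+2, sorted G p, uniq p &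
    {in p, forall x, [|| x \in y :: r, x \in a | P x]}].
Proof.
elim: a y r => [|b a IH] y r pr ur la pool hc.
  exists (y :: r); split => //; first by rewrite addn0.
    by rewrite cats0 in ur.
  by move=> x ->.
have [|z [q [szq pq uq Pq [adjq disq]]]] := pool [set x in y :: r ++ b :: a]%SET.
  rewrite cardsE; apply: leq_trans (card_size _) _ => /=.
  rewrite size_cat /=; move: hc; rewrite /= -addSn; lia.
have dis x : x \in z :: q -> x \notin y :: r ++ b :: a.
  by move=> /disq; rewrite inE.
have [|||||p [szp sp up hp]] := IH y (r ++ b :: z :: q).
- rewrite cat_path pr /=; case/andP: la => -> _ /=.
  by have /andP [-> _] := adjq b (mem_head _ _).
- have -> : y :: (r ++ b :: z :: q) ++ a = (y :: r) ++ [:: b] ++ (z :: q) ++ a.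
    by rewrite /= -catA.
  have E : perm_eq ((y :: r) ++ [:: b] ++ (z :: q) ++ a) ((z :: q) ++ (y :: r ++ b :: a)).
    rewrite -[y :: r ++ b :: a]/((y :: r) ++ [:: b] ++ a).
    rewrite perm_sym perm_catCA perm_cat2l perm_catCA perm_cat2l //.
  rewrite (perm_uniq E) cat_uniq; apply/and3P; split=> //.
  by apply/hasPn => x xs; apply/negP => xz; have := dis x xz; rewrite xs.
- rewrite last_cat /=; apply/allP => x xa.
  by have /adjq /andP [] : x \in b :: a by rewrite inE xa orbT.
- move=> Z hZ; have [z' [q' [h1 h2 h3 h4 [h5 h6]]]] := pool Z hZ.
  by exists z', q'; split=> //; split=> // x xa; apply: h5; rewrite inE xa orbT.
- rewrite size_cat /= szq; move: hc => /=; lia.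
exists p; split => //; first by rewrite szp size_cat /= szq; lia.
have Pz x : x \in z :: q -> P x by move/(allP Pq).
move=> x /hp /or3P [|h|->]; last by rewrite !orbT.
  rewrite -cat_cons mem_cat => /orP [->//|]; rewrite inE => /orP [h|/Pz ->].
    by rewrite [x \in b :: a]inE h orbT.
  by rewrite !orbT.
by rewrite [x \in b :: a]inE h !orbT.
Qed.

Lemma alternating_size (B : {set T}) p :
  sorted (fun x y => ~~ ((x \in B) && (y \in B))) p ->
  size p <= (count [predC B] p).*2.+1.
Proof.
have main x q : path (fun x y => ~~ ((x \in B) && (y \in B))) x q ->
    size (x :: q) <= (count [predC B] (x :: q)).*2 + (x \in B).
  elim: q x => [|y q IH] x /=; first by case: (x \in B).
  case/andP=> xy /IH /=; move: xy.
  by case: (x \in B); case: (y \in B) => //= _; lia.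
by case: p => // x q /main; case: (x \in B) => /=; lia.
Qed.

(* Around a vertex of [V1] the path alternates with the independent set [V2],
   so it has at most [2(k-1)+1 < 2k] vertices. *)
Lemma bipartite_fan_free (V1 V2 A : {set T}) :
  0 < k -> {in A, forall x, (x \in V1) || (x \in V2)} ->
  {in V2 &, forall x y, ~~ G x y} ->
  {in V1, forall v, #|nbr G v :&: V1| < k} ->
  (forall p, uniq p -> sorted G p -> {in p, forall x, x \in V1} -> size p < k.*2) ->
  forall w, isfan G A w -> False.
Proof.
move=> k0 cov ind deg nop [|c p] // /and5P [uw /eqP szp srt /allP adjc /allP hA].
have pA x : x \in p -> x \in A by move=> xp; apply: hA; rewrite inE xp orbT.
case/orP: (cov c (hA c (mem_head _ _))) => cV.
  have : size p <= (count [predC V2] p).*2.+1.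
    apply: alternating_size; apply: sub_sorted srt => x y xy.
    by apply/negP => /andP [xV yV]; have := ind _ _ xV yV; rewrite xy.
  have : count [predC V2] p <= #|nbr G c :&: V1|.
    rewrite -size_filter -(card_uniqP (filter_uniq _ _)); last by case/andP: uw.
    apply: subset_leq_card; apply/subsetP => x; rewrite mem_filter !inE => /andP [xV xp].
    by rewrite adjc //=; have := cov x (pA x xp); rewrite (negbTE xV) orbF.
  by have := deg c cV; rewrite szp; lia.
suff : size p < k.*2 by rewrite szp ltnn.
apply: nop => //; first by case/andP: uw.
move=> x xp; case/orP: (cov x (pA x xp)) => // xV.
by have := ind _ _ cV xV; rewrite adjc.
Qed.

End PathBuilding.

End Fans.

(** * Extremal graphs *)

Section Extremal.
Variable R : realType.

(* All that the argument uses of an extremal graph: [ext_opt] allows competitors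
   on any vertex type of the same size. *)
Record extremal (k t : nat) (V : finType) (G : sgraph V) (rho : R) (x : V -> R) : Prop :=
  Extremal {
    ext_k : (2 < k)%N;
    ext_t : (0 < t)%N;
    ext_pack : forall L, packing k G [set: V]%SET L -> (size L < t)%N;
    ext_ge0 : forall v, 0 <= x v;
    ext_neq0 : exists v, x v != 0;
    ext_eig : forall v, wt x (nbr G v) = rho * x v;
    ext_opt : forall (T : finType) (H : sgraph T), #|T| = #|V| ->
      gfree (copies t (join (pathg 1) (pathg k.*2))) H ->
      forall y, bform H y y <= rho * sqn y }.

(** A competitor on another vertex type is pulled back along a bijection from ['I_n], where [spex]
    bounds it. *)
Lemma spex_extremal k t n (G : sgraph 'I_n) : (2 < k)%N -> (0 < t)%N -> (0 < n)%N ->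
  Spex R n (copies t (join (pathg 1) (pathg k.*2))) G ->
  exists x, extremal k t G (spectral_radius R G) x.
Proof.
move=> k2 t0 n0 [Gfree Grho].
have [_ [x [x0 xn0 xe]]] := spectral_radiusP R G n0.
exists x; split=> //; first exact: gfree_packing Gfree.
move=> T H cT Hfree y; rewrite card_ord in cT.
have [e [e' eK e'K]] : exists e : 'I_n -> T, bijective e.
  exists (fun i => enum_val (cast_ord (esym cT) i)).
  apply: bij_comp; first exact: enum_val_bij.
  by exists (cast_ord cT); [exact: cast_ordKV | exact: cast_ordK].
have Hefree : gfree (copies t (join (pathg 1) (pathg k.*2))) (induced e H).
  move=> [f finj fhom]; apply: Hfree; exists (e \o f).
    by apply: inj_comp => //; exact: can_inj eK.
  by move=> u v /fhom.
have := (spectral_radiusP R (induced e H) n0).1 (y \o e).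
have eb : bijective e by exists e'.
have -> : bform (induced e H) (y \o e) (y \o e) = bform H y y.
  rewrite !bformE (reindex e) /=; last exact: onW_bij.
  by apply: eq_bigr => i _; rewrite [RHS](reindex e) //=; exact: onW_bij.
have -> : sqn (y \o e) = sqn y by rewrite /sqn [RHS](reindex e) //; exact: onW_bij.
move=> h; apply: le_trans h _; apply: ler_wpM2r; first exact: sqn_ge0.
by rewrite Grho; exact: spex_le.
Qed.

Lemma sum_set_le (V : finType) (A : {set V}) (F : V -> R) c :
  {in A, forall v, F v <= c} -> \sum_(v in A) F v <= #|A|%:R * c.
Proof.
by move=> h; rewrite mulr_natl -sumr_const; apply: ler_sum => v /h.
Qed.

Lemma sum_set_ge (V : finType) (A : {set V}) (F : V -> R) c :
  {in A, forall v, c <= F v} -> #|A|%:R * c <= \sum_(v in A) F v.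
Proof.
by move=> h; rewrite mulr_natl -sumr_const; apply: ler_sum => v /h.
Qed.

Lemma sum_set_sub (V : finType) (A B : {set V}) (F : V -> R) :
  A \subset B -> (forall v, 0 <= F v) -> \sum_(v in A) F v <= \sum_(v in B) F v.
Proof.
move=> AB F0; rewrite [X in _ <= X](big_setID A) /= (setIidPr AB) lerDl.
by apply: sumr_ge0 => v _.
Qed.

Lemma sum_cst (T : finType) (c : R) : \sum_(v : T) c = #|T|%:R * c.
Proof. by rewrite sumr_const mulr_natl. Qed.

Lemma sum_cst_ord n (c : R) : \sum_(v < n) c = n%:R * c.
Proof. by rewrite sum_cst card_ord. Qed.

Lemma wt_setID (V : finType) (x : V -> R) (A B : {set V}) :
  wt x A = wt x (A :&: B) + wt x (A :\: B).
Proof. exact: big_setID. Qed.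

Lemma edge_sum_sym (V : finType) (G : sgraph V) (A B : {set V}) :
  (\sum_(v in A) #|nbr G v :&: B| = \sum_(v in B) #|nbr G v :&: A|)%N.
Proof.
have E (C D : {set V}) : (\sum_(v in C) #|nbr G v :&: D| =
    \sum_(v in C) \sum_(u in D) G v u)%N.
  apply: eq_bigr => v _; rewrite -sum1_card [LHS]big_mkcond [RHS]big_mkcond /=.
  by apply: eq_bigr => u _; rewrite !inE andbC; case: (u \in D); case: (G v u).
rewrite !E exchange_big; apply: eq_bigr => v _; apply: eq_bigr => u _.
by rewrite adj_sym.
Qed.

Section Competitors.
Variables (k t : nat) (V : finType) (G : sgraph V) (rho : R) (x : V -> R).
Hypothesis ext : extremal k t G rho x.

(* Rayleigh quotient of [K_s \/ (G1 \/ N2 K_1)] on a vector constant on the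
   three parts. *)
Lemma opt_join s N2 (T : finType) (G1 : sgraph T) (p q z : R) :
  (s < t)%N -> (s + (#|T| + N2) = #|V|)%N ->
  (forall v, degree G1 v < k)%N -> no_path G1 k.*2 ->
  (\sum_v degree G1 v)%:R * p ^+ 2 + 2 * (#|T|%:R * p) * (N2%:R * q)
    + 2 * (s%:R * z) * (#|T|%:R * p + N2%:R * q) + s%:R * (s%:R - 1) * z ^+ 2
  <= rho * (#|T|%:R * p ^+ 2 + N2%:R * q ^+ 2 + s%:R * z ^+ 2).
Proof.
move=> st sz deg nop.
pose H := join (complete s) (join G1 (edgeless N2)).
pose W := [set u : 'I_s + (T + 'I_N2) | if u is inl _ then true else false]%SET.
have cW : #|W| = s.
  rewrite -sum1_card big_mkcond big_sumType /= [X in (_ + X)%N]big1 => [|u _]; last by rewrite inE.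
  under eq_bigr do rewrite inE.
  by rewrite sum1_card card_ord addn0.
have Hfree : gfree (copies t (join (pathg 1) (pathg k.*2))) H.
  apply: (gfree_hit (W := W)); first by rewrite cW.
  pose V1 := [set u : 'I_s + (T + 'I_N2) | if u is inr (inl _) then true else false]%SET.
  pose V2 := [set u : 'I_s + (T + 'I_N2) | if u is inr (inr _) then true else false]%SET.
  apply: (@bipartite_fan_free k _ H V1 V2).
  - by have := ext_k ext; lia.
  - by move=> [a|[a|a]]; rewrite !inE.
  - by move=> [a|[a|a]] [b|[b|b]]; rewrite !inE.
  - move=> [a|[a|a]]; rewrite !inE // => _; apply: leq_ltn_trans (deg a).
    have inj : injective (fun b : T => inr (inl b) : 'I_s + (T + 'I_N2)) by move=> b c [].
    rewrite /degree -[X in (_ <= X)%N](card_imset _ inj); apply: subset_leq_card; apply/subsetP => u.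
    rewrite !inE; case: u => [b|[b|b]]; rewrite ?andbF //= andbT => h.
    by apply/imsetP; exists b => //; rewrite inE.
  - move=> p0 up sp pV1.
    have [p' pE] : exists p', p0 = map (fun b : T => inr (inl b)) p'.
      elim: p0 pV1 {up sp} => [|u p0 IH] h; first by exists [::].
      have [|p' ->] := IH; first by move=> v vp; apply: h; rewrite inE vp orbT.
      have := h u (mem_head _ _); rewrite inE; case: u {h} => [|[b|]] // _.
      by exists (b :: p').
    rewrite pE size_map; apply: nop.
      by move: up; rewrite pE map_inj_uniq // => b c [].
    by move: sp; rewrite pE sorted_map.
pose y (u : 'I_s + (T + 'I_N2)) := match u with inl _ => z | inr (inl _) => p | inr (inr _) => q end.
have cH : #|{: 'I_s + (T + 'I_N2)}| = #|V| by rewrite !card_sum !card_ord.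
have := ext_opt ext cH Hfree y.
have -> : sqn y = #|T|%:R * p ^+ 2 + N2%:R * q ^+ 2 + s%:R * z ^+ 2.
  by rewrite /sqn !big_sumType /= !sum_cst_ord sum_cst addrC.
suff -> : bform H y y = (\sum_v degree G1 v)%:R * p ^+ 2 + 2 * (#|T|%:R * p) * (N2%:R * q)
    + 2 * (s%:R * z) * (#|T|%:R * p + N2%:R * q) + s%:R * (s%:R - 1) * z ^+ 2 by [].
rewrite bformE !big_sumType /=.
have e1 (i : 'I_s) : \sum_v (H (inl i) v)%:R * (y (inl i) * y v) =
    (s%:R - 1) * z ^+ 2 + #|T|%:R * (z * p) + N2%:R * (z * q).
  rewrite !big_sumType /= sum_cst_ord sum_cst !mul1r addrA; congr (_ + _ + _).
  rewrite (bigD1 i) //= /complete_rel eqxx mul0r add0r.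
  rewrite (eq_bigr (fun=> z ^+ 2)) => [|j ji]; last by rewrite eq_sym ji mul1r.
  rewrite sumr_const cardC1 card_ord -(mulr_natl (z ^+ 2)); congr (_ * _).
  by case: (s) i => [[] //|s' _] /=; rewrite -natr1 addrK.
have e2 (a : T) : \sum_v (H (inr (inl a)) v)%:R * (y (inr (inl a)) * y v) =
    s%:R * (z * p) + (degree G1 a)%:R * p ^+ 2 + N2%:R * (p * q).
  rewrite !big_sumType /= !sum_cst_ord !mul1r [p * z]mulrC addrA; congr (_ + _ + _).
  by rewrite -mulr_suml degree_sum natr_sum.
have e3 (a : 'I_N2) : \sum_v (H (inr (inr a)) v)%:R * (y (inr (inr a)) * y v) =
    s%:R * (z * q) + #|T|%:R * (p * q).
  rewrite !big_sumType /= sum_cst_ord sum_cst !mul1r [q * z]mulrC [q * p]mulrC.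
  by rewrite [X in _ + (_ + X)]big1 ?addr0 // => j _; rewrite mul0r.
rewrite (eq_bigr _ (fun i _ => e1 i)) (eq_bigr _ (fun a _ => e2 a)) (eq_bigr _ (fun a _ => e3 a)).
rewrite sum_cst_ord.
rewrite sum_cst_ord !big_split /= !sum_cst -mulr_suml -natr_sum.
move: (#|T|%:R : R) ((\sum_i degree G1 i)%:R : R) (s%:R : R) (N2%:R : R) => a b c d; lra.
Qed.

(** The competitor is the balanced complete bipartite graph, tested on the all-one vector. *)
Lemma rho_lower : (0 < #|V|)%N -> (#|V|%:R - 1) / 2 <= rho.
Proof.
move=> n0; set n := #|V|.
set a := n./2; set b := uphalf n.
have ab : (a + b = n)%N by rewrite /a /b uphalf_half addnCA addnn odd_double_half.
have abR : a%:R + b%:R = n%:R :> R by rewrite -natrD ab.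
have ab1 : (a%:R <= b%:R :> R) && (b%:R <= a%:R + 1 :> R).
  by rewrite natr1 !ler_nat /a /b uphalf_half; case: (odd n); lia.
have deg0 v : degree (edgeless a) v = 0%N by rewrite degree_sum big1.
have nop : no_path (edgeless a) k.*2.
  by move=> [|u [|v p]] //=; rewrite ?andbF //; have := ext_k ext; lia.
have szn : (0 + (#|'I_a| + b) = #|V|)%N by rewrite card_ord ab.
have degk v : (degree (edgeless a) v < k)%N by rewrite deg0; have := ext_k ext; lia.
have := @opt_join 0 b _ (edgeless a) 1 1 0 (ext_t ext) szn degk nop.
rewrite card_ord.
have -> : (\sum_v degree (edgeless a) v)%N = 0%N.
  by apply: big1 => v _.
have n1 : 1 <= n%:R :> R by rewrite ler1n.
move: abR ab1 n1; move: (a%:R) (b%:R) (n%:R) => ar br nr; rewrite /=.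
move=> e /andP [h1 h2] n1 h.
have h3 : 2 * ar * br <= rho * nr by rewrite -e; lra.
have h4 : (nr - 1) * nr / 2 <= rho * nr.
  apply: le_trans h3; rewrite -e; nra.
by rewrite -(ler_pM2r (_ : 0 < nr)); lra.
Qed.

Lemma max_entry : exists2 u, 0 < x u & forall v, x v <= x u.
Proof.
have [w wx] := ext_neq0 ext.
have [u _ umax] := @arg_maxP _ _ _ w predT x isT.
exists u; last by move=> v; exact: umax.
by apply: lt_le_trans (umax w isT); rewrite lt_neqAle eq_sym wx (ext_ge0 ext).
Qed.

Lemma rho_upper : rho <= #|V|%:R.
Proof.
have [u xu umax] := max_entry.
rewrite -(ler_pM2r xu) -(ext_eig ext); apply: le_trans (sum_set_le _) _.
  by move=> v _; exact: umax v.
by rewrite ler_pM2r // ler_nat max_card.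
Qed.

(** At the largest entry [x u] of all, the eigenvalue equation gives [(rho - #|S|) * x u <= n * M],
    and [rho - #|S|] is at least [n / 3]. *)
Lemma entry_le3 (S : {set V}) M : (12 * #|S| + 12 <= #|V|)%N ->
  {in ~: S, forall v, x v <= M} -> forall v, x v <= 3 * M.
Proof.
move=> Sn hM v; have [u xu umax] := max_entry; apply: le_trans (umax v) _.
have SnR : 12 * #|S|%:R + 12 <= #|V|%:R :> R by rewrite -natrM -natrD ler_nat.
have n0 : (0 < #|V|)%N by lia.
have rl := rho_lower n0.
have M0 : 0 <= M.
  have [w wS] : exists w, w \in ~: S.
    by apply/card_gt0P; rewrite cardsCs setCK; lia.
  exact: le_trans (ext_ge0 ext w) (hM w wS).
have : rho * x u <= #|V|%:R * M + #|S|%:R * x u.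
  rewrite -(ext_eig ext) (wt_setID _ _ S) addrC; apply: lerD.
    apply: le_trans (sum_set_le (c := M) _) _.
      by move=> w; rewrite inE => /andP [wS _]; apply: hM; rewrite inE.
    by rewrite ler_wpM2r // ler_nat max_card.
  apply: le_trans (sum_set_le (c := x u) _) _; first by move=> w _; exact: umax.
  rewrite ler_wpM2r ?ler_nat; [by []|exact: ltW|].
  by apply: subset_leq_card; exact: subsetIr.
have sp : 0 <= #|S|%:R :> R by [].
move: (#|V|%:R : R) (#|S|%:R : R) SnR rl sp => n s SnR rl sp h.
have s0 : 0 <= x u by exact: ltW.
have n3 : n / 3 <= rho - s by lra.
have h3 : n / 3 * x u <= n * M.
  by apply: (@le_trans _ _ ((rho - s) * x u)); [rewrite ler_wpM2r | lra].
have [ns|] := ltP 0 n; last by lra.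
by rewrite -(ler_pM2l ns); lra.
Qed.

End Competitors.
End Extremal.

(** * Rough bipartite structure *)

Section Bipartition.
Variable R : realType.

Lemma inner_sum_setD1 (V : finType) (G : sgraph V) (A : {set V}) v : v \in A ->
  (\sum_(w in A) #|nbr G w :&: A| =
   #|nbr G v :&: A|.*2 + \sum_(w in A :\ v) #|nbr G w :&: (A :\ v)|)%N.
Proof.
move=> vA; rewrite (big_setD1 v) //= -addnn -addnA; congr (_ + _)%N.
rewrite (eq_bigr (fun w => (v \in nbr G w) + #|nbr G w :&: (A :\ v)|)%N) => [|w _]; last first.
  by rewrite (cardsD1 v) inE vA andbT setIDA.
rewrite big_split /=; congr (_ + _)%N.
rewrite -sum1_card [LHS]big_mkcond [RHS]big_mkcond; apply: eq_bigr => w _.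
rewrite !inE adj_sym; have [->|_] := eqVneq w v; first by rewrite adj_irr.
by rewrite andbC; case: (w \in A); case: (G v w).
Qed.

(** Degeneracy argument: if all inner degrees exceeded [m], a path could be extended greedily to
    [m + 1] vertices. So some vertex has inner degree at most [m]; it is deleted and the rest
    follows by induction. *)
Lemma sparse_of_no_path (V : finType) (G : sgraph V) m (A : {set V}) :
  (forall p, uniq p -> sorted G p -> {in p, forall v, v \in A} -> (size p <= m)%N) ->
  (\sum_(v in A) #|nbr G v :&: A| <= (m * #|A|).*2)%N.
Proof.
have [c] := ubnP #|A|; elim: c A => // c IH A cA nop.
have [->|/set0Pn [a aA]] := eqVneq A set0; first by rewrite big_set0.
have [v vA dv] : exists2 v, v \in A & (#|nbr G v :&: A| <= m)%N.
  apply: contrapT => no.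
  have big v : v \in A -> (m < #|nbr G v :&: A|)%N.
    by move=> vA; rewrite ltnNge; apply/negP => h; apply: no; exists v.
  suff [u [p [s up sp pA]]] : exists u p, [/\ size p = m, uniq (u :: p), sorted G (u :: p) &
      {in u :: p, forall w, w \in A}].
    by have := nop _ up sp pA; rewrite /= s ltnn.
  (* The length is generalised to [j <= m] for the greedy extension: the head [u] has more than [m]
     inner neighbours, and only the [j] vertices behind it are excluded. *)
  have [j jm] : exists2 j, j = m & (j <= m)%N by exists m.
  rewrite -{2}jm; elim: j {jm} => [|j IHj] jm.
    by exists a, [::]; split=> // w; rewrite inE => /eqP ->.
  have [u [p [s up sp pA]]] := IHj (ltnW jm).
  have [y] : exists y, y \in (nbr G u :&: A) :\: [set w in p].
    apply/card_gt0P; rewrite cardsD subn_gt0.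
    apply: leq_ltn_trans (subset_leq_card (subsetIr _ _)) _.
    rewrite cardsE; apply: leq_ltn_trans (card_size _) _; rewrite s.
    by apply: ltn_trans jm _; apply: big; apply: pA; rewrite mem_head.
  rewrite !inE => /and3P [yp uy yA]; exists y, (u :: p); split.
  - by rewrite /= s.
  - apply/andP; split=> //; rewrite inE negb_or yp andbT.
    by apply/eqP => yu; rewrite yu adj_irr in uy.
  - by rewrite /= adj_sym uy.
  - by move=> w; rewrite inE => /orP [/eqP ->|/pA].
have := IH (A :\ v); rewrite (cardsD1 v A) vA in cA *.
move=> /(_ cA) h; rewrite (inner_sum_setD1 G vA).
have {}h : (\sum_(w in A :\ v) #|nbr G w :&: (A :\ v)| <= (m * #|A :\ v|).*2)%N.
  by apply: h => p up sp pA; apply: nop => // w /pA; rewrite !inE => /andP [].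
by move: h dv; rewrite mulnDr muln1 doubleD; lia.
Qed.

Record balanced (V : finType) (G : sgraph V) (eta : R) (A B : {set V}) : Prop := Balanced {
  bal_dis : [disjoint A & B];
  bal_ltA : #|A|%:R <= (1 / 2 + eta) * #|V|%:R;
  bal_ltB : #|B|%:R <= (1 / 2 + eta) * #|V|%:R;
  bal_gtA : (1 / 2 - eta) * #|V|%:R <= #|A|%:R;
  bal_gtB : (1 / 2 - eta) * #|V|%:R <= #|B|%:R;
  bal_missA : {in A, forall v, #|B :\: nbr G v|%:R <= eta * #|V|%:R};
  bal_missB : {in B, forall v, #|A :\: nbr G v|%:R <= eta * #|V|%:R} }.

Lemma balanced_sym (V : finType) (G : sgraph V) eta (A B : {set V}) :
  balanced G eta A B -> balanced G eta B A.
Proof. by case=> *; split; rewrite // disjoint_sym. Qed.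

Section MaxEntry.
Variables (k t : nat) (V : finType) (G : sgraph V) (rho : R) (x : V -> R).
Hypothesis ext : extremal k t G rho x.

(* Counting walks of length two from the largest entry [u] outside [S]:
   [rho^2 x_u] is at most [e(N(u), V \ N(u)) x_u] up to [O(n) x_u], because
   [N(u)] contains no path on [2k] vertices. *)
Lemma dense_cut (S : {set V}) sg :
  (#|S| <= sg)%N -> (12 * sg + 12 <= #|V|)%N ->
  (forall w, isfan k G (~: S) w -> False) ->
  exists A : {set V}, #|V|%:R ^+ 2 / 4 - (6 * sg + 4 * k + 1)%:R * #|V|%:R <=
    (\sum_(v in A) #|nbr G v :&: ~: A|)%:R :> R.
Proof.
move=> Ssg Vsg nofan; have k2 := ext_k ext.
have cS : (0 < #|~: S|)%N by rewrite cardsCs setCK; lia.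
have [w0 w0S] := card_gt0P cS.
have [u uS umax] := @arg_maxP _ _ _ w0 [in ~: S] x w0S.
set M := x u in umax.
have le3 : forall v, x v <= 3 * M.
  apply: (entry_le3 ext (S := S)); last by move=> v; exact: umax.
  by apply: leq_trans Vsg; rewrite leq_add2r leq_mul2l Ssg orbT.
have M0 : 0 < M.
  have [v xv _] := max_entry ext; have := lt_le_trans xv (le3 v); lra.
have rl : (#|V|%:R - 1) / 2 <= rho by apply: (rho_lower ext); lia.
have ru := rho_upper ext.
set P := nbr G u :\: S; exists P.
have PS : {in P, forall v, v \in ~: S} by move=> v; rewrite !inE => /andP [].
have nfan : (\sum_(v in P) #|nbr G v :&: P| <= (k.*2 * #|P|).*2)%N.
  apply: sparse_of_no_path => p up sp pP.
  rewrite leqNgt; apply/negP => sz; apply: (nofan (u :: take k.*2 p)).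
  apply: fan_of_path => //; last exact: ltnW.
  move=> v vp; split; last by apply: PS; exact: pP.
  by have := pP v vp; rewrite !inE => /andP [].
have n1 : 1 <= #|V|%:R :> R by rewrite ler1n; lia.
have sgS : #|S|%:R <= sg%:R :> R by rewrite ler_nat.
(* Walks that meet [S] at their middle or last vertex are estimated with entries [3 * M], all others
   with [M]. *)
have walk : rho ^+ 2 * M <= sg%:R * (3 * rho * M) + (3 * sg%:R * #|V|%:R * M)
    + (\sum_(v in P) #|nbr G v :\: S|)%:R * M.
  rewrite expr2 -mulrA -(ext_eig ext) (wt_setID _ _ S) mulrDr -addrA; apply: lerD.
    rewrite [3 * rho]mulrC -mulrA mulrCA; apply: ler_wpM2l; first lra.
    apply: le_trans (sum_set_le (c := 3 * M) _) _; first by move=> v _; exact: le3.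
    apply: ler_wpM2r; first lra.
    by apply: le_trans sgS; rewrite ler_nat subset_leq_card // subsetIr.
  rewrite /wt -/P mulr_sumr natr_sum mulr_suml.
  have -> : 3 * sg%:R * #|V|%:R * M = #|V|%:R * (3 * sg%:R * M) by lra.
  apply: (@le_trans _ _ (#|P|%:R * (3 * sg%:R * M) + \sum_(i in P) #|nbr G i :\: S|%:R * M)).
    rewrite mulr_natl -sumr_const -big_split; apply: ler_sum => v vP /=.
    rewrite -(ext_eig ext) (wt_setID _ _ S); apply: lerD.
      apply: le_trans (sum_set_le (c := 3 * M) _) _; first by move=> w _; exact: le3.
      rewrite -mulrA mulrCA; apply: ler_wpM2l; first lra.
      apply: ler_wpM2r; first lra.
      by apply: le_trans sgS; rewrite ler_nat subset_leq_card // subsetIr.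
    by apply: sum_set_le => w; rewrite inE => /andP [wS _]; apply: umax; rewrite inE.
  rewrite lerD2r; apply: ler_wpM2r; last by rewrite ler_nat max_card.
  by rewrite !mulr_ge0 // ltW.
have split_deg : (\sum_(v in P) #|nbr G v :\: S| <=
    \sum_(v in P) #|nbr G v :&: P| + \sum_(v in P) #|nbr G v :&: ~: P|)%N.
  rewrite -big_split; apply: leq_sum => v _ /=.
  by rewrite -setDE cardsID; exact: subset_leq_card (subsetDl _ _).
(* Of the constant in the statement, [6 * sg] pays for the walks through [S] (as [rho <= n]),
   [4 * k] for the edges inside [P], and [1] for the gap between [rho ^+ 2] and [n ^+ 2 / 4]. *)
have fin : rho ^+ 2 <= 3 * sg%:R * rho + 3 * sg%:R * #|V|%:R + 4 * k%:R * #|V|%:R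
   + (\sum_(v in P) #|nbr G v :&: ~: P|)%:R.
  rewrite -(ler_pM2r M0); apply: le_trans walk _.
  have : (\sum_(v in P) #|nbr G v :\: S|)%:R <= 4 * k%:R * #|V|%:R +
      (\sum_(v in P) #|nbr G v :&: ~: P|)%:R :> R.
    rewrite -!natrM -natrD ler_nat; apply: leq_trans split_deg _; rewrite leq_add2r.
    apply: leq_trans nfan _; rewrite -mul2n -mul2n !mulnA leq_mul2l max_card orbT //.
  move=> h; have := ler_wpM2r (ltW M0) h.
  move: (\sum_(v in P) #|nbr G v :\: S|)%:R (\sum_(v in P) #|nbr G v :&: ~: P|)%:R => a b; lra.
have sg0 : 0 <= sg%:R :> R by [].
rewrite 2!natrD 2!natrM.
move: fin rl ru n1 sg0; move: (\sum_(v in P) _)%:R (#|V|%:R : R) (sg%:R : R) (k%:R : R) => e n s c; nra.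
Qed.

End MaxEntry.
End Bipartition.

(** * Discarding boundedly many atypical vertices *)

Section TypicalStructure.
Variable R : realType.

Lemma nat_above (a : R) : exists N : nat, a <= N%:R.
Proof.
exists (Num.bound `|a|); apply: le_trans (ler_norm a) _.
exact: ltW (archi_boundP (normr_ge0 a)).
Qed.

Lemma few_above (V : finType) (A : {set V}) (F : V -> nat) (tau K : R) :
  \sum_(v in A) (F v)%:R <= K ->
  #|[set v in A | tau < (F v)%:R]|%:R * tau <= K.
Proof.
move=> h; apply: le_trans h; apply: (@le_trans _ _ (\sum_(v in [set v in A | tau < (F v)%:R]) (F v)%:R)).
  by apply: sum_set_ge => v; rewrite inE => /andP [_ /ltW].
by apply: sum_set_sub => //; apply/subsetP => v; rewrite inE => /andP [].
Qed.

Lemma missing_sum (V : finType) (G : sgraph V) (A B : {set V}) :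
  \sum_(v in A) #|B :\: nbr G v|%:R =
  #|A|%:R * #|B|%:R - (\sum_(v in A) #|nbr G v :&: B|)%:R :> R.
Proof.
apply/eqP; rewrite eq_sym subr_eq natr_sum -big_split /=; apply/eqP.
rewrite mulr_natl -sumr_const; apply: eq_bigr => v _.
by rewrite -natrD addnC setIC cardsID.
Qed.

(** The cut lacks only [O(n)] of its possible edges, so by Markov's inequality boundedly many
    vertices lack more than [eps * n / 2] of theirs. These and the vertices of a maximal packing are
    discarded; their number [c] is fixed before [n]. *)
Lemma typical_structure k t (eps : R) : 0 < eps ->
  exists N c : nat, forall (V : finType) (G : sgraph V) (rho : R) (x : V -> R),
    extremal k t G rho x -> (N <= #|V|)%N ->
    exists A B : {set V}, [/\ balanced G eps A B, (#|~: (A :|: B)| <= c)%N &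
      forall w, isfan k G (A :|: B) w -> False].
Proof.
move=> eps0; set sg := (t * k.*2.+1)%N; set C1 : R := (6 * sg + 4 * k + 1)%:R.
set e1 := eps / 2; have e10 : 0 < e1 by rewrite /e1; lra.
have [b hb] := nat_above (C1 / e1).
pose c := (sg + b + b)%N.
have [N1 hN1] := nat_above (C1 / e1 / e1); have [N2 hN2] := nat_above (c%:R / e1).
exists (12 * sg + 12 + N1 + N2)%N, c => V G rho x ext NV.
have k2 := ext_k ext; have t0 := ext_t ext.
have [L pL Lmax] := max_packing t0 (ext_pack ext).
pose S := [set v in flatten L].
have cS : (#|S| <= sg)%N.
  rewrite cardsE; apply: leq_trans (card_size _) _; rewrite (size_flatten_packing pL).
  by rewrite leq_mul2r (ltnW (ext_pack ext pL)) orbT.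
have nofan w : isfan k G (~: S) w -> False.
  move=> fw; have /Lmax /hasP [v vw vL] : isfan k G [set: V] w.
    by apply: fan_subset fw _ => v _; rewrite inE.
  by have := fan_sub fw vw; rewrite !inE => /negP.
have Vsg : (12 * sg + 12 <= #|V|)%N by lia.
have [A hA] := dense_cut ext cS Vsg nofan.
set n : R := #|V|%:R; rewrite -/n -/C1 in hA.
have n0 : 0 < n by rewrite ltr0n; apply: leq_trans NV; rewrite addn_gt0 addn_gt0 addn_gt0 orbT.
have nN1 : C1 <= e1 * (e1 * n).
  have : C1 / e1 / e1 <= n by apply: le_trans hN1 _; rewrite ler_nat; apply: leq_trans NV;
    rewrite -addnA addnCA leq_addr.
  by rewrite ler_pdivrMr // ler_pdivrMr // mulrC [n * _]mulrC.
have nN2 : c%:R <= e1 * n.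
  have : c%:R / e1 <= n by apply: le_trans hN2 _; rewrite ler_nat; apply: leq_trans NV; rewrite leq_addl.
  by rewrite ler_pdivrMr // mulrC.
set B := ~: A; have abn : #|A|%:R + #|B|%:R = n by rewrite -natrD cardsC.
have cut : #|A|%:R * #|B|%:R - (\sum_(v in A) #|nbr G v :&: B|)%:R <= C1 * n.
  rewrite -/B in hA; have ab4 : #|A|%:R * #|B|%:R <= n ^+ 2 / 4.
    rewrite -abn; have := sqr_ge0 (#|A|%:R - #|B|%:R : R).
    move: (#|A|%:R : R) (#|B|%:R : R) => a b'; lra.
  move: hA ab4; move: (\sum_(v in A) _)%:R (#|A|%:R * #|B|%:R) (n ^+ 2) (C1 * n) => e ab n2 K; lra.
pose TA := [set v in A | e1 * n < #|B :\: nbr G v|%:R].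
pose TB := [set v in B | e1 * n < #|A :\: nbr G v|%:R].
have bound (X : {set V}) : #|X|%:R * (e1 * n) <= C1 * n -> (#|X| <= b)%N.
  move=> h; rewrite -(ler_nat R); apply: le_trans hb.
  by rewrite ler_pdivlMr // -(ler_pM2r n0) -mulrA.
have cTA : (#|TA| <= b)%N.
  by apply: bound; apply: few_above; rewrite missing_sum.
have cTB : (#|TB| <= b)%N.
  by apply: bound; apply: few_above; rewrite missing_sum edge_sum_sym mulrC.
pose T := S :|: TA :|: TB.
have cT : (#|T| <= c)%N.
  apply: leq_trans (leq_card_setU _ _) _; rewrite leq_add //.
  by apply: leq_trans (leq_card_setU _ _) _; rewrite leq_add.
have cTR : #|T|%:R <= e1 * n by apply: le_trans nN2; rewrite ler_nat.
have sizes (X : {set V}) : #|X|%:R <= #|X :\: T|%:R + e1 * n.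
  rewrite -(cardsID T X) addnC natrD lerD2l; apply: le_trans cTR.
  by rewrite ler_nat subset_leq_card // subsetIr.
have sizes2 (X : {set V}) : #|X :\: T|%:R <= #|X|%:R :> R.
  by rewrite ler_nat subset_leq_card // subsetDl.
have eab : (\sum_(v in A) #|nbr G v :&: B|)%:R <= #|A|%:R * #|B|%:R :> R.
  by rewrite -subr_ge0 -missing_sum; apply: sumr_ge0.
(* Since [|A| |B| = (n^2 - (|A| - |B|)^2) / 4] and the cut has almost [n^2 / 4] edges, the parts
   differ little in size. *)
have sqdev : (#|A|%:R - #|B|%:R) ^+ 2 <= (2 * (e1 * n)) ^+ 2.
  have h : C1 * n <= e1 * (e1 * n) * n by rewrite ler_pM2r.
  move: hA h abn eab; rewrite -/B; move: (\sum_(v in A) _)%:R (#|A|%:R : R) (#|B|%:R : R).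
  move=> e a b' hA h abn e0; rewrite -abn in hA h *; move: (C1 * _) hA h => K hA h; nra.
have en0 : 0 < e1 * n by rewrite mulr_gt0.
have [dev1 dev2] : #|A|%:R - #|B|%:R <= 2 * (e1 * n) /\ - (2 * (e1 * n)) <= #|A|%:R - #|B|%:R.
  move: sqdev; move: (#|A|%:R - #|B|%:R : R) (e1 * n) en0 => d m m0 h; split; nra.
have epsE : eps = e1 + e1 by rewrite /e1 -splitr.
exists (A :\: T), (B :\: T); split.
- split.
  + rewrite -setI_eq0; apply/eqP/setP => v; rewrite !inE.
    by case: (v \in A); rewrite ?andbF.
  + apply: le_trans (sizes2 A) _; rewrite epsE -/n; lra.
  + apply: le_trans (sizes2 B) _; rewrite epsE -/n; lra.
  + have := sizes A; rewrite epsE -/n; lra.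
  + have := sizes B; rewrite epsE -/n; lra.
  + move=> v; rewrite !inE => /andP [vT vA].
    have hB : #|B :\: nbr G v|%:R <= e1 * n.
      by rewrite leNgt; apply/negP => h; move: vT; rewrite vA h ?orbT.
    apply: (@le_trans _ _ (e1 * n)); last by rewrite epsE -/n; lra.
    by apply: le_trans hB; rewrite ler_nat subset_leq_card // setSD // subsetDl.
  + move=> v; rewrite !inE => /andP [vT vB].
    have hA' : #|A :\: nbr G v|%:R <= e1 * n.
      by rewrite leNgt; apply/negP => h; move: vT; rewrite vB h ?orbT.
    apply: (@le_trans _ _ (e1 * n)); last by rewrite epsE -/n; lra.
    by apply: le_trans hA'; rewrite ler_nat subset_leq_card // setSD // subsetDl.
- apply: leq_trans cT; apply: subset_leq_card; apply/subsetP => v; apply: contraTT => vT.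
  by rewrite in_setC negbK in_setU !in_setD vT /= in_setC orbN.
- move=> w fw; apply: (nofan w); apply: (fan_subset fw) => v vw.
  have := fan_sub fw vw; rewrite in_setU !in_setD in_setC.
  by case/orP => /andP []; rewrite /T !in_setU !negb_or => /andP [/andP [h _] _].
Qed.

End TypicalStructure.

(** * Eigenvector entries *)

Section Balanced.
Variable R : realType.

(** Each vertex of [Y] excludes at most [eta * n] vertices of [A], and [Z] at most [c] more; [D] is
    larger than all these together. *)
Lemma bal_pick (V : finType) (G : sgraph V) (eta : R) (A B D Y Z : {set V}) c :
  balanced G eta A B -> D \subset A -> Y \subset B -> (#|Y| <= c)%N -> (#|Z| <= c)%N ->
  c%:R * (eta * #|V|%:R + 1) < #|D|%:R ->
  exists a, [/\ a \in D, a \notin Z & {in Y, forall y, G a y}].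
Proof.
move=> bal /subsetP DA /subsetP YB cY cZ hD.
pose bad := [set a in A | [exists y in Y, ~~ G a y]].
have hbad : #|bad|%:R <= c%:R * (eta * #|V|%:R).
  have le1 : (#|bad| <= \sum_(y in Y) #|A :\: nbr G y|)%N.
    have -> : (\sum_(y in Y) #|A :\: nbr G y| = \sum_(a in A) \sum_(y in Y) ~~ G a y)%N.
      rewrite exchange_big; apply: eq_bigr => y _; rewrite -sum1_card [LHS]big_mkcond [RHS]big_mkcond.
      by apply: eq_bigr => a _; rewrite !inE adj_sym andbC; case: (a \in A); case: (G a y).
    rewrite -sum1_card [X in (_ <= X)%N](big_setID bad) /=.
    have badA : A :&: bad = bad by apply/setIidPr/subsetP => a; rewrite inE => /andP [].
    rewrite badA; apply: leq_trans (leq_addr _ _); apply: leq_sum => a.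
    rewrite inE => /andP [_ /existsP [y /andP [yY h]]].
    by rewrite (bigD1 y) //= h.
  apply: (@le_trans _ _ ((\sum_(y in Y) #|A :\: nbr G y|)%N)%:R); first by rewrite ler_nat.
  have m0 : 0 <= eta * #|V|%:R.
    have [Y0|[y yY]] := set_0Vmem Y; last first.
      by apply: le_trans (bal_missB bal (YB y yY)).
    have [e0|/ltW e0] := leP 0 eta; first by rewrite mulr_ge0.
    have := bal_ltA bal; have := bal_gtA bal.
    have : 0 <= #|V|%:R :> R by [].
    move: (#|V|%:R : R) (#|A|%:R : R) => n a; nra.
  rewrite natr_sum; apply: le_trans (sum_set_le (c := eta * #|V|%:R) _) _.
    by move=> y /YB; exact: bal_missB bal y.
  by apply: ler_wpM2r; rewrite ?ler_nat.
have [a aDZ] : exists a, a \in D :\: (bad :|: Z).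
  apply/card_gt0P; rewrite cardsD subn_gt0 -(ltr_nat R).
  apply: le_lt_trans hD; apply: (@le_trans _ _ (#|bad|%:R + #|Z|%:R)).
    rewrite -natrD ler_nat; apply: leq_trans (subset_leq_card (subsetIr _ _)) _.
    exact: leq_card_setU.
  by rewrite mulrDr mulr1 lerD // ler_nat.
move: aDZ; rewrite in_setD in_setU negb_or => /andP [/andP [abad aZ] aD].
exists a; split=> // y yY; apply/negPn/negP => h; case/negP: abad.
by rewrite inE DA //=; apply/existsP; exists y; rewrite yY.
Qed.

(** Around the centre [v] the path alternates between the [k] neighbours [a] in [A] and common
    neighbours of [a] chosen in [D], starting and ending in [D]: this gives [2k + 1] vertices, one
    more than needed. *)
Lemma fan_at k (V : finType) (G : sgraph V) (eta : R) (A B X D : {set V}) v (a : seq V) :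
  balanced G eta A B -> v \in X -> D \subset nbr G v :&: B :&: X ->
  {subset a <= nbr G v :&: A :&: X} -> uniq a -> size a = k ->
  (2 * k + 1)%:R * (eta * #|V|%:R + 1) < #|D|%:R ->
  exists w, isfan k G X w.
Proof.
move=> bal vX /subsetP Dsub asub ua sa hD.
have balS := balanced_sym bal.
have DB : D \subset B by apply/subsetP => u /Dsub; rewrite !inE => /andP [/andP []].
have aA : [set u in a] \subset A.
  by apply/subsetP => u; rewrite inE => /asub; rewrite !inE => /andP [/andP []].
have ca : (#|[set u in a]| <= 2 * k + 1)%N.
  by rewrite cardsE; apply: leq_trans (card_size _) _; rewrite sa; lia.
have pick (Z : {set V}) : (#|Z| <= 2 * k + 1)%N -> exists y, [/\ y \in D, y \notin Z & {in a,
  forall b, G y b}].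
  move=> cZ; have [y [yD yZ yadj]] := bal_pick balS DB aA ca cZ hD.
  by exists y; split=> // b ba; apply: yadj; rewrite inE.
have [y [yD ya yadj]] := pick _ ca; rewrite inE in ya.
have [||||p [sp srt up hp]] := @glue_path V G [in D] 0 (2 * k + 1) a y [::] isT.
- by rewrite /= ya.
- by apply/allP.
- move=> Z cZ; have [z [zD zZ zadj]] := pick Z cZ.
  exists z, [::]; split=> //; first by rewrite /= zD.
  split=> [b ba|u]; first by rewrite /= adj_sym !zadj.
  by rewrite inE => /eqP ->.
- by rewrite sa /=; lia.
exists (v :: take k.*2 p); apply: fan_of_path => //; last by rewrite sp sa; lia.
move=> u /hp /or3P []; rewrite ?inE.
- by move=> /eqP ->; have := Dsub y yD; rewrite !inE => /andP [/andP []].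
- by move=> /asub; rewrite !inE => /andP [/andP []].
- by move=> /Dsub; rewrite !inE => /andP [/andP []].
Qed.

Lemma indegree_lt k (V : finType) (G : sgraph V) (eta : R) (A B X : {set V}) v :
  balanced G eta A B -> A :|: B \subset X -> (forall w, isfan k G X w -> False) ->
  (2 * k + 1)%:R * (eta * #|V|%:R + 1) < (1 / 2 - 2 * eta) * #|V|%:R ->
  v \in A -> (#|nbr G v :&: A| < k)%N.
Proof.
move=> bal /subsetP ABX nofan hn vA; rewrite ltnNge; apply/negP => kdeg.
have sub u : u \in take k (enum (nbr G v :&: A)) -> u \in nbr G v :&: A.
  by move=> /mem_take; rewrite mem_enum.
have cD : (1 / 2 - 2 * eta) * #|V|%:R <= #|nbr G v :&: B|%:R.
  have := bal_gtB bal; have := bal_missA bal vA.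
  have -> : #|B|%:R = #|nbr G v :&: B|%:R + #|B :\: nbr G v|%:R :> R.
    by rewrite -natrD setIC cardsID.
  by move: (#|V|%:R : R) (#|nbr G v :&: B|%:R : R) (#|B :\: nbr G v|%:R : R) => n d e; lra.
have [||||||w fw] := @fan_at k V G eta A B X (nbr G v :&: B) v (take k (enum (nbr G v :&: A))) bal.
- by apply: ABX; rewrite inE vA.
- apply/subsetP => u uB; rewrite inE uB ABX // inE.
  by move: uB; rewrite inE => /andP [_ ->]; rewrite orbT.
- move=> u /sub uA; rewrite inE uA ABX // inE.
  by move: uA; rewrite inE => /andP [_ ->].
- by rewrite take_uniq // enum_uniq.
- by rewrite size_takel // -cardE.
- exact: lt_le_trans hn cD.
- exact: (nofan w fw).
Qed.

Lemma few_n (V : finType) (eta : R) c :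
  eta <= 1 / 100 -> 12 * c%:R + 12 <= eta * #|V|%:R -> (12 * c + 12 <= #|V|)%N.
Proof.
move=> eta1 few; rewrite -(ler_nat R) natrD natrM; apply: le_trans few _.
by rewrite ler_piMl //; apply: le_trans eta1 _; lra.
Qed.

Lemma rho_near_half k t (V : finType) (G : sgraph V) (rho : R) (x : V -> R) (eta : R) c :
  extremal k t G rho x -> eta <= 1 / 100 -> 12 * c%:R + 12 <= eta * #|V|%:R ->
  (1 / 2 - eta) * #|V|%:R <= rho.
Proof.
move=> ext eta1 few; have h := few_n eta1 few; have n0 : (0 < #|V|)%N by lia.
have := rho_lower ext n0; have : 0 <= c%:R :> R by [].
by move: few; move: (#|V|%:R : R) (c%:R : R) => n c'; lra.
Qed.

(** A vertex of [A] sees almost all of [B], and [u] sees hardly more, so the entries on [A] are at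
    least [(1 - 7 * eta) * x u]. This makes [wt x A] large, and a vertex of [B], which sees almost
    all of [A], loses a further [10 * eta]. *)
Lemma entries_aux k t (V : finType) (G : sgraph V) (rho : R) (x : V -> R)
  (eta : R) (A B : {set V}) u :
  extremal k t G rho x -> balanced G eta A B -> 0 < eta -> eta <= 1 / 100 ->
  12 * #|~: (A :|: B)|%:R + 12 <= eta * #|V|%:R ->
  {in A, forall v, #|nbr G v :&: A|%:R <= eta * #|V|%:R} ->
  {in B, forall v, #|nbr G v :&: B|%:R <= eta * #|V|%:R} ->
  u \in A -> {in A :|: B, forall v, x v <= x u} ->
  [/\ 0 < x u, {in A :|: B, forall v, (1 - 17 * eta) * x u <= x v} &
     rho <= (1 / 2 + 3 * eta) * #|V|%:R].
Proof.
move=> ext bal eta0 eta1 few inA inB uA umax.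
have rl := rho_near_half ext eta1 few.
have fewn := few_n eta1 few.
have le3 : forall v, x v <= 3 * x u.
  apply: (entry_le3 ext (S := ~: (A :|: B)) fewn).
  by move=> v; rewrite setCK; exact: umax.
have M0 : 0 < x u.
  by have [v xv _] := max_entry ext; have := lt_le_trans xv (le3 v); rewrite pmulr_rgt0.
have x0 := ext_ge0 ext.
set M := x u in umax le3 M0 *; set n : R := #|V|%:R in few inA inB rl *.
have n0 : 0 < n by rewrite ltr0n; lia.
pose T := ~: (A :|: B).
have smallT v : wt x (nbr G v :&: T) <= eta * n * M.
  apply: le_trans (sum_set_le (c := 3 * M) _) _; first by move=> w _; exact: le3.
  have : #|nbr G v :&: T|%:R <= #|T|%:R :> R by rewrite ler_nat subset_leq_card // subsetIr.
  have : 0 <= #|nbr G v :&: T|%:R :> R by [].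
  move: few; rewrite -/T; move: (#|nbr G v :&: T|%:R : R) (#|T|%:R : R) (eta * n) => a b m h a0 h2.
  by rewrite mulrA ler_wpM2r // ?ltW //; lra.
have wtM (X : {set V}) : X \subset A :|: B -> #|X|%:R <= eta * n -> wt x X <= eta * n * M.
  move=> /subsetP XAB cX; apply: le_trans (sum_set_le (c := M) _) _.
    by move=> w /XAB; exact: umax.
  by rewrite ler_wpM2r // ltW.
have AB : A \subset A :|: B by exact: subsetUl.
have BB : B \subset A :|: B by exact: subsetUr.
have split3 v : wt x (nbr G v) = wt x (nbr G v :&: A) + wt x (nbr G v :&: B) + wt x (nbr G v :&: T).
  rewrite (wt_setID _ _ A) -addrA; congr (_ + _); rewrite (wt_setID _ _ B); congr (wt x _ + wt x _).
    apply/setP => w; rewrite !inE; have := bal_dis bal; rewrite -setI_eq0 => /eqP/setP/(_ w).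
    by rewrite !inE; case: (w \in A) => //= ->; rewrite andbF.
  by apply/setP => w; rewrite !inE; case: (w \in A); case: (w \in B); rewrite ?andbF ?andbT.
have loA : {in A, forall v, wt x B - eta * n * M <= rho * x v}.
  move=> v vA; rewrite -(ext_eig ext) split3 (wt_setID x B (nbr G v)) setIC.
  have := wtM (B :\: nbr G v) (subset_trans (subsetDl _ _) BB) (bal_missA bal vA).
  have : 0 <= wt x (nbr G v :&: A) by exact: sumr_ge0.
  have : 0 <= wt x (nbr G v :&: T) by exact: sumr_ge0.
  by lra.
have loB : {in B, forall v, wt x A - eta * n * M <= rho * x v}.
  move=> v vB; rewrite -(ext_eig ext) split3 (wt_setID x A (nbr G v)) [A :&: _]setIC.
  have := wtM (A :\: nbr G v) (subset_trans (subsetDl _ _) AB) (bal_missB bal vB).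
  have : 0 <= wt x (nbr G v :&: B) by exact: sumr_ge0.
  have : 0 <= wt x (nbr G v :&: T) by exact: sumr_ge0.
  by lra.
have hiu : rho * M <= wt x B + 2 * (eta * n) * M.
  rewrite -(ext_eig ext) split3.
  have := smallT u; have := wtM _ (subset_trans (subsetIr _ _) AB) (inA u uA).
  have : wt x (nbr G u :&: B) <= wt x B by apply: sum_set_sub => //; exact: subsetIr.
  by lra.
have cB := bal_ltB bal; have cA := bal_gtA bal; rewrite -/n in cB cA.
have XB : wt x B <= (1 / 2 + eta) * n * M.
  apply: le_trans (sum_set_le (c := M) _) _.
    by move=> w wB; apply: umax; rewrite inE wB orbT.
  by rewrite ler_wpM2r // ltW.
have rhoU : rho <= (1 / 2 + 3 * eta) * n.
  by rewrite -(ler_pM2r M0); lra.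
have r0 : 0 < rho.
  by apply: lt_le_trans rl; rewrite mulr_gt0 //; lra.
have xA : {in A, forall v, (1 - 7 * eta) * M <= x v}.
  move=> v /loA h; rewrite -(ler_pM2l r0).
  have : 7 * eta * rho * M >= 3 * eta * n * M by rewrite ler_wpM2r ?(ltW M0) //; nra.
  by lra.
have XA : (1 / 2 - eta) * n * ((1 - 7 * eta) * M) <= wt x A.
  apply: le_trans (sum_set_ge xA); rewrite ler_wpM2r // mulr_ge0 ?ltW //; lra.
split=> // v; rewrite inE => /orP [/xA|/loB] h.
  by apply: le_trans h; rewrite ler_wpM2r ?ltW //; lra.
rewrite -(ler_pM2l r0); apply: le_trans h.
have e17 : 0 <= (1 - 17 * eta) * M by rewrite mulr_ge0 ?ltW //; lra.
apply: (@le_trans _ _ ((1 / 2 + 3 * eta) * n * ((1 - 17 * eta) * M))).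
  by rewrite ler_wpM2r.
apply: (@le_trans _ _ ((1 / 2 - eta) * n * ((1 - 7 * eta) * M) - eta * n * M)); last by rewrite lerD2r.
have -> : (1 / 2 + 3 * eta) * n * ((1 - 17 * eta) * M) = ((1 / 2 + 3 * eta) * (1 - 17 * eta)) * (n
  * M) by lra.
have -> : (1 / 2 - eta) * n * ((1 - 7 * eta) * M) - eta * n * M =
   ((1 / 2 - eta) * (1 - 7 * eta) - eta) * (n * M) by lra.
by rewrite ler_wpM2r ?ltW //; nra.
Qed.

Lemma balanced_entries k t (V : finType) (G : sgraph V) (rho : R) (x : V -> R)
  (eta : R) (A B : {set V}) :
  extremal k t G rho x -> balanced G eta A B -> 0 < eta -> eta <= 1 / 100 ->
  12 * #|~: (A :|: B)|%:R + 12 <= eta * #|V|%:R ->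
  {in A, forall v, #|nbr G v :&: A|%:R <= eta * #|V|%:R} ->
  {in B, forall v, #|nbr G v :&: B|%:R <= eta * #|V|%:R} ->
  exists M, [/\ 0 < M, {in A :|: B, forall v, (1 - 17 * eta) * M <= x v <= M},
     forall v, x v <= 3 * M,
     (1 / 2 - eta) * #|V|%:R <= rho & rho <= (1 / 2 + 3 * eta) * #|V|%:R].
Proof.
move=> ext bal eta0 eta1 few inA inB.
have fewn := few_n eta1 few.
have [w wAB] : exists w, w \in A :|: B.
  by apply/card_gt0P; have := cardsC (A :|: B); lia.
have [u uAB umax] := @arg_maxP _ _ _ w [in A :|: B] x wAB.
exists (x u); have rl := rho_near_half ext eta1 few.
have le3 : forall v, x v <= 3 * x u.
  apply: (entry_le3 ext (S := ~: (A :|: B)) fewn).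
  by move=> v; rewrite setCK; exact: umax.
have [uA|uB] := setUP uAB.
  have [h1 h2 h3] := entries_aux ext bal eta0 eta1 few inA inB uA umax.
  by split=> // v vAB; rewrite h2 //=; exact: umax.
rewrite setUC in few umax *; have balS := balanced_sym bal.
have [h1 h2 h3] := entries_aux ext balS eta0 eta1 few inB inA uB umax.
by split=> // v vAB; rewrite h2 //=; exact: umax.
Qed.

(* Moving [v] so that its neighbourhood becomes [N] cannot increase the
   spectral radius; the optimal weight for the moved vertex is [wt x N / rho]. *)
Lemma wt_replace_nbr k t (V : finType) (G : sgraph V) (rho : R) (x : V -> R) v (N : {set V}) :
  extremal k t G rho x -> 0 < rho -> v \notin N ->
  (forall Y Z : {set V}, (#|Y| <= t * k.*2.+1 + 2)%N -> (#|Z| <= t * k.*2.+1 + 2)%N ->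
     Z \subset N -> exists2 u, u \notin Y & {in Z, forall z, G u z}) ->
  wt x N <= rho * x v.
Proof.
move=> ext r0 vN hsub.
pose rel' a b := if a == v then b \in N else if b == v then a \in N else G a b.
have rsym : symmetric rel'.
  move=> a b; rewrite /rel'; case: (eqVneq a v) => [ea|_]; case: (eqVneq b v) => [eb|_] //.
    by rewrite ea eb.
  by rewrite adj_sym.
have rirr : irreflexive rel'.
  by move=> a; rewrite /rel'; case: eqVneq => [->|_]; [exact: negbTE | rewrite adj_irr].
pose H := SGraph rsym rirr.
have Hfree : gfree (copies t (join (pathg 1) (pathg k.*2))) H.
  apply: packing_gfree => L pL; rewrite ltnNge; apply/negP => tL.
  have pT : packing k H [set: V] (take t L).
    case/andP: pL => hL uL; apply/andP; split.
      by apply/allP => w /mem_take; exact: (allP hL).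
    by move: uL; rewrite -{1}(cat_take_drop t L) flatten_cat cat_uniq => /andP [].
  pose Z := [set u in flatten (take t L)].
  have cZ : (#|Z| <= t * k.*2.+1)%N.
    rewrite cardsE; apply: leq_trans (card_size _) _.
    by rewrite (size_flatten_packing pT) size_takel.
  (* Only adjacencies at [v] differ between [G] and [H]. In the bound [t * k.*2.+1 + 2] the vertices
     of [t] fans count once and [v] twice, as the exchanged vertex and as a forbidden
     replacement. *)
  have [||||r [r1 r2 r3 r4]] := @substitution V G H [set v] Z (t * k.*2.+1 + 1).
  - by move=> a b; rewrite !inE => av bv; rewrite /= /rel' (negbTE av) (negbTE bv).
  - by move=> a b; rewrite !inE => /eqP -> /eqP ->; rewrite /= /rel' eqxx.
  - move=> u Y; rewrite inE => /eqP -> cY.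
    have [|||u' u'Y u'adj] := hsub (v |: Y) (Z :&: N).
    + by rewrite cardsU1; case: (v \notin Y) => /=; lia.
    + by apply: leq_trans (subset_leq_card (subsetIl _ _)) _; lia.
    + exact: subsetIr.
    move: u'Y; rewrite !inE negb_or => /andP [u'v u'Y].
    exists u'; split=> //; first by rewrite inE.
    move=> y yZ; rewrite inE /= /rel' eqxx => yv yN; apply: u'adj.
    by rewrite inE yZ.
  - by rewrite cards1 leq_add2r.
  have : packing k G [set: V] (map (map r) (take t L)).
    apply: (packing_map (G' := H) (A := [set: V])) => //.
    + by move=> a b aL bL; apply: r3; rewrite inE.
    + by move=> a b aL bL; apply: r4; rewrite inE.
  by move/(ext_pack ext); rewrite size_map size_takel // ltnn.
set c := wt x N / rho; set x' : V -> R := fun u => x u + (- x v) * (u == v)%:R.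
have xN (K : {set V}) : v \notin K -> wt x' K = wt x K.
  move=> vK; apply: eq_bigr => u uK; rewrite /x'.
  by case: eqVneq => [uv|_]; rewrite ?mulr0 ?addr0 //; rewrite uv (negbTE vK) in uK.
have nbrH : nbr H v = N by apply/setP => u; rewrite inE /= /rel' eqxx.
have := ext_opt ext (erefl _) Hfree (fun u => x' u + c * (u == v)%:R).
rewrite bform_shift sqn_shift nbrH (xN N vN).
have -> : bform H x' x' = bform G x' x'.
  rewrite !bformE; apply: eq_bigr => a _; apply: eq_bigr => b _ /=; rewrite /x' /rel'.
  case: (eqVneq a v) => [->|_]; first by rewrite mulr1 addrN !mul0r !mulr0.
  by case: (eqVneq b v) => [->|_] //; rewrite mulr1 addrN !mulr0.
(* Emptying [v] costs [2 * rho * x v ^+ 2] in the form and [x v ^+ 2] in the squared norm; the new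
   entry [c] brings [2 * rho * c ^+ 2] and [c ^+ 2]. What remains is [c <= x v]. *)
have -> : bform G x' x' = rho * sqn x - 2 * x v * (rho * x v).
  rewrite bform_shift (ext_eig ext); have -> : bform G x x = rho * sqn x; last by lra.
  by rewrite /bform /sqn mulr_sumr; apply: eq_bigr => u _; rewrite (ext_eig ext); lra.
rewrite sqn_shift /x' eqxx mulr1 addrN.
have cE : wt x N = rho * c by rewrite /c mulrC divfK // gt_eqF.
have c0 : 0 <= c.
  by apply: divr_ge0; [apply: sumr_ge0 => u _; exact: ext_ge0 ext u | exact: ltW].
rewrite cE ler_pM2l // => h.
have : rho * c ^+ 2 <= rho * x v ^+ 2 by move: h; move: (sqn x) => S; lra.
by rewrite ler_pM2l // ler_sqr // ?nnegrE //; exact: ext_ge0 ext v.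
Qed.

End Balanced.

(** * Dominating vertices *)

Section Classification.
Variable R : realType.

(** The vertex may be moved so as to see exactly [B]: for every bounded subset of [B], a typical
    vertex of [A] can stand in for it. *)
Lemma wt_cross k t (V : finType) (G : sgraph V) (rho : R) (x : V -> R) (eta : R) (A B : {set V}) v :
  extremal k t G rho x -> balanced G eta A B -> 0 < rho -> v \notin B ->
  (t * k.*2.+1 + 2)%:R * (eta * #|V|%:R + 1) < (1 / 2 - eta) * #|V|%:R ->
  wt x B <= rho * x v.
Proof.
move=> ext bal r0 vB hn; apply: (wt_replace_nbr ext r0 vB) => Y Z cY cZ ZB.
have hA : (t * k.*2.+1 + 2)%:R * (eta * #|V|%:R + 1) < #|A|%:R.
  exact: lt_le_trans hn (bal_gtA bal).
by have [a [_ aY aZ]] := bal_pick bal (subxx A) ZB cZ cY hA; exists a.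
Qed.

Lemma two_sided_fan k (V : finType) (G : sgraph V) (eta del : R) (A B Z : {set V}) w c :
  balanced G eta A B -> (#|Z| <= c)%N -> w \notin Z -> w \notin A :|: B ->
  del * #|V|%:R <= #|nbr G w :&: A|%:R -> del * #|V|%:R <= #|nbr G w :&: B|%:R ->
  (k + c)%:R <= del * #|V|%:R ->
  (2 * k + 1)%:R * (eta * #|V|%:R + 1) + c%:R < del * #|V|%:R ->
  exists2 f, isfan k G (~: Z) f & {in f, forall v, v != w -> v \in A :|: B}.
Proof.
move=> bal cZ wZ wAB dA dB hk hn.
have big (D : {set V}) : (#|D| <= #|D :\: Z| + c)%N.
  rewrite -(cardsID Z D) addnC leq_add2l; apply: leq_trans cZ.
  by rewrite subset_leq_card // subsetIr.
pose a := take k (enum ((nbr G w :&: A) :\: Z)).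
have aE u : u \in a -> u \in (nbr G w :&: A) :\: Z by move/mem_take; rewrite mem_enum.
have [||||||f ff] := @fan_at R k V G eta A B (w |: ((A :|: B) :\: Z)) ((nbr G w :&: B) :\: Z) w a bal.
- exact: setU11.
- by apply/subsetP => u; rewrite !inE => /and3P [-> -> ->]; rewrite !orbT.
- by move=> u /aE; rewrite !inE => /and3P [-> -> ->]; rewrite !orbT.
- by rewrite take_uniq // enum_uniq.
- rewrite size_takel // -cardE; have := le_trans hk dA.
  by rewrite ler_nat => h; rewrite -(leq_add2r c); apply: leq_trans (big _).
- have : #|nbr G w :&: B|%:R <= #|(nbr G w :&: B) :\: Z|%:R + c%:R :> R.
    by rewrite -natrD ler_nat.
  move: hn dB; move: (#|V|%:R : R) ((2 * k + 1)%:R : R) (c%:R : R).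
  move: (#|_|%:R : R) (#|_|%:R : R) => b b' n kk cc h1 h2 h3; lra.
exists f.
  apply: (fan_subset ff) => u uf; have := fan_sub ff uf; rewrite !inE.
  by case/orP => [/eqP ->|/andP []].
move=> u uf uw; have := fan_sub ff uf; rewrite !inE (negbTE uw) /=.
by case/andP.
Qed.

(** Starting from [L], fans through the vertices of [W] are added one by one. Each meets [W] only in
    its own vertex, so the vertices of [W] still to be treated remain free. *)
Lemma two_sided_packing k t (V : finType) (G : sgraph V) (rho : R) (x : V -> R)
    (A B W : {set V}) :
  extremal k t G rho x -> [disjoint W & A :|: B] ->
  (forall w (Z : {set V}), w \in W -> w \notin Z -> (#|Z| <= t * k.*2.+1)%N ->
     exists2 f, isfan k G (~: Z) f & {in f, forall v, v != w -> v \in A :|: B}) ->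
  forall L, packing k G (~: W) L -> (#|W| + size L < t)%N.
Proof.
move=> ext dis fans L pL; rewrite ltnNge; apply/negP => tWL.
have Lt := ext_pack ext (packing_subset pL (fun v _ => in_setT v)).
have ext_fan ws : uniq ws -> {subset ws <= W} -> (size ws + size L <= t)%N ->
    exists L', [/\ packing k G [set: V] L', size L' = (size ws + size L)%N &
      {in flatten L', forall v, v \in W -> v \in ws}].
  elim: ws => [|w ws IH] /=.
    exists L; split=> // [|v vL vW]; first exact: packing_subset pL (fun v _ => in_setT v).
    by have := packing_sub pL vL; rewrite inE vW.
  case/andP=> wws uws sub sz.
  have [||L' [pL' sL' hL']] := IH uws; first by move=> v vws; apply: sub; rewrite inE vws orbT.
    exact: ltnW.
  have wW : w \in W by apply: sub; rewrite mem_head.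
  have [||f ff fAB] := fans w [set v in flatten L'] wW.
  - rewrite inE; apply/negP => /hL' /(_ wW) h; by rewrite h in wws.
  - rewrite cardsE; apply: leq_trans (card_size _) _; rewrite (size_flatten_packing pL').
    by rewrite leq_mul2r sL' (ltnW sz) orbT.
  exists (f :: L'); split.
  - case/andP: pL' => aL uL.
    have uf : uniq f by case: (f) ff => // ? ? /and5P [].
    have fT : isfan k G [set: V] f by apply: (fan_subset ff) => v _; rewrite inE.
    rewrite /packing /= fT aL cat_uniq uf uL /= andbT; apply/hasPn => v vL; apply/negP => vf.
    by have := fan_sub ff vf; rewrite !inE vL.
  - by rewrite /= sL'.
  - move=> v; rewrite /= mem_cat => /orP [vf|vL] vW; last by rewrite inE hL' ?orbT.
    rewrite inE; case: eqVneq => //= vw; move: dis; rewrite disjoint_sym => /pred0P /(_ v) /=.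
    by rewrite vW fAB.
have [|||L' [pL' sL' _]] := ext_fan (take (t - size L) (enum W)).
- by rewrite take_uniq // enum_uniq.
- by move=> v /mem_take; rewrite mem_enum.
- by rewrite size_takel -?cardE; lia.
have := ext_pack ext pL'; rewrite sL' size_takel -?cardE; lia.
Qed.

(** A discarded vertex with few neighbours in one part must see almost all of the other and is
    assigned accordingly; those with at least [del * n] neighbours in both parts form [W]. *)
Lemma classification k t (del : R) : (2 < k)%N -> (0 < t)%N -> 0 < del -> del <= 1 / 400 ->
  exists N : nat, forall (V : finType) (G : sgraph V) (rho : R) (x : V -> R),
    extremal k t G rho x -> (N <= #|V|)%N ->
    exists V1 V2 W : {set V}, [/\ balanced G (2 * del) V1 V2, V1 :|: V2 = ~: W,
      {in V1, forall v, #|nbr G v :&: V1|%:R <= 2 * del * #|V|%:R},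
      {in V2, forall v, #|nbr G v :&: V2|%:R <= 2 * del * #|V|%:R} &
      forall L, packing k G (~: W) L -> (#|W| + size L < t)%N].
Proof.
move=> k2 t0 del0 del1; set K := (t * k.*2.+1 + 2)%N.
have K0 : 0 < K%:R :> R by rewrite ltr0n /K addn2.
have K1 : 1 <= K%:R :> R by rewrite ler1n /K addn2.
(* Common neighbourhoods of up to [K] vertices, enough for [t] fans, have to stay large: the total
   loss [K * e1 * n] is [del * n / 20]. *)
pose e1 := del / 20 / K%:R.
have e10 : 0 < e1 by rewrite divr_gt0 // divr_gt0.
have Ke1 : K%:R * e1 = del / 20.
  by rewrite /e1 mulrC divfK // gt_eqF.
have e1del : e1 <= del / 20 by rewrite -Ke1 ler_peMl // ltW.
have [N1 [c hc]] := typical_structure k t e10.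
have [N2 hN2] := nat_above ((12 * c + 12 + K + k)%:R / e1).
exists (N1 + N2)%N => V G rho x ext NV.
have [|A [B [bal cAB nofan]]] := hc V G rho x ext; first by apply: leq_trans NV; exact: leq_addr.
set n : R := #|V|%:R.
have nlarge : 12 * c%:R + 12 + K%:R + k%:R <= e1 * n.
  have : (12 * c + 12 + K + k)%:R / e1 <= n.
    by apply: le_trans hN2 _; rewrite ler_nat; apply: leq_trans NV; exact: leq_addl.
  by rewrite ler_pdivrMr // mulrC 3!natrD natrM.
have c0 : 0 <= c%:R :> R by [].
have k0 : 0 <= k%:R :> R by [].
have en0 : 0 < e1 * n by lra.
have n0 : 0 < n by rewrite -(pmulr_rgt0 _ e10).
have Kn : K%:R * (e1 * n) = del / 20 * n by rewrite mulrA Ke1.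
have en : 20 * (e1 * n) <= del * n.
  by have := e1del; rewrite -(ler_pM2r n0); lra.
have dn : del * n <= n / 400 by have := del1; rewrite -(ler_pM2r n0); lra.
have kK : (2 * k + 1)%:R <= K%:R :> R.
  rewrite ler_nat /K mul2n addn1 -[X in (X <= _)%N]addn0; apply: leq_add => //.
  exact: leq_pmull.
have KK : K%:R * (e1 * n + 1) <= del * n / 10 by rewrite mulrDr mulr1 Kn; lra.
have kK2 : (2 * k + 1)%:R * (e1 * n + 1) <= del * n / 10.
  by apply: le_trans KK; rewrite ler_wpM2r //; lra.
pose T := ~: (A :|: B).
have cT : #|T|%:R <= c%:R :> R by rewrite ler_nat.
have degA : {in A, forall v, (#|nbr G v :&: A| < k)%N}.
  move=> v vA; apply: (indegree_lt bal (subxx _) nofan _ vA); rewrite -/n; lra.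
have degB : {in B, forall v, (#|nbr G v :&: B| < k)%N}.
  move=> v vB; apply: (indegree_lt (balanced_sym bal) _ nofan _ vB).
    by rewrite setUC.
  by rewrite -/n; lra.
have degA' : {in A, forall v, #|nbr G v :&: A|%:R <= e1 * n}.
  move=> v /degA h; apply: (@le_trans _ _ k%:R); last lra.
  by rewrite ler_nat ltnW.
have degB' : {in B, forall v, #|nbr G v :&: B|%:R <= e1 * n}.
  move=> v /degB h; apply: (@le_trans _ _ k%:R); last lra.
  by rewrite ler_nat ltnW.
have few : 12 * #|~: (A :|: B)|%:R + 12 <= e1 * n by rewrite -/T; lra.
have e1s : e1 <= 1 / 100 by lra.
have [M [M0 entries le3 rl _]] := balanced_entries ext bal e10 e1s few degA' degB'.
have r0 : 0 < rho by apply: lt_le_trans rl; rewrite mulr_gt0 //; lra.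
have x0 := ext_ge0 ext.
have crossB v : v \notin A :|: B -> wt x B <= rho * x v.
  rewrite inE negb_or => /andP [_ vB]; apply: (wt_cross ext bal r0 vB); rewrite -/n -/K; lra.
have crossA v : v \notin A :|: B -> wt x A <= rho * x v.
  rewrite inE negb_or => /andP [vA _]; apply: (wt_cross ext (balanced_sym bal) r0 vA).
  by rewrite -/n -/K; lra.
(* As the moving inequality [wt x Y <= rho * x v] holds, the neighbours of [v] weigh at least as
   much as [Y]; with few of them in [X] and boundedly many in [T], almost all of [Y] must be among
   them. *)
have forced (X Y : {set V}) v : X :|: Y = A :|: B -> [disjoint X & Y] ->
    #|Y|%:R <= (1 / 2 + e1) * n -> wt x Y <= rho * x v ->
    #|nbr G v :&: X|%:R < del * n -> #|Y :\: nbr G v|%:R <= del * n + 10 * (e1 * n).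
  move=> XY dXY cY; rewrite -(ext_eig ext) => hw hX.
  have split3 : wt x (nbr G v) <= wt x (nbr G v :&: X) + wt x (nbr G v :&: Y) + wt x (nbr G v :&: T).
    rewrite (wt_setID _ _ X) -addrA lerD2l (wt_setID _ _ Y); apply: lerD.
      by apply: sum_set_sub => //; apply/subsetP => u; rewrite !inE => /andP [/andP [_ ->] ->].
    apply: sum_set_sub => //; apply/subsetP => u.
    by rewrite /T -XY !inE negb_or => /andP [-> /andP [-> ->]].
  have wX : wt x (nbr G v :&: X) <= del * n * M.
    apply: (@le_trans _ _ (#|nbr G v :&: X|%:R * M)).
      apply: sum_set_le => u; rewrite inE => /andP [_ uX].
      by have /entries /andP [] : u \in A :|: B by rewrite -XY inE uX.
    by rewrite ler_wpM2r // ltW.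
  have wY : wt x (nbr G v :&: Y) <= #|nbr G v :&: Y|%:R * M.
    apply: sum_set_le => u; rewrite inE => /andP [_ uY].
    by have /entries /andP [] : u \in A :|: B by rewrite -XY inE uY orbT.
  have wT : wt x (nbr G v :&: T) <= c%:R * (3 * M).
    apply: le_trans (sum_set_le (c := 3 * M) _) _; first by move=> u _; exact: le3.
    rewrite ler_wpM2r //; first lra.
    by apply: le_trans cT; rewrite ler_nat subset_leq_card // subsetIr.
  have wYl : #|Y|%:R * ((1 - 17 * e1) * M) <= wt x Y.
    apply: sum_set_ge => u uY.
    by have /entries /andP [] : u \in A :|: B by rewrite -XY inE uY orbT.
  have cYE : #|Y|%:R = #|nbr G v :&: Y|%:R + #|Y :\: nbr G v|%:R :> R.
    by rewrite -natrD setIC cardsID.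
  have : #|Y|%:R * (1 - 17 * e1) <= del * n + #|nbr G v :&: Y|%:R + c%:R * 3.
    rewrite -(ler_pM2r M0); apply: (@le_trans _ _ (wt x Y)); first by rewrite -mulrA.
    by apply: le_trans hw _; apply: le_trans split3 _; lra.
  have : #|Y|%:R * e1 <= (1 / 2 + e1) * (e1 * n).
    by have := ler_wpM2r (ltW e10) cY; lra.
  have : e1 * (e1 * n) <= e1 * n / 100 by have := e1s; rewrite -(ler_pM2r en0); lra.
  move: cYE; move: (#|Y|%:R : R) (#|nbr G v :&: Y|%:R : R) (#|Y :\: nbr G v|%:R : R) => y y1 y2.
  by move=> cYE h1 h2 h3; lra.
have AT : [disjoint A & B] by exact: bal_dis bal.
have plusT (X Y : {set V}) : X \subset Y :|: T -> #|X|%:R <= #|Y|%:R + c%:R :> R.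
  move=> XY; rewrite -natrD ler_nat; apply: leq_trans (subset_leq_card XY) _.
  by apply: leq_trans (leq_card_setU _ _) _; rewrite leq_add2l.
pose V1 := A :|: [set v in T | #|nbr G v :&: A|%:R < del * n].
pose V2 := B :|: [set v in T | (del * n <= #|nbr G v :&: A|%:R) && (#|nbr G v :&: B|%:R < del * n)].
pose W := [set v in T | (del * n <= #|nbr G v :&: A|%:R) && (del * n <= #|nbr G v :&: B|%:R)].
have V1T : V1 \subset A :|: T by apply: setUS; apply/subsetP => v; rewrite inE => /andP [].
have V2T : V2 \subset B :|: T by apply: setUS; apply/subsetP => v; rewrite inE => /andP [].
have subT (X Y Z : {set V}) : X \subset Y :|: T -> Z :&: X \subset (Z :&: Y) :|: T.
  move=> /subsetP h; apply/subsetP => v; rewrite !inE => /andP [-> /h].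
  by rewrite !inE.
have subTD (X Y Z : {set V}) : X \subset Y :|: T -> X :\: Z \subset (Y :\: Z) :|: T.
  by rewrite !setDE ![_ :&: ~: Z]setIC; exact: subT.
have dAT v : v \in A -> v \notin T by rewrite !inE => ->.
have dBT v : v \in B -> v \notin T by rewrite !inE => ->; rewrite orbT.
have c12 : 12 * c%:R <= e1 * n by lra.
have cA1 := bal_ltA bal; have cA2 := bal_gtA bal; have cB1 := bal_ltB bal; have cB2 := bal_gtB bal.
rewrite -/n in cA1 cA2 cB1 cB2.
have sub_le (X Y : {set V}) : X \subset Y -> #|X|%:R <= #|Y|%:R :> R.
  by move=> h; rewrite ler_nat subset_leq_card.
have V12 : V1 :|: V2 = ~: W.
  apply/setP => v; rewrite /V1 /V2 /W !in_setU in_setC inE [v \in [set _ in T | _]]inE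
     [v \in [set _ in T | _]]inE /T in_setC in_setU.
  case: (v \in A); case: (v \in B) => //=.
  by rewrite !ltNge; do 2!case: (_ <= _).
have disV : [disjoint V1 & V2].
  rewrite -setI_eq0; apply/eqP/setP => v; rewrite /V1 /V2 in_setI !in_setU in_set0
    [v \in [set _ in T | _]]inE [v \in [set _ in T | _]]inE /T in_setC in_setU.
  have := AT; rewrite -setI_eq0 => /eqP/setP/(_ v); rewrite in_setI in_set0.
  case: (v \in A); case: (v \in B) => //= _.
  by rewrite ltNge; case: (_ <= _).
clear few entries le3 rl kK KK dn.
exists V1, V2, W; split=> //.
- split=> //; rewrite -/n.
  + by apply: le_trans (plusT _ _ V1T) _; lra.
  + by apply: le_trans (plusT _ _ V2T) _; lra.
  + by apply: le_trans (sub_le _ _ (subsetUl _ _)); lra.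
  + by apply: le_trans (sub_le _ _ (subsetUl _ _)); lra.
  + move=> v vV1; apply: le_trans (plusT _ _ (subTD _ _ _ V2T)) _.
    move: vV1; rewrite inE => /orP [vA|].
      by have := bal_missA bal vA; rewrite -/n; lra.
    rewrite inE => /andP [vT hA]; have vAB : v \notin A :|: B by rewrite -in_setC.
    by have := forced A B v (erefl _) AT cB1 (crossB v vAB) hA; lra.
  + move=> v vV2; apply: le_trans (plusT _ _ (subTD _ _ _ V1T)) _.
    move: vV2; rewrite inE => /orP [vB|].
      by have := bal_missB bal vB; rewrite -/n; lra.
    rewrite inE => /and3P [vT _ hB]; have vAB : v \notin A :|: B by rewrite -in_setC.
    have dBA : [disjoint B & A] by rewrite disjoint_sym.
    by have := forced B A v (setUC _ _) dBA cA1 (crossA v vAB) hB; lra.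
- move=> v vV1; apply: le_trans (plusT _ _ (subT _ _ _ V1T)) _; rewrite -/n.
  move: vV1; rewrite inE => /orP [/degA'|]; first by lra.
  by rewrite inE => /andP [_ hA]; lra.
- move=> v vV2; apply: le_trans (plusT _ _ (subT _ _ _ V2T)) _; rewrite -/n.
  move: vV2; rewrite inE => /orP [/degB'|]; first by lra.
  by rewrite inE => /and3P [_ _ hB]; lra.
apply: (two_sided_packing (A := A) (B := B) ext).
  rewrite -setI_eq0; apply/eqP/setP => v; rewrite in_setI /W inE in_set0 /T in_setC.
  by case: (v \in A :|: B); rewrite ?andbF.
move=> w Z; rewrite inE => /and3P [wT wA wB] wZ cZ.
have wAB : w \notin A :|: B by rewrite -in_setC.
have tK : (t * k.*2.+1)%:R + 2 = K%:R :> R by rewrite /K natrD.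
apply: (two_sided_fan bal cZ wZ wAB wA wB); rewrite -/n ?natrD; lra.
Qed.

End Classification.

(** * Exactly [t - 1] dominating vertices *)

Section DominatingSet.
Variable R : realType.

(** With all entries positive, an added edge strictly raises the form at the eigenvector [x], beyond
    what [ext_opt] allows. *)
Lemma extremal_maximal k t (V : finType) (G H : sgraph V) (rho : R) (x : V -> R) :
  extremal k t G rho x -> (forall v, 0 < x v) ->
  gfree (copies t (join (pathg 1) (pathg k.*2))) H ->
  (forall a b, G a b -> H a b) -> forall a b, H a b -> G a b.
Proof.
move=> ext xpos Hfree sub a b Hab; apply/negPn/negP => nG.
have := ext_opt ext (erefl _) Hfree x; apply/negP; rewrite -ltNge.
have -> : rho * sqn x = bform G x x.
  by rewrite /bform /sqn mulr_sumr; apply: eq_bigr => u _; rewrite (ext_eig ext); lra.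
rewrite !bformE (bigD1 a) //= [X in _ < X](bigD1 a) //=; apply: ltr_leD.
  rewrite (bigD1 b) //= [X in _ < X](bigD1 b) //=; apply: ltr_leD.
    by rewrite Hab (negbTE nG) mul0r mul1r mulr_gt0.
  apply: ler_sum => v _; apply: ler_wpM2r; first by rewrite ltW // mulr_gt0.
  by rewrite ler_nat; case g: (G a v) => //; rewrite (sub _ _ g).
apply: ler_sum => u _; apply: ler_sum => v _; apply: ler_wpM2r; first by rewrite ltW // mulr_gt0.
by rewrite ler_nat; case g: (G u v) => //; rewrite (sub _ _ g).
Qed.

(** Joining [W] to every vertex creates no fan outside [W], so [W] certifies the enlarged graph, and
    maximality applies. *)
Lemma dominating_edges k t (V : finType) (G : sgraph V) (rho : R) (x : V -> R) (W : {set V}) :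
  extremal k t G rho x -> (forall v, 0 < x v) -> (#|W| < t)%N ->
  (forall w, isfan k G (~: W) w -> False) -> {in W, forall w v, v != w -> G w v}.
Proof.
move=> ext xpos Wt nofan w wW v vw.
pose r a b := (a != b) && [|| G a b, a \in W | b \in W].
have rs : symmetric r by move=> a b; rewrite /r eq_sym adj_sym [(a \in W) || _]orbC.
have ri : irreflexive r by move=> a; rewrite /r eqxx.
apply: (extremal_maximal (H := SGraph rs ri) ext xpos).
- apply: (gfree_hit Wt) => f ff; apply: (nofan (map id f)).
  apply: (fan_map _ _ _ ff) => //.
    move=> a b af bf; rewrite /= /r; have := fan_sub ff af; have := fan_sub ff bf.
    by rewrite !inE => /negbTE -> /negbTE ->; rewrite !orbF => /andP [].
  by move=> a af; exact: fan_sub ff af.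
- move=> a b g; rewrite /= /r g /= andbT; apply/eqP => ab.
  by rewrite ab adj_irr in g.
by rewrite /= /r eq_sym vw wW orbT.
Qed.

(* If deleting the edges inside the parts at a bounded set [U] kills all fans
   outside [W], then it pays to make some [D \subset U] dominating instead:
   linearly many edges are gained per vertex of [D], few are lost. *)
Lemma no_cheap_dominating k t (V : finType) (G : sgraph V) (rho : R) (x : V -> R)
    (eta M : R) (V1 V2 W U D : {set V}) :
  extremal k t G rho x -> balanced G eta V1 V2 -> V1 :|: V2 = ~: W ->
  {in V1, forall v, #|nbr G v :&: V1|%:R <= eta * #|V|%:R} ->
  {in V2, forall v, #|nbr G v :&: V2|%:R <= eta * #|V|%:R} ->
  0 < M -> {in V1 :|: V2, forall v, 9 / 10 * M <= x v <= M} ->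
  0 < eta -> eta <= 1 / 100 ->
  D \subset U -> U \subset ~: W -> (0 < #|D|)%N -> (#|W| + #|D| < t)%N ->
  (#|U| <= k.*2.+1 * #|D|)%N ->
  (forall w, isfan k G (~: (W :|: U)) w -> False) ->
  (t * k.*2.+1)%:R <= eta * #|V|%:R ->
  (4 * t * k.*2.+1)%:R * (eta * #|V|%:R + 1) < 1 / 20 * #|V|%:R -> False.
Proof.
move=> ext bal V12 in1 in2 M0 ent eta0 eta1 /subsetP DU /subsetP UW D0 WDt cU nofan tn hn.
have Ut : (#|U| <= t * k.*2.+1)%N.
  by apply: leq_trans cU _; rewrite mulnC leq_mul2r; lia.
have dis : forall v, v \in V1 -> v \in V2 -> False.
  move=> v v1 v2; have := bal_dis bal; rewrite -setI_eq0 => /eqP/setP/(_ v).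
  by rewrite !inE v1 v2.
have UV u : u \in U -> (u \in V1) || (u \in V2).
  by move=> /UW; rewrite -V12 inE.
pose opp a b := (a \in V1) && (b \in V2) || (a \in V2) && (b \in V1).
have opp_sym a b : opp a b = opp b a by rewrite /opp orbC ![(_ \in V1) && _]andbC.
(* Of the edges at [U], only those to the opposite part that avoid a second vertex of [U] are kept.
   Hence, in a fan of [H0], a vertex of [U] can be exchanged for a typical vertex of its own
   part. *)
pose r0 a b := G a b && [|| (a \notin U) && (b \notin U) | ~~ ((a \in U) && (b \in U)) && opp a b].
have r0s : symmetric r0.
  by move=> a b; rewrite /r0 adj_sym opp_sym [(a \notin U) && _]andbC [(a \in U) && _]andbC.
have r0i : irreflexive r0 by move=> a; rewrite /r0 adj_irr.
pose H0 := SGraph r0s r0i.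
pose DD := W :|: D.
pose r a b := (a != b) && [|| a \in DD, b \in DD | r0 a b].
have rs : symmetric r by move=> a b; rewrite /r eq_sym r0s orbCA.
have ri : irreflexive r by move=> a; rewrite /r eqxx.
pose H := SGraph rs ri.
have Hfree : gfree (copies t (join (pathg 1) (pathg k.*2))) H.
  apply: (gfree_hit (W := DD)).
    by apply: leq_ltn_trans WDt; exact: leq_card_setU.
  move=> f ff.
  have f0 : isfan k H0 (~: DD) f.
    rewrite -[f]map_id; apply: (fan_map _ _ _ ff) => //.
      move=> a b af bf; rewrite /= /r; have := fan_sub ff af; have := fan_sub ff bf.
      by rewrite ![_ \in ~: _]inE => /negbTE -> /negbTE -> /andP [].
    by move=> a af; exact: fan_sub ff af.
  pose Z := W :|: [set v in f].
  have cZ : (#|Z| <= t + k.*2.+1)%N.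
    apply: leq_trans (leq_card_setU _ _) _; apply: leq_add; first by lia.
    by rewrite cardsE -(size_fan ff) card_size.
  have pick (A B Y Q : {set V}) : balanced G eta A B -> Q \subset B ->
      (#|Y| <= 3 * t * k.*2.+1)%N -> (#|Q| <= 3 * t * k.*2.+1)%N ->
      exists a, [/\ a \in A, a \notin Y :|: U & {in Q, forall y, G a y}].
    move=> bAB QB cY cQ; apply: (bal_pick (c := 4 * t * k.*2.+1) bAB (subxx A) QB).
    - by apply: leq_trans cQ _; rewrite -!mulnA leq_mul2r orbT.
    - apply: leq_trans (leq_card_setU _ _) _.
      have -> : (4 * t * k.*2.+1 = 3 * t * k.*2.+1 + t * k.*2.+1)%N by rewrite -[(4 * t)%N]/((3 +
        1) * t)%N mulnDl mul1n mulnDl.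
      exact: leq_add.
    apply: lt_le_trans hn _; apply: le_trans (bal_gtA bAB).
    by rewrite ler_wpM2r //; lra.
  have c2 : (#|Z| + #|U| <= 3 * t * k.*2.+1)%N.
    have h1 : (t <= t * k.*2.+1)%N by exact: leq_pmulr.
    have h2 : (k.*2.+1 <= t * k.*2.+1)%N by apply: leq_pmull; exact: ext_t ext.
    rewrite -mulnA; move: (t * k.*2.+1)%N h1 h2 cZ Ut => p h1 h2 cZ Ut; lia.
  have [||||r' [r1 r2 r3 r4]] := @substitution V G H0 U Z (3 * t * k.*2.+1).
  - by move=> a b aU bU /andP [].
  - by move=> a b aU bU; rewrite /= /r0 aU bU /= andbF.
  - move=> u Y uU cY.
    have sub (A B : {set V}) : (#|Z :&: B| <= 3 * t * k.*2.+1)%N.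
      by apply: leq_trans (subset_leq_card (subsetIl _ _)) _; apply: leq_trans c2; exact: leq_addr.
    case/orP: (UV u uU) => uV.
      have [a [aA aY aQ]] := pick V1 V2 Y (Z :&: V2) bal (subsetIr _ _) cY (sub V1 V2).
      move: aY; rewrite inE negb_or => /andP [aY aU].
      exists a; split=> // y yZ yU; rewrite /= /r0 uU /= (negbTE yU) /= => /andP [_].
      rewrite /opp uV /=; case: (boolP (u \in V2)) => [uV2|_]; first by case: (dis u).
      by rewrite orbF => yV; apply: aQ; rewrite inE yZ.
    have [a [aA aY aQ]] := pick V2 V1 Y (Z :&: V1) (balanced_sym bal) (subsetIr _ _) cY (sub V2 V1).
    move: aY; rewrite inE negb_or => /andP [aY aU].
    exists a; split=> // y yZ yU; rewrite /= /r0 uU /= (negbTE yU) /= => /andP [_].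
    rewrite /opp uV /=; case: (boolP (u \in V1)) => [uV1|_]; first by case: (dis u).
    by move=> yV; apply: aQ; rewrite inE yZ.
  - exact: c2.
  apply: (nofan (map r' f)); apply: (fan_map _ _ _ f0).
  - by move=> a b af bf; apply: r3; rewrite !inE ?af ?bf orbT.
  - by move=> a b af bf; apply: r4; rewrite !inE ?af ?bf orbT.
  - move=> a af; have aW : a \notin W.
      by have := fan_sub ff af; rewrite in_setC /DD in_setU negb_or => /andP [].
    rewrite in_setC in_setU negb_or.
    case: (boolP (a \in U)) => aU; last by rewrite r1 // aW.
    have /andP [h1 h2] := r2 a aU; rewrite h2 andbT.
    by apply: contra h1 => h; rewrite inE h.
pose sd a := if a \in V1 then V1 else V2.
pose S a := (nbr G a :&: sd a) :|: U.
pose good a := (sd a :\ a) :\: nbr G a.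
have opp_sd a b : a \in U -> b \in V1 :|: V2 -> ~~ opp a b -> b \in sd a.
  move=> aU; rewrite inE /opp /sd => bV; case/orP: (UV a aU) => aV.
    by rewrite aV /=; case: (boolP (b \in V2)) bV => // _; rewrite orbF.
  rewrite aV /=; case: ifP => [aV1|_]; first by case: (dis a).
  by rewrite /= ; case: (boolP (b \in V1)) bV.
pose i (b : bool) : R := b%:R.
(* Pointwise accounting: an edge of [G] survives in [H] or is charged to an end in [U], and the new
   edges from [D] to [good] come on top. *)
have pw a b : i (G a b) + i ((a \in D) && (b \in good a)) <=
    i (H a b) + (i ((a \in U) && (b \in S a)) + i ((b \in U) && (a \in S b))).
  rewrite /i -!natrD ler_nat; case: (boolP (a \in D)) => aD /=.
    case: (boolP (b \in good a)) => [|_].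
      rewrite !inE => /andP [/negbTE -> /andP [ba _]].
      by rewrite /r eq_sym ba [a \in DD]inE aD orbT.
    rewrite addn0; case g: (G a b) => //; rewrite /r [a \in DD]inE aD orbT /=.
    by have -> : a != b by apply/eqP => ab; rewrite ab adj_irr in g.
  rewrite addn0; case g: (G a b) => //.
  have ab : a != b by apply/eqP => ab; rewrite ab adj_irr in g.
  rewrite /r ab /=; case: (boolP (a \in DD)) => //= aDD; case: (boolP (b \in DD)) => //= bDD.
  have [aW bW] : a \notin W /\ b \notin W.
    by move: aDD bDD; rewrite !inE !negb_or => /andP [-> _] /andP [-> _].
  rewrite /r0 g /=; case: (boolP (a \in U)) => aU /=; case: (boolP (b \in U)) => bU //=.
  - by rewrite !inE bU !orbT.
  - case: (boolP (opp a b)) => // nopp; rewrite addn0 !inE g (negbTE bU) orbF.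
    by rewrite opp_sd // V12 inE.
  - case: (boolP (opp a b)) => // nopp; rewrite !inE [G b a]adj_sym g (negbTE aU) orbF.
    by rewrite opp_sd // ?V12 ?inE // opp_sym.
have sumE (P : V -> {set V}) (Q : {set V}) :
    \sum_a \sum_b i ((a \in Q) && (b \in P a)) * (x a * x b) = \sum_(a in Q) \sum_(b in P a) x a * x b.
  rewrite [RHS]big_mkcond; apply: eq_bigr => a _; case: (a \in Q); last first.
    by rewrite big1 // => b _; rewrite mul0r.
  rewrite [RHS]big_mkcond; apply: eq_bigr => b _; rewrite /i.
  by case: (b \in P a); rewrite ?mul1r ?mul0r.
have main : \sum_(a in D) \sum_(b in good a) x a * x b <= 2 * \sum_(a in U) \sum_(b in S a) x a * x b.
  have := ext_opt ext (erefl _) Hfree x.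
  have -> : rho * sqn x = bform G x x.
    by rewrite /bform /sqn mulr_sumr; apply: eq_bigr => u _; rewrite (ext_eig ext) mulrCA.
  rewrite !bformE -!sumE => hGH.
  have : \sum_a \sum_b (i (G a b) + i ((a \in D) && (b \in good a))) * (x a * x b) <=
      \sum_a \sum_b (i (H a b) + (i ((a \in U) && (b \in S a)) + i ((b \in U) && (a \in S b)))) *
        (x a * x b).
    apply: ler_sum => a _; apply: ler_sum => b _; apply: ler_wpM2r; last exact: pw.
    by rewrite mulr_ge0 // (ext_ge0 ext).
  have spl (f g : V -> V -> R) : \sum_a \sum_b (f a b + g a b) * (x a * x b) =
      \sum_a \sum_b f a b * (x a * x b) + \sum_a \sum_b g a b * (x a * x b).
    rewrite -big_split; apply: eq_bigr => a _; rewrite -big_split; apply: eq_bigr => b _.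
    by rewrite mulrDl.
  rewrite !spl.
  have -> : \sum_a \sum_b i ((b \in U) && (a \in S b)) * (x a * x b) =
      \sum_a \sum_b i ((a \in U) && (b \in S a)) * (x a * x b).
    rewrite exchange_big; apply: eq_bigr => a _; apply: eq_bigr => b _.
    by rewrite [x b * _]mulrC.
  by move: hGH; rewrite /i => h1 h2; rewrite mulrDl mul1r; apply: le_trans (_ : _ <= _) _; last first;
    [exact: lexx | move: h1 h2; set a1 := \sum_a _; set a2 := \sum_a _; set a3 := \sum_a _;
      set a4 := \sum_a _; lra].
set n : R := #|V|%:R in bal in1 in2 tn hn *.
set f : R := k.*2.+1%:R.
have f1 : 1 <= f by rewrite ler1n.
have tf : f <= (t * k.*2.+1)%:R by rewrite ler_nat; apply: leq_pmull; exact: ext_t ext.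
have tf4 : (4 * t * k.*2.+1)%:R = 4 * (t * k.*2.+1)%:R :> R by rewrite -mulnA natrM.
have en0 : 0 <= eta * n by apply: le_trans tn.
have fen : 4 * (f * (eta * n)) + 4 < n / 20.
  apply: le_lt_trans (_ : (4 * t * k.*2.+1)%:R * (eta * n + 1) < n / 20); last by lra.
  rewrite tf4; have := ler_wpM2r en0 tf; lra.
have in_sd a : a \in D -> #|nbr G a :&: sd a|%:R <= eta * n.
  move=> /DU /UV; rewrite /sd; case: ifP => [aV _|_ /= aV]; [exact: in1|exact: in2].
have in_sdU a : a \in U -> #|nbr G a :&: sd a|%:R <= eta * n.
  move=> /UV; rewrite /sd; case: ifP => [aV _|_ /= aV]; [exact: in1|exact: in2].
have sdV a : sd a \subset V1 :|: V2.
  by rewrite /sd; case: ifP => _; [exact: subsetUl | exact: subsetUr].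
have M2 : 0 < M * M by rewrite mulr_gt0.
have cgood a : a \in D -> (1 / 2 - 2 * eta) * n - 1 <= #|good a|%:R.
  move=> aD; have := in_sd a aD.
  have : (1 / 2 - eta) * n <= #|sd a|%:R.
    by rewrite /sd; case: ifP => _; [exact: bal_gtA bal | exact: bal_gtB bal].
  have : #|sd a|%:R <= #|good a|%:R + 1 + #|nbr G a :&: sd a|%:R :> R.
    suff : (#|sd a| <= #|good a| + 1 + #|nbr G a :&: sd a|)%N by rewrite -(ler_nat R) 2!natrD.
    have h1 : (#|sd a| <= #|sd a :\ a| + 1)%N by rewrite (cardsD1 a (sd a)) addnC leq_add2l leq_b1.
    have h2 : (#|sd a :\ a| <= #|(sd a :\ a) :\: nbr G a| + #|nbr G a :&: sd a|)%N.
      rewrite -(cardsID (nbr G a)) addnC leq_add2l subset_leq_card //.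
      by rewrite setIC setIS // subsetDl.
    by apply: leq_trans h1 _; rewrite addnAC leq_add2r.
  by move: (#|sd a|%:R : R) (#|good a|%:R : R) (#|_|%:R : R) => q1 q2 q3; lra.
have lowD : #|D|%:R * (((1 / 2 - 2 * eta) * n - 1) * (81 / 100 * (M * M))) <=
    \sum_(a in D) \sum_(b in good a) x a * x b.
  apply: sum_set_ge => a aD; apply: le_trans (sum_set_ge (c := 81 / 100 * (M * M)) _).
    by rewrite ler_wpM2r ?cgood //; apply: mulr_ge0; [lra | exact: ltW].
  move=> b; rewrite in_setD in_setD1 => /and3P [_ _ bsd].
  have /ent /andP [hb _] : b \in V1 :|: V2 by exact: subsetP (sdV a) b bsd.
  have /ent /andP [ha _] : a \in V1 :|: V2 by rewrite inE; apply: UV; exact: DU.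
  have -> : 81 / 100 * (M * M) = (9 / 10 * M) * (9 / 10 * M) by lra.
  by apply: ler_pM => //; rewrite mulr_ge0 ?ltW //; lra.
have upU : \sum_(a in U) \sum_(b in S a) x a * x b <= #|U|%:R * (2 * (eta * n) * (M * M)).
  apply: sum_set_le => a aU; apply: le_trans (sum_set_le (c := M * M) _) _.
    move=> b bS; have /ent /andP [_ hb] : b \in V1 :|: V2.
      by move: bS; rewrite inE inE => /orP [/andP [_ h]|h];
        [exact: subsetP (sdV a) b h|rewrite inE; exact: UV].
    have /ent /andP [_ ha] : a \in V1 :|: V2 by rewrite inE; exact: UV.
    by apply: ler_pM => //; exact: ext_ge0 ext _.
  rewrite ler_wpM2r ?(ltW M2) //.
  have : #|S a|%:R <= #|nbr G a :&: sd a|%:R + #|U|%:R :> R.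
    by rewrite -natrD ler_nat leq_card_setU.
  have : #|U|%:R <= eta * n by apply: le_trans tn; rewrite ler_nat.
  by have := in_sdU a aU; lra.
have cUR : #|U|%:R <= f * #|D|%:R by rewrite -natrM ler_nat.
have D0R : 0 < #|D|%:R :> R by rewrite ltr0n.
(* After cancelling [#|D|] and [M * M], the gain per vertex of [D] is nearly [0.4 * n], while the
   loss is at most [4 * f * eta * n], which is below [n / 20]. *)
have : #|D|%:R * (((1 / 2 - 2 * eta) * n - 1) * (81 / 100 * (M * M))) <=
    #|D|%:R * (4 * (f * (eta * n)) * (M * M)).
  apply: le_trans lowD _; apply: le_trans main _.
  have h1 : 0 <= 4 * (eta * n) * (M * M) by rewrite mulr_ge0 ?(ltW M2) // mulr_ge0.
  by have := ler_wpM2r h1 cUR; lra.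
rewrite ler_pM2l // mulrA ler_pM2r // => h.
have n0 : 0 <= n by [].
have : eta * n <= n / 100 by have := ler_wpM2r n0 eta1; lra.
have : 0 <= f * (eta * n) by rewrite mulr_ge0 //; lra.
by lra.
Qed.

(** [no_cheap_dominating] is used twice: to show that no fan avoids [W], and then, with a single
    vertex, that [W] cannot have fewer than [t - 1] vertices. *)
Lemma dominating_set k t (eta : R) : (2 < k)%N -> (0 < t)%N -> 0 < eta ->
  (4 * t * k.*2.+1)%:R * eta <= 1 / 40 ->
  exists N : nat, forall (V : finType) (G : sgraph V) (rho : R) (x : V -> R),
    extremal k t G rho x -> (N <= #|V|)%N ->
    exists (V1 V2 W : {set V}) M,
      [/\ balanced G eta V1 V2, V1 :|: V2 = ~: W, #|W|.+1 = t,
        {in W, forall w v, v != w -> G w v} &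
        (forall w, isfan k G (~: W) w -> False)] /\
      [/\ 0 < M, forall v, 0 < x v, {in V1 :|: V2, forall v, (1 - 17 * eta) * M <= x v <= M} &
        (1 / 2 - eta) * #|V|%:R <= rho /\ rho <= (1 / 2 + 3 * eta) * #|V|%:R].
Proof.
move=> k2 t0 eta0 teta; set F := (t * k.*2.+1)%N.
have F4 : (4 * t * k.*2.+1)%:R = 4 * F%:R :> R by rewrite -mulnA natrM.
have F7 : (7 <= F)%N by apply: (@leq_trans k.*2.+1); [lia|exact: leq_pmull].
have F7R : 7 <= F%:R :> R by rewrite (ler_nat R 7).
have eta1 : eta <= 1 / 1000.
  by have := ler_wpM2r (ltW eta0) F7R; rewrite F4 in teta; lra.
have del0 : 0 < eta / 2 by lra.
have del1 : eta / 2 <= 1 / 400 by lra.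
have [N1 hN1] := classification k2 t0 del0 del1.
have [N2 hN2] := nat_above ((12 * t + 12 + 4 * F + 200 * F)%:R / eta).
exists (N1 + N2)%N => V G rho x ext NV.
have [|V1 [V2 [W [bal V12 in1 in2 Wpack]]]] := hN1 V G rho x ext.
  by apply: leq_trans NV; exact: leq_addr.
have ee : 2 * (eta / 2) = eta by lra.
rewrite ee in bal in1 in2.
set n : R := #|V|%:R.
have nlarge : 12 * t%:R + 12 + 204 * F%:R <= eta * n.
  have : (12 * t + 12 + 4 * F + 200 * F)%:R / eta <= n.
    by apply: le_trans hN2 _; rewrite ler_nat; apply: leq_trans NV; exact: leq_addl.
  by rewrite ler_pdivrMr // mulrC 3!natrD !natrM; lra.
have t0R : 0 <= t%:R :> R by [].
have en0 : 0 < eta * n by lra.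
have n0 : 0 < n by rewrite -(pmulr_rgt0 _ eta0).
have Wt : (#|W| < t)%N.
  by have := Wpack [::]; rewrite addn0; apply.
have few : 12 * #|~: (V1 :|: V2)|%:R + 12 <= eta * n.
  have : #|W|%:R <= t%:R :> R by rewrite ler_nat ltnW.
  by rewrite V12 setCK; lra.
have eta2 : eta <= 1 / 100 by lra.
have [M [M0 ent _ rl ru]] := balanced_entries ext bal eta0 eta2 few in1 in2.
have Fn : 4 * F%:R * (eta * n + 1) < 1 / 20 * n.
  have : 4 * F%:R * (eta * n) <= 1 / 40 * n.
    by rewrite mulrA ler_wpM2r ?(ltW n0) // -F4.
  have : eta * n <= n / 1000 by have := ler_wpM2r (ltW n0) eta1; lra.
  by lra.
have ent9 : {in V1 :|: V2, forall v, 9 / 10 * M <= x v <= M}.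
  move=> v /ent /andP [h1 ->]; rewrite andbT; apply: le_trans h1.
  by rewrite ler_wpM2r ?(ltW M0) //; lra.
have Fn2 : F%:R <= eta * n by lra.
have cheap (U D : {set V}) := no_cheap_dominating (U := U) (D := D) ext bal V12 in1 in2 M0 ent9
  eta0 eta2.
have cV1 : (0 < #|V1|)%N.
  by rewrite -(ltr_nat R); apply: lt_le_trans (bal_gtA bal); rewrite mulr_gt0 //; lra.
have [v1 v1V] := card_gt0P cV1.
have [L pL Lmax] := @max_packing k V G (~: W) t t0 (fun L pL => leq_ltn_trans (leq_addl _ _) (Wpack
  L pL)).
have szL := size_flatten_packing pL.
have [uL _] : uniq (flatten L) /\ True by case/andP: pL.
have L0 : L = [::].
  apply/eqP/negPn/negP => Lne.
  (* All vertices of the packing are stripped of their inner edges, which kills every fan outside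
     [W] by maximality of [L]. Which [size L] of them become dominating is immaterial; the first
     ones are taken. *)
  pose U := [set v in flatten L]; pose D := [set v in take (size L) (flatten L)].
  have cU : #|U| = (size L * k.*2.+1)%N by rewrite cardsE (card_uniqP uL).
  have cD : #|D| = size L.
    by rewrite cardsE (card_uniqP (take_uniq _ uL)) size_takel // szL leq_pmulr.
  apply: (cheap U D).
  - by apply/subsetP => v; rewrite !inE; exact: mem_take.
  - by apply/subsetP => v; rewrite inE => /(packing_sub pL).
  - by rewrite cD; case: (L) Lne.
  - by rewrite cD; exact: Wpack.
  - by rewrite cU cD mulnC.
  - move=> w fw; have /Lmax /hasP [v vw vL] : isfan k G (~: W) w.
      by apply: (fan_subset fw) => v /(fan_sub fw); rewrite !inE negb_or => /andP [].
    by have := fan_sub fw vw; rewrite !inE vL orbT.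
  - exact: Fn2.
  - by rewrite F4.
have nofan w : isfan k G (~: W) w -> False by move/Lmax; rewrite L0 => /hasP [].
(* No fan is left to kill, so if [W] were smaller, any one vertex of [V1] could be made dominating
   with profit. *)
have Wt1 : #|W|.+1 = t.
  apply/eqP; rewrite eqn_leq Wt /= leqNgt; apply/negP => Wlt.
  have v1W : v1 \in ~: W by rewrite -V12 inE v1V.
  apply: (cheap [set v1] [set v1]); rewrite ?cards1 ?addn1 ?muln1 //.
  - by rewrite sub1set.
  - move=> w fw; apply: (nofan w); apply: (fan_subset fw) => v /(fan_sub fw).
    by rewrite !inE negb_or => /andP [].
  - by rewrite F4.
have r0 : 0 < rho by apply: lt_le_trans rl; rewrite mulr_gt0 //; lra.
have xV v : v \in V1 :|: V2 -> 0 < x v.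
  by move=> /ent9 /andP [h _]; apply: lt_le_trans h; rewrite mulr_gt0 //; lra.
(* On [W] positivity follows from the moving inequality [wt x V1 <= rho * x v]. *)
have xpos v : 0 < x v.
  have [vV|vV] := boolP (v \in V1 :|: V2); first exact: xV.
  move: vV; rewrite inE negb_or => /andP [nv1 _].
  rewrite -(pmulr_rgt0 _ r0); apply: lt_le_trans (wt_cross ext (balanced_sym bal) r0 nv1 _).
    rewrite /wt (bigD1 v1) //=; apply: ltr_wpDr; last by apply: xV; rewrite inE v1V.
    by apply: sumr_ge0 => u _; exact: ext_ge0 ext u.
  have : (F + 2)%:R * (eta * n + 1) <= 4 * F%:R * (eta * n + 1).
    by rewrite ler_wpM2r ?natrD //; lra.
  have : eta * n <= n / 1000 by have := ler_wpM2r (ltW n0) eta1; lra.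
  by rewrite -/n -/F; lra.
exists V1, V2, W, M; split; split=> //.
exact: (dominating_edges ext xpos Wt nofan).
Qed.

End DominatingSet.

(** * Almost complete bipartite structure *)

Section CoreStructure.
Variable R : realType.

(* [G] is [K_{t-1}] (on [W]) joined to an almost complete bipartite graph with
   parts [V1], [V2] whose in-degrees and missing degrees are below [k]. *)
Record core (k t : nat) (V : finType) (G : sgraph V) (rho : R) (x : V -> R)
    (eta M : R) (V1 V2 W : {set V}) : Prop := Core {
  cr_ext : extremal k t G rho x;
  cr_dis : [disjoint V1 & V2];
  cr_cov : V1 :|: V2 = ~: W;
  cr_W : #|W|.+1 = t;
  cr_dom : {in W, forall w v, v != w -> G w v};
  cr_nofan : forall f, isfan k G (~: W) f -> False;
  cr_deg1 : {in V1, forall v, (#|nbr G v :&: V1| < k)%N};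
  cr_deg2 : {in V2, forall v, (#|nbr G v :&: V2| < k)%N};
  cr_miss1 : {in V1, forall v, (#|V2 :\: nbr G v| < k)%N};
  cr_miss2 : {in V2, forall v, (#|V1 :\: nbr G v| < k)%N};
  cr_M : 0 < M;
  cr_pos : forall v, 0 < x v;
  cr_ent : {in V1 :|: V2, forall v, (1 - 17 * eta) * M <= x v <= M};
  cr_le3 : forall v, x v <= 3 * M;
  cr_size1 : (1 / 2 - eta) * #|V|%:R <= #|V1|%:R;
  cr_size2 : (1 / 2 - eta) * #|V|%:R <= #|V2|%:R;
  cr_rho : (1 / 2 - eta) * #|V|%:R <= rho;
  cr_rho' : rho <= (1 / 2 + 3 * eta) * #|V|%:R;
  cr_eta0 : 0 < eta;
  cr_eta : 1000 * k%:R * eta <= 1;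
  cr_big : (1000 * k ^ 4 * t)%:R <= eta * #|V|%:R }.

Lemma core_sym k t V G rho x eta M V1 V2 W :
  @core k t V G rho x eta M V1 V2 W -> core k t G rho x eta M V2 V1 W.
Proof. by case=> *; split; rewrite // 1?disjoint_sym // setUC. Qed.

Lemma wt_nbr_split (V : finType) (G : sgraph V) (x : V -> R) (V1 V2 W : {set V}) v :
  [disjoint V1 & V2] -> V1 :|: V2 = ~: W -> {in W, forall w v, v != w -> G w v} ->
  v \notin W -> wt x (nbr G v) = wt x (nbr G v :&: V1) + wt x (nbr G v :&: V2) + wt x W.
Proof.
move=> dis V12 dom vW.
rewrite (wt_setID _ _ V1) -addrA; congr (_ + _).
rewrite (wt_setID _ _ V2); congr (wt x _ + wt x _).
  apply/setP => u; rewrite !inE; move: dis; rewrite -setI_eq0 => /eqP/setP/(_ u).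
  by rewrite !inE; case: (u \in V1) => //= ->; rewrite andbF.
apply/setP => u; rewrite !inE; move/setP: V12 => /(_ u); rewrite !inE.
case: (boolP (u \in W)) => uW /=; last by case: (u \in V1); case: (u \in V2).
case: (u \in V1); case: (u \in V2) => //= _.
by rewrite adj_sym dom //; apply/eqP => uv; rewrite uv uW in vW.
Qed.

(** If [v] were moved to see exactly [V2 :|: W], it would trade its inner neighbours for the
    vertices it misses. Hence the missed ones weigh no more than the inner ones, and as entries are
    almost equal, they are not more numerous either. *)
Lemma missing_lt k t (V : finType) (G : sgraph V) (rho : R) (x : V -> R) (eta M : R)
    (V1 V2 W : {set V}) v :
  extremal k t G rho x -> 0 < rho -> balanced G eta V1 V2 -> V1 :|: V2 = ~: W ->
  {in W, forall w v, v != w -> G w v} -> 0 < M -> 1000 * k%:R * eta <= 1 ->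
  {in V1 :|: V2, forall v, (1 - 17 * eta) * M <= x v <= M} ->
  (t * k.*2.+1 + 2)%:R * (eta * #|V|%:R + 1) < (1 / 2 - eta) * #|V|%:R ->
  v \in V1 -> (#|nbr G v :&: V1| < k)%N -> (#|V2 :\: nbr G v| < k)%N.
Proof.
move=> ext r0 bal V12 dom M0 ke ent hn vV1 deg.
have V1W u : u \in V1 -> u \notin W.
  by move=> uV; rewrite -in_setC -V12 inE uV.
have vV2 : v \notin V2.
  have := bal_dis bal; rewrite -setI_eq0 => /eqP/setP/(_ v); rewrite !inE vV1 /= => ->.
  by [].
have h : wt x (V2 :|: W) <= rho * x v.
  apply: (wt_replace_nbr ext r0); first by rewrite inE negb_or vV2 V1W.
  move=> Y Z cY cZ /subsetP ZVW.
  have hV1 : (t * k.*2.+1 + 2)%:R * (eta * #|V|%:R + 1) < #|V1|%:R.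
    exact: lt_le_trans hn (bal_gtA bal).
  have cZ2 : (#|Z :&: V2| <= t * k.*2.+1 + 2)%N.
    exact: leq_trans (subset_leq_card (subsetIl _ _)) cZ.
  have [u [uV uY uZ]] := bal_pick bal (subxx V1) (subsetIr Z V2) cZ2 cY hV1.
  exists u => // y yZ; have := ZVW y yZ; rewrite inE => /orP [yV|yW].
    by apply: uZ; rewrite inE yZ.
  rewrite adj_sym; apply: dom => //; apply/eqP => uy.
  by have := V1W u uV; rewrite uy yW.
have nbrE := wt_nbr_split x (bal_dis bal) V12 dom (V1W v vV1).
have dVW : wt x (V2 :|: W) = wt x V2 + wt x W.
  rewrite (wt_setID _ _ V2); congr (wt x _ + wt x _); apply/setP => u; rewrite !inE.
    by case: (u \in V2); rewrite ?andbF ?andbT.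
  move/setP: V12 => /(_ u); rewrite !inE; case: (u \in V2) => //=.
  by rewrite orbT => /esym /negbTE ->.
move: h; rewrite -(ext_eig ext) nbrE dVW (wt_setID x V2 (nbr G v)) [V2 :&: _]setIC => h.
have h1 : wt x (nbr G v :&: V1) <= #|nbr G v :&: V1|%:R * M.
  apply: sum_set_le => u; rewrite inE => /andP [_ uV].
  by have /ent /andP [] : u \in V1 :|: V2 by rewrite inE uV.
have h2 : #|V2 :\: nbr G v|%:R * ((1 - 17 * eta) * M) <= wt x (V2 :\: nbr G v).
  apply: sum_set_ge => u; rewrite inE => /andP [_ uV].
  by have /ent /andP [] : u \in V1 :|: V2 by rewrite inE uV orbT.
have h3 : #|V2 :\: nbr G v|%:R * (1 - 17 * eta) <= #|nbr G v :&: V1|%:R.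
  by rewrite -(ler_pM2r M0); lra.
have h4 : #|nbr G v :&: V1|%:R + 1 <= k%:R :> R by rewrite natr1 ler_nat.
rewrite ltnNge; apply/negP => km; have h5 : k%:R <= #|V2 :\: nbr G v|%:R :> R by rewrite ler_nat.
have k1 : 1 <= k%:R :> R by rewrite ler1n; apply: leq_trans (ext_k ext).
have e1 : 0 <= 1 - 17 * eta by nra.
by have := ler_wpM2r e1 h5; lra.
Qed.

Lemma core_exists k t : (2 < k)%N -> (0 < t)%N ->
  exists N : nat, forall (V : finType) (G : sgraph V) (rho : R) (x : V -> R),
    extremal k t G rho x -> (N <= #|V|)%N ->
    exists eta M V1 V2 W, core k t G rho x eta M V1 V2 W.
Proof.
move=> k2 t0; have [F FE] : exists F, F = (t * k.*2.+1)%N by eexists.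
have [Bg BgE] : exists Bg, Bg = (1000 * k ^ 4 * t)%N by eexists.
have F4 : (4 * t * k.*2.+1)%:R = 4 * F%:R :> R by rewrite -mulnA -FE natrM.
have kF : (2 * k + 1 <= F)%N by rewrite FE mul2n addn1; exact: leq_pmull.
have F0 : 0 < F%:R :> R by rewrite ltr0n; lia.
have F1 : 1 <= F%:R :> R by rewrite ler1n; lia.
have kFR : k%:R <= F%:R :> R by rewrite ler_nat; lia.
(* Since [k <= F], the choice [F * eta = 1 / 1000] gives [1000 * k * eta <= 1]; it also leaves room
   for avoiding the vertices of [t] fans. *)
pose eta : R := 1 / 1000 / F%:R.
have eta0 : 0 < eta by rewrite divr_gt0 // divr_gt0.
have Fe : F%:R * eta = 1 / 1000 by rewrite /eta mulrC divfK // gt_eqF.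
have teta : (4 * t * k.*2.+1)%:R * eta <= 1 / 40 by rewrite F4 -mulrA Fe; lra.
have ke : 1000 * k%:R * eta <= 1.
  by have := ler_wpM2r (ltW eta0) kFR; lra.
have eta1 : eta <= 1 / 1000 by have := ler_wpM2r (ltW eta0) F1; lra.
have [N1 hN1] := dominating_set k2 t0 eta0 teta.
have [N2 hN2] := nat_above ((Bg + 12 * t + 12 + F)%:R / eta).
exists (N1 + N2)%N => V G rho x ext NV.
have [|V1 [V2 [W [M [[bal V12 Wt dom nofan] [M0 xpos ent [rl ru]]]]]]] := hN1 V G rho x ext.
  by apply: leq_trans NV; exact: leq_addr.
set n : R := #|V|%:R in rl ru *.
have nlarge : (Bg)%:R + 12 * t%:R + 12 + F%:R <= eta * n.
  have : (Bg + 12 * t + 12 + F)%:R / eta <= n.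
    by apply: le_trans hN2 _; rewrite ler_nat; apply: leq_trans NV; exact: leq_addl.
  by rewrite ler_pdivrMr // mulrC 3!natrD (natrM _ 12 t).
have b0 : 0 <= (Bg)%:R :> R by [].
have t0R : 0 <= t%:R :> R by [].
have en0 : 0 < eta * n by lra.
have n0 : 0 < n by rewrite -(pmulr_rgt0 _ eta0).
have r0 : 0 < rho by apply: lt_le_trans rl; rewrite mulr_gt0 //; lra.
have Fn : F%:R * (eta * n) = n / 1000 by rewrite mulrA Fe; lra.
have en : eta * n <= n / 1000 by have := ler_wpM2r (ltW n0) eta1; lra.
have bal' := balanced_sym bal.
have hk (X : {set V}) v : X = V1 \/ X = V2 -> v \in X -> (#|nbr G v :&: X| < k)%N.
  have hn : (2 * k + 1)%:R * (eta * n + 1) < (1 / 2 - 2 * eta) * n.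
    have : (2 * k + 1)%:R <= F%:R :> R by rewrite ler_nat.
    have e1 : 0 <= eta * n + 1 by lra.
    by move=> /(ler_wpM2r e1); lra.
  case=> ->; first by apply: (indegree_lt bal _ nofan hn); rewrite V12.
  by apply: (indegree_lt bal' _ nofan hn); rewrite setUC V12.
have deg1 : {in V1, forall v, (#|nbr G v :&: V1| < k)%N} by move=> v; apply: hk; left.
have deg2 : {in V2, forall v, (#|nbr G v :&: V2| < k)%N} by move=> v; apply: hk; right.
have hn : (F + 2)%:R * (eta * n + 1) < (1 / 2 - eta) * n.
  by rewrite natrD; lra.
have V21 : V2 :|: V1 = ~: W by rewrite setUC.
rewrite FE in hn.
have few : (12 * #|W| + 12 <= #|V|)%N.
  rewrite -(ler_nat R) natrD natrM -/n.
  have : #|W|%:R <= t%:R :> R by rewrite ler_nat -Wt.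
  by lra.
exists eta, M, V1, V2, W; split=> //.
- exact: bal_dis bal.
- by move=> v vV; apply: (missing_lt ext r0 bal V12 dom M0 ke ent hn vV); exact: deg1.
- move=> v vV; rewrite setUC in ent.
  by apply: (missing_lt ext r0 bal' V21 dom M0 ke ent hn vV); exact: deg2.
- apply: (entry_le3 ext few) => v; rewrite -V12 => vV.
  by case/andP: (ent v vV).
- exact: bal_gtA bal.
- exact: bal_gtB bal.
- by rewrite -BgE -/n; lra.
Qed.

End CoreStructure.

(** * One part is independent *)

Definition inner (V : finType) (G : sgraph V) (X : {set V}) : nat :=
  (\sum_(v in X) #|nbr G v :&: X|)%N.

Lemma even_inner (V : finType) (G : sgraph V) (A : {set V}) : ~~ odd (inner G A).
Proof.
have [c] := ubnP #|A|; elim: c A => // c IH A cA; rewrite /inner.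
have [->|/set0Pn [v vA]] := eqVneq A set0; first by rewrite big_set0.
rewrite (inner_sum_setD1 G vA) oddD odd_double /=; apply: IH.
by rewrite (cardsD1 v A) vA in cA.
Qed.

(** * Inner degrees compared with those of a competitor *)

Section CoreComparison.
Variables (R : realType) (k t : nat) (V : finType) (G : sgraph V) (rho : R) (x : V -> R).
Variables (eta M : R) (V1 V2 W : {set V}).
Hypothesis C : core k t G rho x eta M V1 V2 W.

Lemma core_notW v : v \in V1 :|: V2 -> v \notin W.
Proof. by rewrite (cr_cov C) inE. Qed.

Lemma core_wt v : v \in V1 :|: V2 ->
  rho * x v = wt x (nbr G v :&: V1) + wt x (nbr G v :&: V2) + wt x W.
Proof.
move=> vV; rewrite -(ext_eig (cr_ext C)).
exact: wt_nbr_split (cr_dis C) (cr_cov C) (cr_dom C) (core_notW vV).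
Qed.

Lemma wt_total : wt x [set: V] = wt x V1 + wt x V2 + wt x W.
Proof.
rewrite (wt_setID _ _ V1) setTI -addrA; congr (_ + _).
rewrite (wt_setID _ _ V2); congr (wt x _ + wt x _); apply/setP => u; rewrite !inE ?andbT.
  have := cr_dis C; rewrite -setI_eq0 => /eqP/setP/(_ u); rewrite !inE.
  by case: (u \in V2); rewrite ?andbF // andbT => ->.
have := cr_cov C => /setP/(_ u); rewrite !inE.
by case: (u \in V1); case: (u \in V2); case: (u \in W).
Qed.

Lemma core_card : (#|V1| + #|V2| + #|W| = #|V|)%N.
Proof.
rewrite -cardsUI (eqP (_ : V1 :&: V2 == set0)) ?setI_eq0 ?(cr_dis C) // cards0 addn0.
by rewrite (cr_cov C) addnC cardsC.
Qed.

Lemma core_wtW w : w \in W -> (rho + 1) * x w = wt x V1 + wt x V2 + wt x W.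
Proof.
move=> wW; rewrite mulrDl mul1r -(ext_eig (cr_ext C)) -wt_total.
rewrite (wt_setID x [set: V] (nbr G w)) setTI; congr (_ + _).
rewrite /wt (big_pred1 w) // => u; rewrite !inE andbT.
have [->|uw] := eqVneq u w; first by rewrite adj_irr.
by rewrite (cr_dom C).
Qed.

Lemma rho_pos : 0 < rho.
Proof.
have [u xu _] := max_entry (cr_ext C).
have V0 : (0 < #|V|)%N by apply/card_gt0P; exists u.
have n0 : 0 < #|V|%:R :> R by rewrite ltr0n.
have k1 : 1 <= k%:R :> R by rewrite ler1n; apply: leq_trans (ext_k (cr_ext C)).
have e1 := cr_eta C; have e0 := cr_eta0 C.
apply: lt_le_trans (cr_rho C); rewrite mulr_gt0 //.
have := ler_wpM2r (ltW e0) k1; lra.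
Qed.

(** A vertex of [W] is adjacent to all others, so adding its own entry to the eigenvalue equation
    turns the right side into the total weight; this is the resulting common entry on [W]. *)
Definition wtop : R := (wt x V1 + wt x V2 + wt x W) / (rho + 1).

Lemma core_top w : w \in W -> x w = wtop.
Proof.
move=> wW; rewrite /wtop -(core_wtW wW) mulrC mulKf // gt_eqF //.
by rewrite addr_gt0 // rho_pos.
Qed.

Lemma wt_W : wt x W = #|W|%:R * wtop.
Proof.
by rewrite /wt (eq_bigr (fun=> wtop)) => [|w wW]; rewrite ?core_top // sumr_const mulr_natl.
Qed.

Lemma wtopE : rho * wtop = (#|W|%:R - 1) * wtop + wt x V1 + wt x V2.
Proof.
have : (rho + 1) * wtop = wt x V1 + wt x V2 + wt x W.
  by rewrite /wtop mulrC divfK // gt_eqF // addr_gt0 // rho_pos.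
by rewrite wt_W; lra.
Qed.

(* Replacing [x] by its averages over the three parts only loses the edges
   inside the parts. *)
Lemma inner_form_ge m p q :
  wt x V1 = #|V1|%:R * p -> wt x V2 = #|V2|%:R * q ->
  m * p ^+ 2 + 2 * (#|V1|%:R * p) * (#|V2|%:R * q)
    + 2 * (#|W|%:R * wtop) * (#|V1|%:R * p + #|V2|%:R * q)
    + #|W|%:R * (#|W|%:R - 1) * wtop ^+ 2
  <= rho * (#|V1|%:R * p ^+ 2 + #|V2|%:R * q ^+ 2 + #|W|%:R * wtop ^+ 2) ->
  m * p ^+ 2 <= (inner G V1 + inner G V2)%:R * M ^+ 2.
Proof.
move=> hp hq h; have x0 := ext_ge0 (cr_ext C); have r0 := rho_pos.
(* The variance of [x] on [X] is nonnegative, so averaging cannot raise the squared norm. *)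
have sq (X : {set V}) a : wt x X = #|X|%:R * a -> #|X|%:R * a ^+ 2 <= \sum_(v in X) x v ^+ 2.
  move=> hX; have : 0 <= \sum_(v in X) (x v - a) ^+ 2 by apply: sumr_ge0 => v _; exact: sqr_ge0.
  have -> : \sum_(v in X) (x v - a) ^+ 2 = \sum_(v in X) x v ^+ 2 - #|X|%:R * a ^+ 2.
    under eq_bigr => v _.
      rewrite (_ : (x v - a) ^+ 2 = x v ^+ 2 + (a ^+ 2 - 2 * a * x v)); last by lra.
      over.
    rewrite big_split big_split /= sumr_const -(mulr_natl (a ^+ 2)) sumrN -mulr_sumr -/(wt x X) hX.
    by move: (\sum_(v in X) _) (#|X|%:R : R) => S c; lra.
  by rewrite subr_ge0.
have sq1 := sq V1 p hp; have sq2 := sq V2 q hq.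
have form (X Y : {set V}) : X = V1 /\ Y = V2 \/ X = V2 /\ Y = V1 ->
    rho * \sum_(v in X) x v ^+ 2 <= (inner G X)%:R * M ^+ 2 + wt x X * wt x Y + wt x X * wt x W.
  move=> XY; rewrite mulr_sumr /inner natr_sum mulr_suml /wt !mulr_suml -!big_split /=.
  apply: ler_sum => v vX.
  have vV : v \in V1 :|: V2 by case: XY => [] [eX _]; rewrite inE -eX vX ?orbT.
  have eq1 : rho * x v = wt x (nbr G v :&: X) + wt x (nbr G v :&: Y) + wt x W.
    rewrite (core_wt vV); case: XY => [] [-> ->] //; congr (_ + _); exact: addrC.
  have -> : rho * x v ^+ 2 = x v * wt x (nbr G v :&: X) + x v * wt x (nbr G v :&: Y) + x v * wt x W.
    by rewrite expr2 mulrCA eq1; lra.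
  rewrite lerD2r; apply: lerD; last first.
    by apply: ler_wpM2l => //; apply: sum_set_sub => //; exact: subsetIr.
  have [_ /andP [_ xM]] : True /\ (1 - 17 * eta) * M <= x v <= M by split; [|exact: cr_ent C v vV].
  rewrite expr2 mulrCA; apply: ler_pM => //; first exact: sumr_ge0.
  apply: sum_set_le => u; rewrite inE => /andP [_ uX].
  have uV : u \in V1 :|: V2 by case: XY => [] [eX _]; rewrite inE -eX uX ?orbT.
  by case/andP: (cr_ent C uV).
have f1 := form V1 V2 (or_introl (conj erefl erefl)).
have f2 := form V2 V1 (or_intror (conj erefl erefl)).
rewrite natrD mulrDl.
have g1 := ler_wpM2l (ltW r0) sq1; have g2 := ler_wpM2l (ltW r0) sq2.
have tE := wtopE; have := congr1 (fun y => #|W|%:R * wtop * y) tE.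
rewrite wt_W hp hq in f1 f2; rewrite hp hq /= => e3.
move: h g1 g2 f1 f2 e3; clear.
move: (\sum_(v in V1) _) (\sum_(v in V2) _) ((inner G V1)%:R : R) ((inner G V2)%:R : R).
move: (#|V1|%:R : R) (#|V2|%:R : R) (#|W|%:R : R) wtop => n1 n2 s z S1 S2 I1 I2 *; lra.
Qed.

End CoreComparison.

Lemma core_V1_big (R : realType) k t (V : finType) (G : sgraph V) (rho : R) (x : V -> R)
    (eta M : R) (V1 V2 W : {set V}) :
  core k t G rho x eta M V1 V2 W -> (1000 * k ^ 4 * t <= #|V1|)%N.
Proof.
move=> C; rewrite -(ler_nat R); apply: le_trans (cr_big C) _; apply: le_trans (cr_size1 C).
apply: ler_wpM2r => //; have k1 : 1 <= k%:R :> R by rewrite ler1n; apply: leq_trans (ext_k (cr_ext C)).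
have := ler_wpM2r (ltW (cr_eta0 C)) k1; have := cr_eta C; lra.
Qed.

(** Number of vertices that a segment may have to avoid while a fan is built: at most [k * k]
    vertices of [V2] missed by the centre or its inner neighbours, and fewer than [4 * k + 4] on the
    path itself; the rest is slack. *)
Definition cc (k : nat) : nat := (2 * (k * k) + 4 * k + 4)%N.

Lemma cc_lt k t : (2 < k)%N -> (0 < t)%N -> (k * k * cc k < 1000 * k ^ 4 * t)%N.
Proof.
move=> k2 t0; have h1 : (cc k <= 10 * (k * k))%N by rewrite /cc; nia.
have k4 : (k ^ 4 = (k * k) * (k * k))%N by rewrite !expnS expn0 muln1 !mulnA.
have kk0 : (0 < (k * k) * (k * k))%N by rewrite !muln_gt0; lia.
apply: leq_ltn_trans (leq_mul (leqnn (k * k)) h1) _; rewrite k4.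
apply: (@leq_trans (1000 * (k * k * (k * k)))); last exact: leq_pmulr.
by move: kk0; rewrite mulnCA; move: (k * k * (k * k))%N => z; lia.
Qed.

(** * Fans in the almost complete bipartite graph *)

Section CoreFans.
Variables (R : realType) (k t : nat) (V : finType) (G : sgraph V) (rho : R) (x : V -> R).
Variables (eta M : R) (V1 V2 W : {set V}).
Hypothesis C : core k t G rho x eta M V1 V2 W.

Lemma card_has_le (s : seq V) (F : V -> {set V}) m :
  {in s, forall b, #|F b| <= m}%N -> (#|[set u | has (fun b => u \in F b) s]| <= size s * m)%N.
Proof.
elim: s => [|b s IH] h; first by rewrite leqn0 cards_eq0; apply/eqP/setP => u; rewrite !inE.
have -> : [set u | has (fun b => u \in F b) (b :: s)] = F b :|: [set u | has (fun b => u \in F b) s].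
  by apply/setP => u; rewrite !inE.
apply: leq_trans (leq_card_setU _ _) _; rewrite mulSn; apply: leq_add.
  by apply: h; rewrite mem_head.
by apply: IH => c cs; apply: h; rewrite inE cs orbT.
Qed.

(** An inexhaustible supply of paths with [l] edges inside [X]: single vertices, edges and cherries
    for [l = 0, 1, 2]. *)
Definition has_segs (X : {set V}) l c := forall Z : {set V}, (#|Z| <= c)%N ->
  exists z q, [/\ size q = l, path G z q, uniq (z :: q),
    {in z :: q, forall u, u \in X} & {in z :: q, forall u, u \notin Z}].

Lemma segs_single (X : {set V}) c : (c < #|X|)%N -> has_segs X 0 c.
Proof.
move=> cX Z cZ; have [z] : exists z, z \in X :\: Z.
  apply/card_gt0P; rewrite cardsD subn_gt0; apply: leq_ltn_trans cX.
  by apply: leq_trans cZ; rewrite subset_leq_card // subsetIr.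
rewrite inE => /andP [zZ zX]; exists z, [::]; split=> // u; rewrite inE => /eqP -> //.
Qed.

(** A forbidden vertex spoils only the at most [k] vertices in its closed inner neighbourhood. More
    than [c * k] candidates leave one whose whole star avoids [Z]; for [l = 2] it becomes the middle
    of the segment. *)
Lemma segs_star (X : {set V}) l c : {in X, forall v, #|nbr G v :&: X| < k}%N ->
  (l == 1) || (l == 2) -> (c * k < #|[set v in X | l <= #|nbr G v :&: X|]|)%N -> has_segs X l c.
Proof.
move=> deg l12 hD Z cZ.
pose F z := z |: (nbr G z :&: X).
pose bad := [set u | has (fun b => u \in F b) (enum (Z :&: X))].
have cbad : (#|bad| <= c * k)%N.
  apply: leq_trans (card_has_le (m := k) _) _.
    move=> z; rewrite mem_enum inE => /andP [_ zX].
    by rewrite /F cardsU1; have := deg z zX; case: (_ \notin _) => /=; lia.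
  rewrite leq_mul2r -cardE; apply/orP; right; apply: leq_trans cZ.
  by rewrite subset_leq_card // subsetIl.
have [v] : exists v, v \in [set v in X | (l <= #|nbr G v :&: X|)%N] :\: bad.
  apply/card_gt0P; rewrite cardsD subn_gt0; apply: leq_ltn_trans hD.
  by apply: leq_trans cbad; rewrite subset_leq_card // subsetIr.
rewrite !inE => /andP [/hasPn vbad /andP [vX vdeg]].
have vZ : v \notin Z.
  apply/negP => vZ; have := vbad v; rewrite mem_enum !inE vZ vX eqxx => /(_ isT).
  by [].
have nZ u : u \in nbr G v :&: X -> u \notin Z.
  rewrite inE => /andP [gvu uX]; apply/negP => uZ; have := vbad u.
  by rewrite mem_enum !inE uZ uX vX adj_sym -in_nbr gvu orbT => /(_ isT).
have enE u : u \in enum (nbr G v :&: X) -> [/\ G v u, u \in X & u \notin Z].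
  rewrite mem_enum => h; split; last exact: nZ.
    by move: h; rewrite !inE => /andP [].
  by move: h; rewrite inE => /andP [].
have en_uniq : uniq (enum (nbr G v :&: X)) by exact: enum_uniq.
have en_size : (l <= size (enum (nbr G v :&: X)))%N by rewrite -cardE.
case/orP: l12 => /eqP lE; rewrite lE in en_size *.
  case: (enum _) enE en_uniq en_size => // a s enE _ _.
  have [ga aX aZ] := enE a (mem_head _ _); exists v, [:: a]; split=> //=.
  - by rewrite ga.
  - by rewrite inE andbT; apply/eqP => va; rewrite va adj_irr in ga.
  - by move=> u; rewrite !inE => /orP [] /eqP ->.
  - by move=> u; rewrite !inE => /orP [] /eqP ->.
case: (enum _) enE en_uniq en_size => // a [|b s] // enE /= /andP [ab _] _.
have [ga aX aZ] := enE a (mem_head _ _).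
have [gb bX bZ] : [/\ G v b, b \in X & b \notin Z] by apply: enE; rewrite !inE eqxx orbT.
exists a, [:: v; b]; split=> //=.
- by rewrite adj_sym ga gb.
- rewrite !inE andbT negb_or; apply/andP; split; last by apply/eqP => vb; rewrite vb adj_irr in gb.
  apply/andP; split; first by apply/eqP => av; rewrite av adj_irr in ga.
  by move: ab; rewrite inE negb_or => /andP [].
- by move=> u; rewrite !inE => /or3P [] /eqP ->.
- by move=> u; rewrite !inE => /or3P [] /eqP ->.
Qed.

Definition blocked (s : seq V) : {set V} := [set u | has (fun b => u \in V2 :\: nbr G b) s].

Lemma card_blocked s : {subset s <= V1} -> (#|blocked s| <= size s * k)%N.
Proof. by move=> sV; apply: card_has_le => b /sV bV; apply: ltnW; exact: cr_miss1 C b bV. Qed.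

Lemma not_blocked s u : u \in V2 -> u \notin blocked s -> {in s, forall b, G b u}.
Proof.
move=> uV; rewrite inE => /hasPn h b bs; have := h b bs.
by rewrite !inE uV andbT negbK.
Qed.

(** The fan has centre [v]; its path starts with [y :: r] in [V2] and then alternates between inner
    neighbours of [v] and segments inside [V2]. The vertices of [V2] missed by [v] or [a] are added
    to the forbidden set, which is where [k * k] comes from. *)
Lemma core_fan v (a : seq V) y r l c : v \in V1 -> {subset a <= nbr G v :&: V1} -> uniq a ->
  path G y r -> uniq (y :: r) -> {in y :: r, forall u, u \in V2 /\ G v u} ->
  all (G (last y r)) a -> (c + k * k <= l)%N -> forall j, has_segs V2 j l ->
  (k.*2 <= (size r).+1 + size a * j.+2 <= c)%N -> False.
Proof.
move=> vV sa ua pr ur hr la cl j segs /andP [sz1 sz2].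
have aV1 : {subset a <= V1} by move=> b /sa; rewrite inE => /andP [].
have dis u : u \in V1 -> u \in V2 -> False.
  by move=> u1 u2; have := cr_dis C; rewrite -setI_eq0 => /eqP/setP/(_ u); rewrite !inE u1 u2.
have sz_a : (size a < k)%N.
  apply: leq_ltn_trans (cr_deg1 C vV); rewrite -(card_uniqP ua).
  by apply: subset_leq_card; apply/subsetP => b /sa.
have uya : uniq (y :: r ++ a).
  rewrite -cat_cons cat_uniq ur ua andbT; apply/hasPn => b /aV1 bV1.
  by apply/negP => /hr [bV2 _]; exact: dis bV1 bV2.
have [|p [sp srt up hp]] := @glue_path V G [in nbr G v :&: V2] j c a y r pr uya la _ sz2.
- move=> Z cZ; have [|z [q [szq pq uq qV qZ]]] := segs (Z :|: blocked (v :: a)).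
    apply: leq_trans (leq_card_setU _ _) _; apply: leq_trans cl; apply: leq_add => //.
    apply: leq_trans (card_blocked _) _ => [b|]; last by rewrite leq_mul2r sz_a orbT.
    by rewrite inE => /orP [/eqP ->|/aV1].
  have adj u : u \in z :: q -> {in v :: a, forall b, G b u}.
    move=> uz; apply: not_blocked; first exact: qV.
    by have := qZ u uz; rewrite inE negb_or => /andP [].
  exists z, q; split=> //.
    by apply/allP => u uz; rewrite /= !inE (adj u uz v (mem_head _ _)) (qV u uz).
  split=> [b ba|u uz]; last by have := qZ u uz; rewrite inE negb_or => /andP [].
  have bva : b \in v :: a by rewrite inE ba orbT.
  by rewrite (adj z (mem_head _ _) b bva) adj_sym (adj _ (mem_last _ _) b bva).
have inW u : u \in V1 :|: V2 -> u \in ~: W by rewrite (cr_cov C).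
apply: (cr_nofan C (f := v :: take k.*2 p)); apply: fan_of_path => //; last by rewrite sp.
  by apply: inW; rewrite inE vV.
move=> u /hp /or3P [/hr [uV gu]|/sa|].
- by split=> //; apply: inW; rewrite inE uV orbT.
- by rewrite !inE => /andP [gu uV]; split=> //; have := inW u; rewrite !inE uV => /(_ isT).
- by rewrite /= !inE => /andP [gu uV]; split=> //; have := inW u; rewrite !inE uV orbT => /(_ isT).
Qed.

(** Segments of [l + 1] vertices before, between and after the inner neighbours of [v] give a path
    with exactly the number of vertices on the left. *)
Lemma core_deg_bound l v : (l <= 2)%N -> has_segs V2 l (cc k) -> v \in V1 ->
  (#|nbr G v :&: V1| * l.+2 + l.+1 < k.*2)%N.
Proof.
move=> l2 segs vV; rewrite ltnNge; apply/negP => big.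
have deg := cr_deg1 C vV.
pose a := enum (nbr G v :&: V1).
have sa : {subset a <= nbr G v :&: V1} by move=> b; rewrite mem_enum.
have sz : size a = #|nbr G v :&: V1| by rewrite -cardE.
have va1 : {subset v :: a <= V1}.
  by move=> b; rewrite inE => /orP [/eqP ->|/sa] //; rewrite inE => /andP [].
have [|y [r [szr pr ur rV rZ]]] := segs (blocked (v :: a)).
  apply: leq_trans (card_blocked va1) _; rewrite /= sz /cc.
  by apply: (@leq_trans (k * k)%N); [rewrite leq_mul2r deg orbT | lia].
have adj u : u \in y :: r -> {in v :: a, forall b, G b u}.
  by move=> uy; apply: not_blocked; [exact: rV | exact: rZ].
have ur2 : {in y :: r, forall u, u \in V2 /\ G v u}.
  by move=> u uy; split; [exact: rV | exact: adj u uy v (mem_head _ _)].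
have la : all (G (last y r)) a.
  apply/allP => b ba; rewrite adj_sym; apply: adj (mem_last _ _) _ _.
  by rewrite inE ba orbT.
apply: (@core_fan v a y r (cc k) ((cc k) - k * k) vV sa (enum_uniq _) pr ur ur2 la _ l segs).
  by rewrite /cc; lia.
rewrite szr sz addnC big /= /cc.
have : (#|nbr G v :&: V1| * l.+2 <= k * 4)%N by apply: leq_mul; [exact: ltnW | lia].
lia.
Qed.

(** One edge in [V2] already helps: the path begins with [u1, u2] and continues with [k - 1] inner
    neighbours, each followed by a vertex of [V2], which makes [2k] vertices. *)
Lemma one_edge u1 u2 v : u1 \in V2 -> u2 \in V2 -> G u1 u2 -> v \in V1 ->
  {in v |: (nbr G v :&: V1), forall b, G b u1 && G b u2} ->
  (#|nbr G v :&: V1| < k.-1)%N.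
Proof.
move=> u1V u2V g12 vV adj; rewrite ltnNge; apply/negP => big.
pose a := enum (nbr G v :&: V1).
have sa : {subset a <= nbr G v :&: V1} by move=> b; rewrite mem_enum.
have sz : size a = k.-1.
  apply/eqP; rewrite -cardE eqn_leq big andbT; have := cr_deg1 C vV; lia.
have k2 := ext_k (cr_ext C).
have seg0 : has_segs V2 0 (cc k).
  apply: segs_single; apply: leq_trans (core_V1_big (core_sym C)).
  apply: leq_ltn_trans (cc_lt k2 (ext_t (cr_ext C))).
  by apply: leq_pmull; rewrite muln_gt0; apply/andP; split; apply: ltn_trans k2.
have u12 : u1 != u2 by apply/eqP => e; rewrite e adj_irr in g12.
have vadj : G v u1 && G v u2 by apply: adj; exact: setU11.
apply: (@core_fan v a u1 [:: u2] (cc k) ((cc k) - k * k) vV sa (enum_uniq _) _ _ _ _ _ 0 seg0).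
- by rewrite /= g12.
- by rewrite /= inE u12.
- by move=> u; rewrite !inE => /orP [] /eqP ->; case/andP: vadj.
- apply/allP => b /sa bn; rewrite /= adj_sym.
  by have /andP [] := adj b (setU1r _ bn).
- by rewrite /cc; lia.
by rewrite sz /= /cc; lia.
Qed.

End CoreFans.

Lemma inner_le k (V : finType) (G : sgraph V) (X : {set V}) a m :
  {in X, forall v, #|nbr G v :&: X| < k}%N ->
  (#|[set v in X | a < #|nbr G v :&: X|]| <= m)%N -> (inner G X <= a * #|X| + k * m)%N.
Proof.
move=> deg hm; pose D := [set v in X | (a < #|nbr G v :&: X|)%N].
have DX : X :&: D = D by apply/setIidPr/subsetP => v; rewrite inE => /andP [].
apply: (@leq_trans (\sum_(v in X) a + \sum_(v in D) k)%N); last first.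
  by rewrite !sum_nat_const mulnC leq_add2l mulnC leq_mul2l hm orbT.
rewrite /inner (big_setID D) /= DX [X in (_ <= X + _)%N](big_setID D) /= DX.
have h1 : (\sum_(v in D) #|nbr G v :&: X| <= \sum_(v in D) k)%N.
  by apply: leq_sum => v; rewrite inE => /andP [vX _]; apply: ltnW; exact: deg.
have h2 : (\sum_(v in X :\: D) #|nbr G v :&: X| <= \sum_(v in X :\: D) a)%N.
  by apply: leq_sum => v; rewrite !inE => /andP [h vX]; move: h; rewrite vX /= -leqNgt.
rewrite [X in (X <= _)%N]addnC; apply: leq_trans (leq_add h2 h1) _.
by rewrite -addnA leq_addl.
Qed.

Lemma inner_edge (V : finType) (G : sgraph V) (X : {set V}) : (0 < inner G X)%N ->
  exists u1 u2, [/\ u1 \in X, u2 \in X & G u1 u2].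
Proof.
rewrite lt0n sum_nat_eq0 negb_forall => /existsP [u1]; rewrite negb_imply => /andP [u1X].
rewrite cards_eq0 => /set0Pn [u2]; rewrite !inE => /andP [g u2X].
by exists u1, u2.
Qed.

Section CoreDichotomy.
Variables (R : realType) (k t : nat) (V : finType) (G : sgraph V) (rho : R) (x : V -> R).

(** By [one_edge], a vertex of inner degree [k - 1] equals or has as inner neighbour a non-neighbour
    of [u1] or [u2]. There are at most [2 * k] of these, each accounting for at most [k]
    vertices. *)
Lemma few_full_degree (eta M : R) (V1 V2 W : {set V}) u1 u2 :
  core k t G rho x eta M V1 V2 W -> u1 \in V2 -> u2 \in V2 -> G u1 u2 ->
  (#|[set v in V1 | k.-2 < #|nbr G v :&: V1|]| <= 2 * k * k)%N.
Proof.
move=> C u1V u2V g12; have k2 := ext_k (cr_ext C).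
pose B0 := (V1 :\: nbr G u1) :|: (V1 :\: nbr G u2).
have cB0 : (#|B0| <= 2 * k)%N.
  apply: leq_trans (leq_card_setU _ _) _; rewrite mul2n -addnn.
  by apply: leq_add; apply: ltnW; exact: cr_miss2 C _ _.
apply: (@leq_trans (size (enum B0) * k)); last by rewrite -cardE leq_mul2r cB0 orbT.
apply: leq_trans (card_has_le (F := fun b => b |: (nbr G b :&: V1)) (m := k) _); last first.
  move=> b; rewrite mem_enum cardsU1 => bB0.
  have bV : b \in V1 by move: bB0; rewrite !inE => /orP [] /andP [].
  by have := cr_deg1 C bV; case: (_ \notin _) => /=; lia.
apply: subset_leq_card; apply/subsetP => v; rewrite !inE => /andP [vV deg].
apply/negPn/negP => /hasPn nh.
suff : (#|nbr G v :&: V1| < k.-1)%N by lia.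
apply: (one_edge C u1V u2V g12 vV) => b bv.
have bV : b \in V1 by move: bv; rewrite !inE => /orP [/eqP ->|/andP []].
have bB0 : b \notin B0.
  apply/negP => bB; have := nh b; rewrite mem_enum bB => /(_ isT).
  move: bv; rewrite !inE vV bV !andbT eq_sym.
  by case/orP => [->//|gvb]; rewrite [G b v]adj_sym gvb orbT.
by move: bB0; rewrite !inE bV !andbT negb_or !negbK ![G b _]adj_sym.
Qed.

(** The competitor keeps the sizes of the parts, has an almost [(k - 1)]-regular graph on [V1] and
    no edge in [V2], and is tested on the averages of [x]. *)
Lemma inner_lower (eta M : R) (V1 V2 W : {set V}) :
  core k t G rho x eta M V1 V2 W ->
  (#|V1|.-1 * k.-1)%:R * (1 - 17 * eta) ^+ 2 <= (inner G V1 + inner G V2)%:R :> R.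
Proof.
move=> C; have k2 := ext_k (cr_ext C); have t0 := ext_t (cr_ext C).
have big1 := core_V1_big C; have big2 := core_V1_big (core_sym C).
have klt : (k * k * cc k < 1000 * k ^ 4 * t)%N := cc_lt k2 t0.
have kV1 : (0 < k < #|V1|)%N.
  rewrite (ltn_trans _ k2) //=; apply: leq_trans big1; apply: leq_ltn_trans klt.
  by rewrite -mulnA; apply: leq_pmulr; rewrite muln_gt0 /cc addn_gt0 orbT andbT; exact: ltn_trans k2.
have [T [G1 [cT degT sumT nopT]]] := bounded_no_path_exists kV1.
have Wt : (#|W| < t)%N by rewrite -(cr_W C).
have szn : (#|W| + (#|T| + #|V2|) = #|V|)%N by rewrite cT addnC (core_card C).
have degk v : (degree G1 v < k)%N by apply: leq_ltn_trans (degT v) _; lia.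
have n1 : 0 < #|V1|%:R :> R by rewrite ltr0n; case/andP: kV1 => _; apply: leq_trans.
have n2 : 0 < #|V2|%:R :> R.
  rewrite ltr0n; apply: leq_trans big2; apply: leq_ltn_trans klt; exact: leq0n.
pose p := wt x V1 / #|V1|%:R; pose q := wt x V2 / #|V2|%:R.
have hp : wt x V1 = #|V1|%:R * p by rewrite /p mulrC divfK // gt_eqF.
have hq : wt x V2 = #|V2|%:R * q by rewrite /q mulrC divfK // gt_eqF.
have := opt_join (cr_ext C) p q (wtop rho x V1 V2 W) Wt szn degk nopT.
rewrite cT => /(inner_form_ge C hp hq) h.
have M0 := cr_M C.
have e17 : 0 <= 1 - 17 * eta.
  have k1 : 1 <= k%:R :> R by rewrite ler1n; apply: leq_trans k2.
  by have := ler_wpM2r (ltW (cr_eta0 C)) k1; have := cr_eta C; lra.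
have pl : (1 - 17 * eta) * M <= p.
  rewrite -(ler_pM2l n1) -hp; apply: sum_set_ge => v vV.
  by have /(cr_ent C) /andP [] : v \in V1 :|: V2 by rewrite inE vV.
have pl2 : ((1 - 17 * eta) * M) ^+ 2 <= p ^+ 2.
  by rewrite !expr2; apply: ler_pM => //; rewrite mulr_ge0 // ltW.
have M2 : 0 < M ^+ 2 by rewrite exprn_gt0.
rewrite -(ler_pM2r M2) -mulrA -exprMn; apply: le_trans h.
apply: ler_pM => //; first exact: sqr_ge0.
by rewrite ler_nat.
Qed.

(** The leading term of [inner_lower]; [n / 50] absorbs the terms in [eta] and the bounded ones. *)
Lemma inner_lower_linear (eta M : R) (V1 V2 W : {set V}) :
  core k t G rho x eta M V1 V2 W ->
  (k%:R - 1) * #|V|%:R / 2 - #|V|%:R / 50 <= (inner G V1 + inner G V2)%:R :> R.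
Proof.
move=> C; apply: le_trans (inner_lower C).
have k2 := ext_k (cr_ext C); have t0 := ext_t (cr_ext C).
have big1 := core_V1_big C.
have klt : (k * k * cc k < 1000 * k ^ 4 * t)%N := cc_lt k2 t0.
have n1 : (0 < #|V1|)%N by apply: leq_trans big1; exact: leq_ltn_trans klt.
have pn : #|V1|.-1%:R = #|V1|%:R - 1 :> R by case: (#|V1|) n1 => // m _; rewrite -natr1 addrK.
have pk : k.-1%:R = k%:R - 1 :> R by case: (k) k2 => // m _; rewrite -natr1 addrK.
have big : 1000 * k%:R <= eta * #|V|%:R.
  apply: le_trans (cr_big C); rewrite -natrM ler_nat -mulnA leq_mul2l /=.
  rewrite expnS -mulnA; apply: leq_pmulr; rewrite muln_gt0 t0 andbT expn_gt0; apply/orP; left; lia.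
have e0 := cr_eta0 C; have e1 := cr_eta C.
have k3 : 3 <= k%:R :> R by rewrite (ler_nat R 3).
have s1 := cr_size1 C.
have V0 : 0 <= #|V|%:R :> R by [].
rewrite natrM pn pk.
move: s1 e0 e1 k3 big V0; clear -eta; move: (#|V|%:R : R) (#|V1|%:R : R) (k%:R : R).
move=> n n1 kr s1 e0 e1 k3 big n0.
have ken : kr * eta * n <= n / 1000 by have := ler_wpM2r n0 e1; lra.
have h1 : (1 / 2 - eta) * n - 1 <= n1 - 1 by lra.
have h2 : 1 - 34 * eta <= (1 - 17 * eta) ^+ 2 by have := sqr_ge0 eta; lra.
have k1 : 0 <= kr - 1 by lra.
have a1 : ((1 / 2 - eta) * n - 1) * (kr - 1) <= (n1 - 1) * (kr - 1) by apply: ler_wpM2r.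
have ek : 0 <= eta * n by apply: mulr_ge0 => //; exact: ltW.
have en : 3 * eta * n <= kr * eta * n by have := ler_wpM2r ek k3; lra.
have a0 : 0 <= ((1 / 2 - eta) * n - 1) * (kr - 1) by apply: mulr_ge0 => //; lra.
have e34 : 0 <= 1 - 34 * eta by nra.
apply: (@le_trans _ _ (((1 / 2 - eta) * n - 1) * (kr - 1) * (1 - 34 * eta))); last first.
  by apply: ler_pM.
have h3 : ((1 / 2 - eta) * n - 1) * (kr - 1) <= n / 2 * (kr - 1).
  by apply: ler_wpM2r => //; lra.
have h4 := ler_wpM2r (ltW e0) h3.
by lra.
Qed.

End CoreDichotomy.

Lemma inner_le_mul (V : finType) (G : sgraph V) (X : {set V}) c m :
  {in X, forall v, c * #|nbr G v :&: X| <= m}%N -> (c * inner G X <= m * #|X|)%N.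
Proof.
move=> h; rewrite /inner big_distrr /= mulnC -sum_nat_const; exact: leq_sum.
Qed.

Lemma cc_ge k : (2 * k <= cc k)%N.
Proof. by rewrite /cc; lia. Qed.

Lemma cherry_half k a : (a * 4 + 3 < k.*2 -> 2 * a <= k.-2)%N.
Proof. lia. Qed.

Lemma edge_third k a : (a * 3 + 2 < k.*2 -> 3 * a <= k.*2 - 3)%N.
Proof. lia. Qed.

Section OneSided.
Variables (R : realType) (k t : nat) (V : finType) (G : sgraph V) (rho : R) (x : V -> R).

Lemma core_consts (eta M : R) (V1 V2 W : {set V}) :
  core k t G rho x eta M V1 V2 W ->
  [/\ (k * k * cc k)%:R <= eta * #|V|%:R, k%:R * (eta * #|V|%:R) <= #|V|%:R / 1000,
      eta * #|V|%:R <= #|V|%:R / 3000, 0 < #|V|%:R :> R &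
      #|V1|%:R + #|V2|%:R <= #|V|%:R :> R].
Proof.
move=> C; have k2 := ext_k (cr_ext C); have t0 := ext_t (cr_ext C).
have [u xu _] := max_entry (cr_ext C).
have V0 : (0 < #|V|)%N by apply/card_gt0P; exists u.
have n0 : 0 < #|V|%:R :> R by rewrite ltr0n.
have e1 := cr_eta C; have e0 := cr_eta0 C.
have k3 : 3 <= k%:R :> R by rewrite (ler_nat R 3).
have ken : k%:R * (eta * #|V|%:R) <= #|V|%:R / 1000 by have := ler_wpM2r (ltW n0) e1; lra.
have en0 : 0 <= eta * #|V|%:R by rewrite mulr_ge0 // ltW.
split=> //.
- by apply: le_trans (cr_big C); rewrite ler_nat ltnW // cc_lt.
- by have := ler_wpM2r en0 k3; lra.
- by rewrite -natrD ler_nat -(core_card C) leq_addr.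
Qed.

(** An edge in [V2] lowers almost all inner degrees in [V1] to [k - 2]. The total required by
    [inner_lower_linear] then leaves about [n / 2] to [V2], far more than boundedly many vertices
    can supply. *)
Lemma many_edges (eta M : R) (V1 V2 W : {set V}) :
  core k t G rho x eta M V1 V2 W -> (0 < inner G V2)%N -> has_segs G V2 1 (cc k).
Proof.
move=> C I2; have [u1 [u2 [u1V u2V g12]]] := inner_edge I2.
have k2 := ext_k (cr_ext C).
have [b1 b2 b3 n0 b4] := core_consts C.
have full := few_full_degree C u1V u2V g12.
have I1le := inner_le (cr_deg1 C) full.
apply: segs_star (cr_deg2 C) _ _ => //; rewrite ltnNge; apply/negP => few.
have I2le := inner_le (a := 0) (cr_deg2 C) few.
have low := inner_lower_linear C.
have I1R : (inner G V1)%:R <= (k%:R - 2) * #|V1|%:R + (k * k * cc k)%:R :> R.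
  have e : (k.-2)%:R = k%:R - 2 :> R by case: (k) k2 => [|[|m]] // _ /=;
    rewrite -[m.+2]addn2 natrD addrK.
  rewrite -e -natrM -natrD ler_nat; apply: leq_trans I1le _; rewrite leq_add2l.
  by rewrite [(2 * k * k)%N]mulnC mulnA leq_mul2l cc_ge orbT.
have I2R : (inner G V2)%:R <= (k * k * cc k)%:R :> R.
  by rewrite ler_nat; apply: leq_trans I2le _; rewrite mul0n add0n mulnA mulnAC.
have k3 : 0 <= k%:R - 2 :> R by rewrite subr_ge0 (ler_nat R 2) ltnW.
have s2 := cr_size2 C.
have h1 : #|V1|%:R <= (1 / 2 + eta) * #|V|%:R by lra.
have h2 := ler_wpM2l k3 h1.
by rewrite natrD in low; lra.
Qed.

Lemma few_segs (V1 V2 : {set V}) l :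
  {in V1, forall v, #|nbr G v :&: V1| < k}%N -> (l == 1) || (l == 2) ->
  has_segs G V1 l (cc k) \/ (inner G V1 <= l.-1 * #|V1| + k * k * cc k)%N.
Proof.
move=> deg l12.
have [few|many] := leqP #|[set v in V1 | l <= #|nbr G v :&: V1|]%N| (cc k * k); [right|left].
  have := inner_le (a := l.-1) (m := cc k * k) deg; case: (l) l12 few => // l' _ few.
  move=> /(_ few) h; apply: leq_trans h _; by rewrite leq_add2l mulnA mulnAC.
exact: segs_star deg l12 many.
Qed.

(** Edges abound in both parts, so inner degrees are at most [(2k - 3) / 3]. If cherries abound in a
    part, degrees in the other are at most [(k - 2) / 2]; otherwise the average inner degree of that
    part is at most about [1]. The total is thus about [(k - 2) n / 2], [k n / 3] or [n], each below
    [(k - 1) n / 2] when [k > 3]. *)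
Lemma not_both_sides (eta M : R) (V1 V2 W : {set V}) :
  core k t G rho x eta M V1 V2 W -> (3 < k)%N ->
  (0 < inner G V1)%N -> (0 < inner G V2)%N -> False.
Proof.
move=> C k3 I1 I2; have C' := core_sym C.
have s1 := many_edges C' I1; have s2 := many_edges C I2.
have d1 v (vV : v \in V1) := core_deg_bound C (leqnSn 1) s2 vV.
have d2 v (vV : v \in V2) := core_deg_bound C' (leqnSn 1) s1 vV.
have low := inner_lower_linear C; rewrite natrD in low.
have [b1 b2 b3 n0 b4] := core_consts C.
have z1 := cr_size1 C; have z2 := cr_size2 C.
have k4 : 4 <= k%:R :> R by rewrite (ler_nat R 4).
have k2 : k.-2%:R = k%:R - 2 :> R by case: (k) k3 => [|[|m]] // _ /=; rewrite -[m.+2]addn2 natrD addrK.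
have k23 : (k.*2 - 3)%:R = 2 * k%:R - 3 :> R by rewrite natrB -?mul2n ?natrM // mul2n -addnn;
  apply: leq_trans (ltnW k3) (leq_addl _ _).
have half (X Y : {set V}) (D : core k t G rho x eta M X Y W) :
    has_segs G Y 2 (cc k) -> 2 * (inner G X)%:R <= (k%:R - 2) * #|X|%:R :> R.
  move=> sY; rewrite -k2 -!natrM ler_nat; apply: inner_le_mul => v vX.
  exact: cherry_half (core_deg_bound D (leqnn 2) sY vX).
have third (X : {set V}) : {in X, forall v, #|nbr G v :&: X| * 3 + 2 < k.*2}%N ->
    3 * (inner G X)%:R <= (2 * k%:R - 3) * #|X|%:R :> R.
  move=> dX; rewrite -k23 -!natrM ler_nat; apply: inner_le_mul => v vX.
  exact: edge_third (dX v vX).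
have t1 := third V1 d1; have t2 := third V2 d2.
have one (X : {set V}) : (inner G X <= 2.-1 * #|X| + k * k * cc k)%N ->
    (inner G X)%:R <= #|X|%:R + eta * #|V|%:R :> R.
  by rewrite /= mul1n -(ler_nat R) natrD => h; apply: le_trans h _; rewrite lerD2l.
have h1 : #|V1|%:R <= (1 / 2 + eta) * #|V|%:R by lra.
have h2 : #|V2|%:R <= (1 / 2 + eta) * #|V|%:R by lra.
have kn : 4 * #|V|%:R <= k%:R * #|V|%:R :> R by rewrite ler_wpM2r // ltW.
have p1 : (2 * k%:R - 3) * #|V1|%:R <= (2 * k%:R - 3) * ((1 / 2 + eta) * #|V|%:R).
  by apply: ler_wpM2l => //; lra.
have p2 : (2 * k%:R - 3) * #|V2|%:R <= (2 * k%:R - 3) * ((1 / 2 + eta) * #|V|%:R).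
  by apply: ler_wpM2l => //; lra.
have q1 : (k%:R - 2) * #|V1|%:R <= (k%:R - 2) * ((1 / 2 + eta) * #|V|%:R).
  by apply: ler_wpM2l => //; lra.
have q2 : (k%:R - 2) * #|V2|%:R <= (k%:R - 2) * ((1 / 2 + eta) * #|V|%:R).
  by apply: ler_wpM2l => //; lra.
have en0 : 0 <= eta * #|V|%:R by apply: le_trans b1; exact: ler0n.
have l22 : ((2 == 1) || (2 == 2))%N by [].
case: (few_segs V2 (cr_deg1 C) l22) => [sg1|/one f1];
  case: (few_segs V1 (cr_deg2 C) l22) => [sg2|/one f2].
- by have := half _ _ C sg2; have := half _ _ C' sg1; clear -low en0 n0 b2 b3 q1 q2; lra.
- by clear -low en0 n0 b2 b3 p1 t1 f2 h2 kn; lra.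
- by clear -low en0 n0 b2 b3 p2 t2 f1 h1 kn; lra.
- by clear -low en0 n0 b2 b3 f1 f2 h1 h2 kn; lra.
Qed.

(** The total inner degree ties with that of a 2-regular graph on [V1]. Using the maxima [p] and [q]
    as entries, the competitor loses [q ^+ 2] per vertex of [V2] and gains [p ^+ 2] per vertex of
    [V1], which is no loss by the last hypothesis; strictness needs a slightly larger entry on
    [V1]. *)
Lemma no_two_matchings (eta M p q : R) (V1 V2 W : {set V}) :
  core k t G rho x eta M V1 V2 W -> k = 3 ->
  {in V1, forall v, #|nbr G v :&: V1| <= 1}%N -> {in V2, forall v, #|nbr G v :&: V2| <= 1}%N ->
  (exists2 u, u \in V1 & x u = p) -> {in V1, forall v, x v <= p} ->
  (exists2 u, u \in V2 & x u = q) -> {in V2, forall v, x v <= q} ->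
  #|V2|%:R * q ^+ 2 <= #|V1|%:R * p ^+ 2 -> False.
Proof.
move=> C k3 d1 d2 [u uV up] hp [w wV wq] hq pq.
have k2 := ext_k (cr_ext C); have t0 := ext_t (cr_ext C).
have big1 := core_V1_big C.
have klt : (k * k * cc k < 1000 * k ^ 4 * t)%N := cc_lt k2 t0.
have kV1 : (0 < k <= #|V1|)%N.
  rewrite (ltn_trans _ k2) //=; apply: leq_trans big1; apply: leq_trans (ltnW klt).
  by rewrite -mulnA; apply: leq_pmulr; rewrite muln_gt0 /cc addn_gt0 orbT andbT; exact: ltn_trans k2.
have [|T [G1 [cT degT nopT]]] := regular_no_path_exists kV1.
  by rewrite k3 oddM andbF.
have Wt : (#|W| < t)%N by rewrite -(cr_W C).
have szn : (#|W| + (#|T| + #|V2|) = #|V|)%N by rewrite cT addnC (core_card C).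
have degk v : (degree G1 v < k)%N by rewrite degT ltn_predL; exact: ltn_trans k2.
have n1 : 0 < #|V1|%:R :> R by rewrite ltr0n; case/andP: kV1 => h1 h2; apply: leq_trans h2.
have n2 : 0 <= #|V2|%:R :> R by [].
have r0 := rho_pos C.
(* Raising the entry on [V1] by [h] gains at least [2 a h p] to first order, with [a] the size of
   [V1], while the quadratic cost [rho a h^2] is only [a h p]. *)
pose h := p / rho.
have rh : rho * h = p by rewrite /h mulrC divfK // gt_eqF.
have p0 : 0 < p by rewrite -up; exact: cr_pos C u.
have q0 : 0 < q by rewrite -wq; exact: cr_pos C w.
have h0 : 0 < h by rewrite divr_gt0.
pose z := wtop rho x V1 V2 W.
have x0 := ext_ge0 (cr_ext C).
have X1 : wt x V1 <= #|V1|%:R * p by exact: sum_set_le.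
have X2 : wt x V2 <= #|V2|%:R * q by exact: sum_set_le.
have z0 : 0 <= z.
  have wt0 (X : {set V}) : 0 <= wt x X by apply: sumr_ge0.
  by apply: divr_ge0; [rewrite !addr_ge0 // | apply: addr_ge0 => //; exact: ltW].
have s0 : 0 <= #|W|%:R :> R by [].
have wle (X : {set V}) a : 0 <= a -> {in X, forall v, x v <= a} ->
    {in X, forall v, #|nbr G v :&: X| <= 1}%N -> {in X, forall v, wt x (nbr G v :&: X) <= a}.
  move=> a0 ha dX v vX; apply: le_trans (sum_set_le (c := a) _) _.
    by move=> y; rewrite inE => /andP [_ /ha].
  by rewrite ler_piMl // (ler_nat R _ 1) dX.
have A : (rho - 1) * p <= #|V2|%:R * q + #|W|%:R * z.
  have : rho * x u = _ := core_wt C (subsetP (subsetUl V1 V2) u uV).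
  rewrite up (wt_W C) -/z => e; have := wle V1 p (ltW p0) hp d1 u uV.
  have : wt x (nbr G u :&: V2) <= wt x V2 by apply: sum_set_sub => //; exact: subsetIr.
  by lra.
have B : (rho - 1) * q <= #|V1|%:R * p + #|W|%:R * z.
  have : rho * x w = _ := core_wt C (subsetP (subsetUr V1 V2) w wV).
  rewrite wq (wt_W C) -/z => e; have := wle V2 q (ltW q0) hq d2 w wV.
  have : wt x (nbr G w :&: V1) <= wt x V1 by apply: sum_set_sub => //; exact: subsetIr.
  by lra.
have Z := wtopE C; rewrite -/z in Z.
have := opt_join (cr_ext C) (p + h) q z Wt szn degk nopT.
have -> : (\sum_v degree G1 v)%N = (#|T| * 2)%N.
  by rewrite (eq_bigr (fun=> 2%N)) => [|v _]; rewrite ?sum_nat_const // degT k3.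
rewrite cT natrM.
move: (#|V1|%:R : R) (#|V2|%:R : R) (#|W|%:R : R) n1 n2 s0 pq A B Z X1 X2 => a b s a0 b0 s0 pq A B
  Z X1 X2.
have ap : 0 <= a * p by rewrite mulr_ge0 ?ltW.
have ah : 0 < a * h by rewrite mulr_gt0.
have bq : 0 <= b * q by rewrite mulr_ge0 ?(ltW q0).
have sz : 0 <= s * z by rewrite mulr_ge0.
have f1 := ler_wpM2l ap A; have f2 := ler_wpM2l (ltW ah) A; have f3 := ler_wpM2l bq B.
have f4 : s * z * (rho * z) <= s * z * ((s - 1) * z + a * p + b * q).
  by apply: ler_wpM2l => //; lra.
have f5 : 0 < a * h * p by rewrite mulr_gt0.
have f6 : rho * (a * h ^+ 2) = a * h * p by rewrite -rh; lra.
have f7 : rho * (a * h * p) = a * p ^+ 2 by rewrite expr2 -[X in a * (X * _)]rh; lra.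
have f8 : 0 <= a * h ^+ 2 by rewrite mulr_ge0 ?sqr_ge0 // ltW.
clear - f1 f2 f3 f4 f5 f6 f7 f8 pq; lra.
Qed.

(** For [k = 3] the edge segments on each side cap inner degrees at [1]; the roles of the parts are
    chosen by comparing [#|V2| q^2] with [#|V1| p^2]. *)
Lemma one_sided (eta M : R) (V1 V2 W : {set V}) :
  core k t G rho x eta M V1 V2 W -> inner G V1 = 0%N \/ inner G V2 = 0%N.
Proof.
move=> C; case: (posnP (inner G V1)) => [->|I1]; first by left.
case: (posnP (inner G V2)) => [->|I2]; first by right.
exfalso; have k2 := ext_k (cr_ext C).
have [k3|] := ltnP 3 k; first exact: not_both_sides C k3 I1 I2.
move=> k3; have {k3} k3 : k = 3 by lia.
have C' := core_sym C.
have s1 := many_edges C' I1; have s2 := many_edges C I2.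
have d1 : {in V1, forall v, #|nbr G v :&: V1| <= 1}%N.
  by move=> v vV; have := core_deg_bound C (leqnSn 1) s2 vV; rewrite k3; lia.
have d2 : {in V2, forall v, #|nbr G v :&: V2| <= 1}%N.
  by move=> v vV; have := core_deg_bound C' (leqnSn 1) s1 vV; rewrite k3; lia.
have maxX (X : {set V}) : (0 < inner G X)%N -> exists2 u, u \in X & {in X, forall v, x v <= x u}.
  move=> /inner_edge [w [_ [wX _ _]]].
  have [u uX umax] := @arg_maxP _ _ _ w [in X] x wX.
  by exists u => // v; exact: umax.
have [u uV umax] := maxX V1 I1; have [w wV wmax] := maxX V2 I2.
have eu : exists2 u', u' \in V1 & x u' = x u by exists u.
have ew : exists2 u', u' \in V2 & x u' = x w by exists w.
case: (leP (#|V2|%:R * x w ^+ 2) (#|V1|%:R * x u ^+ 2)) => h.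
  exact: no_two_matchings C k3 d1 d2 eu umax ew wmax h.
exact: no_two_matchings C' k3 d2 d1 ew wmax eu umax (ltW h).
Qed.

End OneSided.

(** * Completeness, regularity and sizes of the parts *)

Section OneSidedStructure.
Variables (R : realType) (k t : nat) (V : finType) (G : sgraph V) (rho : R) (x : V -> R).
Variables (eta M : R) (V1 V2 W : {set V}).
Hypotheses (C : core k t G rho x eta M V1 V2 W) (I2 : inner G V2 = 0%N).

Lemma part_independent : {in V2 &, forall a b, ~~ G a b}.
Proof.
move=> a b aV bV; apply/negP => g; have : (0 < inner G V2)%N; last by rewrite I2.
rewrite /inner (bigD1 a) //= addn_gt0; apply/orP; left.
by apply/card_gt0P; exists b; rewrite !inE g.
Qed.

Lemma part_disjoint a : a \in V1 -> a \in V2 -> False.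
Proof.
move=> a1 a2; have := cr_dis C; rewrite -setI_eq0 => /eqP/setP/(_ a).
by rewrite !inE a1 a2.
Qed.

(** Fewer than [#|V2|] vertices of [V2] miss some vertex of a path on [2k] vertices, so one of them
    sees it all and is the centre of a fan. *)
Lemma part_no_path p : uniq p -> sorted G p -> {in p, forall v, v \in V1} -> (size p < k.*2)%N.
Proof.
move=> up sp pV; rewrite ltnNge; apply/negP => big.
have k2 := ext_k (cr_ext C); have k0 : (0 < k)%N by exact: ltn_trans k2.
pose p' := take k.*2 p.
have p'V : {subset p' <= V1} by move=> v /mem_take; exact: pV.
have cb : (#|blocked G V2 p'| < #|V2|)%N.
  apply: leq_ltn_trans (card_blocked C p'V) _; rewrite size_takel //.
  apply: leq_trans (core_V1_big (core_sym C)).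
  apply: leq_ltn_trans (cc_lt k2 (ext_t (cr_ext C))).
  rewrite -mul2n [(2 * k * k)%N]mulnC -mulnA leq_mul2l; apply/orP; right.
  by apply: leq_trans (cc_ge k) _; exact: leq_pmull.
have [c] : exists c, c \in V2 :\: blocked G V2 p'.
  apply/card_gt0P; rewrite cardsD subn_gt0; apply: leq_ltn_trans cb.
  by rewrite subset_leq_card // subsetIr.
rewrite inE => /andP [cb' cV]; have adj := not_blocked cV cb'.
have inW u : u \in V1 :|: V2 -> u \in ~: W by rewrite (cr_cov C).
apply: (cr_nofan C (f := c :: take k.*2 p')); apply: fan_of_path.
- by apply: inW; rewrite inE cV orbT.
- move=> u up'; rewrite adj_sym adj //; split=> //.
  by apply: inW; rewrite inE p'V.
- exact: take_uniq.
- exact: take_sorted.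
- by rewrite size_takel.
Qed.

(** With [V2] independent, adding all cross edges keeps the graph free of fans outside [W], and
    maximality yields the edges. *)
Lemma parts_complete : {in V1 & V2, forall a b, G a b}.
Proof.
move=> a b aV bV; have k2 := ext_k (cr_ext C).
pose cross a b := (a \in V1) && (b \in V2) || (a \in V2) && (b \in V1).
pose r a b := G a b || cross a b.
have rs : symmetric r.
  by move=> c d; rewrite /r /cross adj_sym orbC ![(_ \in V1) && _]andbC orbC [X in _ || X]orbC.
have ri : irreflexive r.
  move=> c; rewrite /r /cross adj_irr /=; apply/negbTE/negP => /orP [] /andP [h1 h2].
    exact: part_disjoint h1 h2.
  exact: part_disjoint h2 h1.
pose H := SGraph rs ri.
have H11 c d : c \in V1 -> d \in V1 -> H c d = G c d.
  have nV2 e : e \in V1 -> (e \in V2) = false by move=> e1; apply/negbTE/negP => /(part_disjoint e1).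
  by move=> cV dV; rewrite /= /r /cross !nV2 // andbF orbF.
apply: (extremal_maximal (H := H) (cr_ext C) (cr_pos C)).
- apply: (gfree_hit (W := W)); first by rewrite -(cr_W C).
  apply: (@bipartite_fan_free k _ H V1 V2).
  + exact: ltn_trans k2.
  + by move=> c; rewrite -(cr_cov C) inE.
  + move=> c d cV dV; rewrite /= /r /cross (negbTE (part_independent cV dV)) cV dV /= andbT.
    case: (boolP (c \in V1)) => [c1|_]; first by case: (part_disjoint c1 cV).
    by apply/negP => d1; exact: part_disjoint d1 dV.
  + move=> c cV; have -> : nbr H c :&: V1 = nbr G c :&: V1; last exact: cr_deg1 C c cV.
    apply/setP => d; rewrite in_setI [RHS]in_setI !in_nbr.
    by case: (boolP (d \in V1)) => dV; rewrite ?andbF // H11.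
  + move=> p up sp pV; apply: part_no_path => //.
    case: p up sp pV => // c p _; rewrite /sorted.
    elim: p c => // d p IH c /andP [hcd sp] pV.
    have cV : c \in V1 by apply: pV; rewrite mem_head.
    have dV : d \in V1 by apply: pV; rewrite !inE eqxx orbT.
    have gcd : G c d by rewrite -H11.
    apply/andP; split=> //; apply: IH sp _ => u up.
    by apply: pV; rewrite inE up orbT.
- by move=> c d g; rewrite /= /r g.
by rewrite /= /r /cross aV bV orbT.
Qed.

End OneSidedStructure.

(** * Two real inequalities behind the comparison of sizes *)

Section Arithmetic.
Variable R : realType.

(** Put [y = tau * (g - tau) + E]. The formula for [B] gives [|B| <= g + d + tau + E], which is at
    most [y * (2 * d + 10)]; hence the dominating vertices contribute at most
    [y * sg * (4 * d + 20)], less than [y * T]. *)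
Lemma shift_bound (r n1 sg d g tau E B T : R) (e : bool) :
  0 < r -> 1 <= n1 -> 0 <= sg -> 2 <= d -> 1 <= tau <= 2 -> tau <= g -> 0 <= E ->
  9 / 10 <= tau * (g - tau) + E ->
  B * (n1 + r) = r * ((-1) ^+ e * g + d - (-1) ^+ e * tau) - (-1) ^+ e * tau * n1 + E ->
  sg * (4 * d + 20) < T ->
  (-1) ^+ e * tau * sg * B + (tau * (g - tau) + E) * T <= 0 -> False.
Proof.
move=> r0 n10 sg0 d2 /andP [t1 t2] tg E0 y0 BE hT h.
have nr : 0 < n1 + r by lra.
have gt : g - tau <= tau * (g - tau) by have := ler_wpM2r (_ : 0 <= g - tau) t1;
  rewrite subr_ge0 => /(_ tg); lra.
pose y := tau * (g - tau) + E.
have hB : - (g + d + tau + E) <= B <= g + d + tau + E.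
  have a2 : 0 <= r * E by rewrite mulr_ge0 // ltW.
  have a3 : 0 <= r * tau by rewrite mulr_ge0 //; lra.
  have a4 : 0 <= r * g by rewrite mulr_ge0 //; lra.
  have a5 : 0 <= n1 * g by rewrite mulr_ge0 //; lra.
  have a6 : 0 <= n1 * tau by rewrite mulr_ge0 //; lra.
  have a7 : 0 <= n1 * d by rewrite mulr_ge0 //; lra.
  have a8 : 0 <= r * d by rewrite mulr_ge0 //; lra.
  have a9 : 0 <= (n1 - 1) * E by rewrite mulr_ge0 //; lra.
  apply/andP; split; rewrite -(ler_pM2r nr) BE; case: e {BE h}; rewrite ?expr1 ?expr0; lra.
have hy : g + d + tau + E <= y * (2 * d + 10).
  have : (2 * d + 8) * (9 / 10) <= (2 * d + 8) * y by apply: ler_wpM2l => //; lra.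
  by rewrite /y; lra.
have y1 : 0 < y by rewrite /y; lra.
have hsB : - (2 * sg * (y * (2 * d + 10))) <= (-1) ^+ e * tau * sg * B.
  have ts : 0 <= tau * sg by rewrite mulr_ge0 //; lra.
  have yd : 0 <= y * (2 * d + 10) by rewrite mulr_ge0 //; lra.
  have ts2 : tau * sg * (y * (2 * d + 10)) <= 2 * sg * (y * (2 * d + 10)).
    by apply: ler_wpM2r => //; apply: ler_wpM2r.
  case/andP: hB => hB1 hB2.
  have c1 : tau * sg * B <= tau * sg * (y * (2 * d + 10)) by apply: ler_wpM2l => //; lra.
  have c2 : tau * sg * - (y * (2 * d + 10)) <= tau * sg * B by apply: ler_wpM2l => //; lra.
  by case: e {BE h}; rewrite ?expr1 ?expr0; lra.
have : y * (sg * (4 * d + 20)) < y * T by rewrite ltr_pM2l.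
by rewrite -/y in h; lra.
Qed.

(* The vertex of deficient degree in the balanced case [n1 = n2 = m]. *)
Lemma deficient_entry (rho sg E d m : R) :
  3 <= d -> 0 <= sg -> 0 < E -> 0 < rho - d -> d ^+ 2 + 2 + sg + d <= m ->
  E <= 2 -> (rho - d) * (rho - sg) = m * (sg + m) - E ->
  rho ^+ 2 < (sg + m) * (rho + d - 1).
Proof.
move=> d3 sg0 E1 r0 mbig E2 F1.
(* For large [m] the excess [y] is about [d / 2]. Up to nonnegative terms the claim is
   [m <= y * (m - d)], for which [3 <= d] leaves room. *)
pose y := rho - m - sg.
have yE : y * (rho + m - d) = m * d - E by rewrite /y; lra.
have m0 : 0 < m by have := sqr_ge0 d; lra.
have md : 3 * m <= m * d by rewrite mulrC ler_pM2l.
have rm : 0 < rho + m - d by lra.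
have y0 : 0 < y by rewrite -(pmulr_lgt0 _ rm) yE; have := sqr_ge0 d; lra.
have rE : rho + m - d = y + 2 * m + sg - d by rewrite /y; lra.
rewrite rE in yE.
have yd : y <= d.
  rewrite leNgt; apply/negP => h.
  have h1 : d * (y + 2 * m + sg - d) < y * (y + 2 * m + sg - d) by rewrite ltr_pM2r -?rE.
  have h2 : 0 <= d * (y + m + sg - d) by rewrite mulr_ge0 //; lra.
  lra.
have ylow : m * d - 2 <= y * (2 * m + sg).
  have : y * (y - d) <= 0 by rewrite pmulr_rle0 //; lra.
  lra.
have key : m <= y * (m - d).
  have ms : 0 < 2 * m + sg by lra.
  rewrite -(ler_pM2r ms).
  have md0 : 0 <= m - d by have := sqr_ge0 d; lra.
  have h1 := ler_wpM2r md0 ylow.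
  have h2 : 0 <= m * (m - (d ^+ 2 + 2 + sg + d)) by rewrite mulr_ge0 //; lra.
  have h3 : 0 <= m * (m * (d - 3)) by rewrite !mulr_ge0 //; lra.
  lra.
have sd : 0 <= sg * (d - 1) by rewrite mulr_ge0 //; lra.
have F2 : (sg + m) * (rho + d - 1) - rho ^+ 2 = y * (m - d) - m + sg * (d - 1) + E.
  rewrite /y; lra.
lra.
Qed.

End Arithmetic.

(** * Parity, regularity and sizes *)

Section Sizes.
Variables (R : realType) (k t : nat) (V : finType) (G : sgraph V) (rho : R) (x : V -> R).
Variables (eta M : R) (V1 V2 W : {set V}).
Hypotheses (C : core k t G rho x eta M V1 V2 W) (I2 : inner G V2 = 0%N).

Let n1 : R := #|V1|%:R.
Let n2 : R := #|V2|%:R.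
Let d : R := k%:R - 1.
Let z := wtop rho x V1 V2 W.

(* The common value of [x] on [V2]. *)
Definition bot : R := (wt x V1 + wt x W) / rho.

(* The total weight of [W] and the weighted degree defect of [V1], in units of [bot]. *)
Definition sgm : R := wt x W / bot.
Definition defect : R := (\sum_(v in V1) (k.-1 - #|nbr G v :&: V1|)%:R * x v) / bot.

(** All vertices of [V2] have the same neighbourhood, [V1] together with [W]. *)
Lemma bot_eq v : v \in V2 -> x v = bot.
Proof.
move=> vV; have r0 := rho_pos C.
have e : rho * x v = _ := core_wt C (subsetP (subsetUr V1 V2) v vV).
have n1v : nbr G v :&: V1 = V1.
  apply/setIidPr/subsetP => u uV; rewrite in_nbr adj_sym.
  exact: parts_complete C I2 u v uV vV.
have n2v : nbr G v :&: V2 = set0.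
  apply/setP => u; rewrite in_setI in_nbr in_set0; apply/negP => /andP [g uV].
  by have := part_independent I2 vV uV; rewrite g.
rewrite n1v n2v {2}/wt big_set0 addr0 in e.
by rewrite /bot -e mulrC mulKf // gt_eqF.
Qed.

Lemma V2_nonempty : exists v, v \in V2.
Proof.
apply/card_gt0P; apply: leq_trans (core_V1_big (core_sym C)).
exact: leq_ltn_trans (cc_lt (ext_k (cr_ext C)) (ext_t (cr_ext C))).
Qed.

Lemma bot_bounds : 0 < bot /\ (1 - 17 * eta) * M <= bot <= M.
Proof.
have [v vV] := V2_nonempty; rewrite -(bot_eq vV); split; first exact: cr_pos C v.
exact: cr_ent C v (subsetP (subsetUr V1 V2) v vV).
Qed.

Lemma wtV2 : wt x V2 = n2 * bot.
Proof.
by rewrite /wt (eq_bigr (fun=> bot)) => [|v vV]; rewrite ?bot_eq // sumr_const mulr_natl.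
Qed.

Lemma wtW_sgm : wt x W = sgm * bot.
Proof. by rewrite /sgm divfK // gt_eqF //; case: bot_bounds. Qed.

Lemma wtV1_sgm : wt x V1 = (rho - sgm) * bot.
Proof.
rewrite mulrBl -wtW_sgm /bot mulrC divfK ?addrK //.
by rewrite gt_eqF // (rho_pos C).
Qed.

Lemma predk : k.-1%:R = d :> R.
Proof. by rewrite /d; case: (k) (ext_k (cr_ext C)) => // m _; rewrite -natr1 addrK. Qed.

(** The eigenvalue equation is summed over [V1], with each inner degree written as [k - 1] minus its
    deficit, and divided by [bot]. *)
Lemma defect_eq : (rho - d) * (rho - sgm) = n1 * (sgm + n2) - defect.
Proof.
have [b0 _] := bot_bounds.
apply: (mulIf (negbT (gt_eqF b0))).
rewrite [RHS]mulrBl -[LHS]mulrA -wtV1_sgm.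
have -> : defect * bot = \sum_(v in V1) (k.-1 - #|nbr G v :&: V1|)%:R * x v.
  by rewrite /defect divfK // gt_eqF.
have -> : n1 * (sgm + n2) * bot = n1 * (wt x W + wt x V2) by rewrite wtW_sgm wtV2; lra.
have e1 : rho * wt x V1 = \sum_(v in V1) wt x (nbr G v :&: V1) + n1 * (wt x W + wt x V2).
  rewrite {1}/wt mulr_sumr /n1 mulr_natl -sumr_const -big_split; apply: eq_bigr => v vV /=.
  have -> : rho * x v = _ := core_wt C (subsetP (subsetUl V1 V2) v vV).
  have -> : nbr G v :&: V2 = V2; last by lra.
  apply/setIidPr/subsetP => u uV; rewrite in_nbr; exact: parts_complete C I2 v u vV uV.
have e2 : \sum_(v in V1) wt x (nbr G v :&: V1) = \sum_(v in V1) #|nbr G v :&: V1|%:R * x v.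
  transitivity (\sum_(v in V1) \sum_(u in V1) (G v u)%:R * x u).
    apply: eq_bigr => v _; rewrite /wt [LHS]big_mkcond [RHS]big_mkcond; apply: eq_bigr => u _ /=.
    by rewrite in_setI in_nbr; case: (u \in V1); case: (G v u); rewrite ?mul1r ?mul0r.
  rewrite exchange_big; apply: eq_bigr => u _; rewrite -mulr_suml; congr (_ * _).
  rewrite -natr_sum -sum1_card [in RHS]big_mkcond [in LHS]big_mkcond; congr (_%:R).
  apply: eq_bigr => v _; rewrite in_setI in_nbr adj_sym.
  by case: (v \in V1); case: (G u v).
have e3 : \sum_(v in V1) (k.-1 - #|nbr G v :&: V1|)%:R * x v =
    d * wt x V1 - \sum_(v in V1) #|nbr G v :&: V1|%:R * x v.
  rewrite /wt mulr_sumr -sumrB; apply: eq_bigr => v vV.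
  have dv : (#|nbr G v :&: V1| <= k.-1)%N.
    by have := cr_deg1 C vV; case: (k) (ext_k (cr_ext C)).
  by rewrite natrB // predk mulrBl.
rewrite e3 mulrBl e1 e2; lra.
Qed.

Lemma core_r0 : 0 < rho - d /\ 1 <= n1.
Proof.
have [b1 b2 b3 n0 b4] := core_consts C; have rl := cr_rho C.
have k2 := ext_k (cr_ext C); have t0 := ext_t (cr_ext C).
have kk : k%:R <= (k * k * cc k)%:R :> R.
  by rewrite ler_nat -mulnA leq_pmulr // muln_gt0 (ltn_trans _ k2) //= /cc addn_gt0 orbT.
have e0 := cr_eta0 C; have en0 : 0 <= eta * #|V|%:R by rewrite mulr_ge0 // ltW.
split; first by rewrite /d; lra.
rewrite /n1 ler1n; apply: leq_trans (core_V1_big C); exact: leq_ltn_trans (cc_lt k2 t0).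
Qed.

(* Rayleigh quotient of the competitor with parts of sizes [N1], [N2], tested on
   the vector equal to [bot] and [z] on the other two parts and balanced on the
   first part. *)
Lemma competitor N1 N2 : (N1 + N2 = #|V1| + #|V2|)%N -> (k <= N1)%N -> ~~ odd (N1 * k.-1) ->
  (N1%:R * (sgm + N2%:R) - (rho - d) * (rho - sgm)) * (sgm + N2%:R) <=
    sgm * (n2 - N2%:R) * (rho - d).
Proof.
move=> NN kN par; have k2 := ext_k (cr_ext C).
have kN1 : (0 < k <= N1)%N by rewrite (ltn_trans _ k2).
have [T [G1 [cT degT nopT]]] := regular_no_path_exists kN1 par.
have Wt : (#|W| < t)%N by rewrite -(cr_W C).
have szn : (#|W| + (#|T| + N2) = #|V|)%N by rewrite cT NN addnC (core_card C).
have degk v : (degree G1 v < k)%N by rewrite degT ltn_predL; exact: ltn_trans k2.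
have [b0 _] := bot_bounds; have [r0 _] := core_r0; have rho0 := rho_pos C.
(* [u * bot] is the entry that the eigenvalue equation with [rho] would prescribe on the
   [(k - 1)]-regular part; it maximises the quadratic in that entry. *)
pose T0 : R := sgm + N2%:R; pose u := T0 / (rho - d).
have ru : (rho - d) * u = T0 by rewrite /u mulrC divfK // gt_eqF.
have := opt_join (cr_ext C) (u * bot) bot z Wt szn degk nopT.
have -> : (\sum_v degree G1 v)%N = (N1 * k.-1)%N.
  by rewrite (eq_bigr (fun=> k.-1)) => [|v _]; rewrite ?sum_nat_const ?cT // degT.
rewrite cT natrM predk.
have sz : #|W|%:R * z = sgm * bot by rewrite -wtW_sgm (wt_W C).
have tE : rho * z = (#|W|%:R - 1) * z + (rho - sgm) * bot + n2 * bot.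
  by rewrite -wtV1_sgm -wtV2; exact: wtopE C.
rewrite sz.
have e2 : #|W|%:R * (#|W|%:R - 1) * z ^+ 2 - rho * (#|W|%:R * z ^+ 2) =
    - (sgm * bot) * ((rho - sgm) * bot + n2 * bot).
  have := congr1 (fun y => #|W|%:R * z * y) tE => /= e.
  have -> : - (sgm * bot) * ((rho - sgm) * bot + n2 * bot) =
     - (#|W|%:R * z * ((rho - sgm) * bot + n2 * bot)) by rewrite sz; lra.
  lra.
move=> h; have b2 : 0 < bot ^+ 2 by rewrite exprn_gt0.
have h2 : bot ^+ 2 * (- (rho - d) * N1%:R * u ^+ 2 + 2 * N1%:R * u * T0 + 2 * sgm * N2%:R
    - sgm * (rho - sgm + n2) - rho * N2%:R) <= 0.
  rewrite /T0; move: h e2; move: (N1%:R : R) (N2%:R : R) (#|W|%:R : R) => a b s h e2; lra.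
rewrite pmulr_rle0 // in h2.
have h3 : N1%:R * u * T0 + 2 * sgm * N2%:R - sgm * (rho - sgm + n2) - rho * N2%:R <= 0.
  have e3 : N1%:R * u * T0 = (rho - d) * N1%:R * u ^+ 2 by rewrite -ru; lra.
  lra.
have := ler_wpM2l (ltW r0) h3; rewrite mulr0.
have e4 : (rho - d) * (N1%:R * u * T0) = N1%:R * T0 * T0 by rewrite -ru; lra.
rewrite -/T0 => h5.
have e5 : (rho - d) * (N1%:R * u * T0 + 2 * sgm * N2%:R - sgm * (rho - sgm + n2) - rho * N2%:R) =
  N1%:R * T0 * T0 + (rho - d) * (2 * sgm * N2%:R - sgm * (rho - sgm + n2) - rho * N2%:R).
  rewrite -e4; lra.
rewrite e5 in h5; move: h5; rewrite /T0; move: (N1%:R : R) (N2%:R : R) => a b h5; lra.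
Qed.

Lemma core_num : [/\ 0 <= sgm, sgm <= 4 * (t%:R - 1), 0 <= defect,
   sgm * (4 * d + 20) + 100 <= n2 - 2 &
   4 * d ^+ 2 + 100 + sgm <= n2 /\ 9 / 10 * bot <= (1 - 17 * eta) * M].
Proof.
have [b0 /andP [bl bu]] := bot_bounds; have M0 := cr_M C.
have k2 := ext_k (cr_ext C); have t0 := ext_t (cr_ext C).
have x0 := ext_ge0 (cr_ext C).
have k3 : 3 <= k%:R :> R by rewrite (ler_nat R 3).
have t1 : 1 <= t%:R :> R by rewrite ler1n.
have e17 : 99 / 100 <= 1 - 17 * eta.
  by have := ler_wpM2r (ltW (cr_eta0 C)) k3; have := cr_eta C; lra.
have bM : 99 / 100 * M <= bot by apply: le_trans bl; rewrite ler_wpM2r ?(ltW M0).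
have hb : 9 / 10 * bot <= (1 - 17 * eta) * M.
  by apply: (@le_trans _ _ (99 / 100 * M)); [lra | rewrite ler_wpM2r ?(ltW M0)].
have s0 : 0 <= sgm by apply: divr_ge0; [exact: sumr_ge0 | exact: ltW].
have s4 : sgm <= 4 * (t%:R - 1).
  have Wt : #|W|%:R = t%:R - 1 :> R by rewrite -(cr_W C) -natr1 addrK.
  rewrite /sgm ler_pdivrMr // -Wt; apply: le_trans (sum_set_le (c := 3 * M) _) _.
    by move=> w _; exact: cr_le3 C w.
  have : #|W|%:R * (3 * M) <= #|W|%:R * (4 * bot) by apply: ler_wpM2l => //; lra.
  lra.
have big : 1000 * (k%:R * k%:R * t%:R) <= n2.
  have hn : (1000 * (k * k * t) <= #|V2|)%N.
    apply: leq_trans (core_V1_big (core_sym C)).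
    have -> : (k ^ 4 = k * k * (k * k))%N by rewrite !expnS expn0 muln1 !mulnA.
    rewrite -[(1000 * _ * t)%N]mulnA; apply: leq_mul => //; apply: leq_mul => //.
    by apply: leq_pmulr; rewrite muln_gt0 andbb; exact: ltn_trans k2.
  by rewrite -!natrM ler_nat.
have h2 : 3 * t%:R <= k%:R * t%:R :> R by apply: ler_wpM2r.
have h1 : 3 * (k%:R * t%:R) <= k%:R * k%:R * t%:R :> R
  by rewrite -mulrA; apply: ler_wpM2r => //; rewrite mulr_ge0.
have h3 : k%:R * k%:R * 1 <= k%:R * k%:R * t%:R :> R
  by apply: ler_wpM2l => //; rewrite mulr_ge0.
split=> //.
- apply: divr_ge0; last exact: ltW.
  by apply: sumr_ge0 => v _; rewrite mulr_ge0.
- have : sgm * (4 * d + 20) <= 4 * (t%:R - 1) * (4 * d + 20).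
    by apply: ler_wpM2r => //; rewrite /d; lra.
  by rewrite /d; lra.
- by split=> //; rewrite /d; lra.
Qed.

Lemma full_degree_of_defect : defect <= 0 -> {in V1, forall v, #|nbr G v :&: V1| = k.-1}.
Proof.
move=> h v vV; have [b0 _] := bot_bounds.
have dv : (#|nbr G v :&: V1| <= k.-1)%N.
  by have := cr_deg1 C vV; case: (k) (ext_k (cr_ext C)).
apply/eqP; rewrite eqn_leq dv leqNgt /=; apply/negP => hlt.
move: h; apply/negP; rewrite -ltNge divr_gt0 // (bigD1 v) //=.
apply: ltr_wpDr; first by apply: sumr_ge0 => u _; rewrite mulr_ge0 // ltW // (cr_pos C).
by rewrite mulr_gt0 ?(cr_pos C) // ltr0n subn_gt0.
Qed.

Lemma defect_pos v : v \in V1 -> (#|nbr G v :&: V1| < k.-1)%N -> x v / bot <= defect.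
Proof.
move=> vV hlt; have [b0 _] := bot_bounds; have x0 := ext_ge0 (cr_ext C).
rewrite /defect ler_pM2r ?invr_gt0 // (bigD1 v) //= ler_wpDr //.
  by apply: sumr_ge0 => u _; rewrite mulr_ge0.
by rewrite ler_peMl // ler1n subn_gt0.
Qed.

Lemma entry_bot v : v \in V1 -> 9 / 10 <= x v / bot.
Proof.
move=> vV; have [b0 _] := bot_bounds; have [_ _ _ _ [_ hb]] := core_num.
rewrite ler_pdivlMr //; apply: le_trans hb _.
by have /andP [] := cr_ent C (subsetP (subsetUl V1 V2) v vV).
Qed.

(* [e] tells whether the first part of the competitor loses or gains [tau] vertices. *)
Lemma shifted (e : bool) tau g : (0 < tau <= 2)%N ->
  (if e then #|V1| = #|V2| + g else #|V2| = #|V1| + g)%N ->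
  ~~ odd ((if e then (#|V1| - tau)%N else (#|V1| + tau)%N) * k.-1) ->
  let T := sgm + n2 - (-1) ^+ e * tau%:R in let B := T - (rho - d) in
  [/\ (-1) ^+ e * tau%:R * sgm * B + (tau%:R * (g%:R - tau%:R) + defect) * T <= 0,
      B * (n1 + (rho - d)) = (rho - d) * ((-1) ^+ e * g%:R + d - (-1) ^+ e * tau%:R)
        - (-1) ^+ e * tau%:R * n1 + defect & sgm * (4 * d + 20) < T].
Proof.
move=> /andP [tau0 tau2] hg par T B; have F1 := defect_eq.
have k2 := ext_k (cr_ext C); have t0 := ext_t (cr_ext C).
have [s0 s4 D0 big _] := core_num.
have bign X Y : core k t G rho x eta M X Y W -> (k + 2 <= #|X|)%N.
  move=> CX; apply: leq_trans (core_V1_big CX); apply: leq_trans (cc_lt k2 t0).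
  have : (0 < k * k)%N by rewrite muln_gt0 andbb; exact: ltn_trans k2.
  by move=> kk; apply: leqW; apply: leq_trans (leq_pmull _ kk); rewrite /cc; lia.
have b1 := bign _ _ C; have b2 := bign _ _ (core_sym C).
have tau2R : tau%:R <= 2 :> R by rewrite (ler_nat R _ 2).
have tau0R : 0 <= tau%:R :> R by [].
(* With [j = (-1) ^+ e * tau], the sign cancels in [j * (n2 - n1 - j)], which is [tau * (g - tau)]
   in both directions. *)
have gE : (-1) ^+ e * g%:R = n2 - n1.
  rewrite /n1 /n2; case: (e) hg => ->; rewrite natrD ?expr1 ?expr0; lra.
have [N1 [N2 [NN kN [eN1 eN2] parN]]] : exists N1 N2, [/\ (N1 + N2 = #|V1| + #|V2|)%N, (k <= N1)%N,
    N1%:R = n1 + (-1) ^+ e * tau%:R /\ N2%:R = n2 - (-1) ^+ e * tau%:R & ~~ odd (N1 * k.-1)].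
  rewrite /n1 /n2; case: (e) par => par.
    exists (#|V1| - tau)%N, (#|V2| + tau)%N; split=> //; [lia|lia|].
    by rewrite natrB ?natrD ?expr1; [split; lra | lia].
  exists (#|V1| + tau)%N, (#|V2| - tau)%N; split=> //; [lia|lia|].
  by rewrite natrB ?natrD ?expr0; [split; lra | lia].
have := competitor NN kN parN; rewrite F1 eN1 eN2.
have Tbig : sgm * (4 * d + 20) < T.
  by rewrite /T; case: (e); rewrite ?expr1 ?expr0; lra.
rewrite /B /T => h; split; last exact: Tbig.
  have F1' : (rho - d) * (rho - sgm) = n1 * (sgm + n2) - defect := F1.
  move: gE h {F1 Tbig}; move: (tau%:R : R) (g%:R : R) defect F1' sgm => a c E F1 sg.
  by case: (e); rewrite ?expr1 ?expr0 => gE h;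
    [have n2E : n2 = n1 - c by lra | have n2E : n2 = n1 + c by lra];
    rewrite n2E in h *; lra.
move: gE F1 {h Tbig}; move: (tau%:R : R) (g%:R : R) defect sgm => a c E sg.
by case: (e); rewrite ?expr1 ?expr0 => gE F1;
  [have n2E : n2 = n1 - c by lra | have n2E : n2 = n1 + c by lra];
    rewrite n2E in F1 *; lra.
Qed.

Lemma d_ge2 : 2 <= d.
Proof.
have : 3 <= k%:R :> R by rewrite (ler_nat R 3); exact: ext_k (cr_ext C).
by rewrite /d; lra.
Qed.

(** Shifting [tau] vertices towards balance would gain at least [9 / 10], either because the gap is
    larger than [tau] or because of a single deficient vertex, which alone contributes [9 / 10] to
    the defect. *)
Lemma no_far (e : bool) tau g : (0 < tau <= 2)%N ->
  (if e then #|V1| = #|V2| + g else #|V2| = #|V1| + g)%N ->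
  ~~ odd ((if e then (#|V1| - tau)%N else (#|V1| + tau)%N) * k.-1) ->
  (tau <= g)%N -> (tau < g)%N \/ 9 / 10 <= defect -> False.
Proof.
move=> tau12 hg par tg alt; have [h BE Tbig] := shifted (e := e) tau12 hg par.
have [s0 _ D0 _ _] := core_num; have [r0 n10] := core_r0.
have t12 : 1 <= tau%:R :> R /\ tau%:R <= 2 :> R.
  by case/andP: tau12 => h1 h2; rewrite ler1n (ler_nat R _ 2).
have tgR : tau%:R <= g%:R :> R by rewrite ler_nat.
have y0 : 9 / 10 <= tau%:R * (g%:R - tau%:R) + defect.
  case: alt => [lt|hD].
    have lt1 : tau%:R + 1 <= g%:R :> R by rewrite natr1 ler_nat.
    have : tau%:R * 1 <= tau%:R * (g%:R - tau%:R) :> R by apply: ler_wpM2l => //; lra.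
    case: t12; lra.
  have : 0 <= tau%:R * (g%:R - tau%:R) :> R by apply: mulr_ge0 => //; lra.
  lra.
apply: (shift_bound r0 n10 s0 d_ge2 _ tgR D0 y0 BE Tbig h).
by case: t12 => -> ->.
Qed.

Lemma deficient_vertex : odd (#|V1| * k.-1) -> exists2 v, v \in V1 & (#|nbr G v :&: V1| < k.-1)%N.
Proof.
move=> od; apply: contrapT => no; have := even_inner G V1; rewrite /inner.
rewrite (eq_bigr (fun=> k.-1)) => [|v vV]; first by rewrite sum_nat_const od.
apply/eqP; rewrite eqn_leq; have -> : (#|nbr G v :&: V1| <= k.-1)%N.
  by have := cr_deg1 C vV; case: (k) (ext_k (cr_ext C)).
by rewrite leqNgt; apply/negP => h; apply: no; exists v.
Qed.

(** Enlarging [V1] by one vertex repairs the parity but costs [1], so the defect must be shown to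
    exceed [1], which the rough bound on entries cannot do. *)
Lemma balanced_odd : #|V1| = #|V2| -> odd (#|V1| * k.-1) -> False.
Proof.
move=> n12 od; have [v vV hv] := deficient_vertex od.
have [b0 _] := bot_bounds; have [s0 _ D0 _ [big _]] := core_num; have [r0 n10] := core_r0.
have rho0 := rho_pos C.
have Dv := defect_pos vV hv; have xv := entry_bot vV.
have d3 : 3 <= d.
  have : (4 <= k)%N by move: od (ext_k (cr_ext C)); rewrite oddM => /andP [_];
    case: (k) => [|[|[|[|m]]]].
  by rewrite -(ler_nat R 4) /d; lra.
have mE : n2 = n1 by rewrite /n2 -n12.
have hd : 3 * d <= d ^+ 2 by rewrite expr2 ler_pM2r //; lra.
have bigm : d ^+ 2 + 2 + sgm + d <= n1 by rewrite -mE; lra.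
(* Otherwise [v] lacks just one neighbour. Estimating [x v] through two rounds of the eigenvalue
   equation, with its [d - 1] inner neighbours, gives [x v > bot] by [deficient_entry], and the
   defect is at least [x v / bot]. *)
have E1 : 1 < defect.
  rewrite ltNge; apply/negP => E1.
  have F1 := defect_eq; rewrite mE in F1.
  have E0 : 0 < defect by lra.
  have E2 : defect <= 2 by lra.
  have key := deficient_entry d3 s0 E0 r0 bigm E2 F1.
  have deg2 : (k.-2 <= #|nbr G v :&: V1|)%N.
    rewrite leqNgt; apply/negP => lt2; have x0 := ext_ge0 (cr_ext C).
    have : 2 * (x v / bot) <= defect.
      rewrite /defect mulrA ler_pM2r ?invr_gt0 // (bigD1 v) //= ler_wpDr //.
        by apply: sumr_ge0 => u _; rewrite mulr_ge0.
      by rewrite ler_wpM2r // (ler_nat R 2); clear -lt2 hv; lia.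
    lra.
  have degR : d - 1 <= #|nbr G v :&: V1|%:R.
    have -> : d - 1 = (k.-2)%:R; last by rewrite ler_nat.
    by rewrite /d; case: (k) (ext_k (cr_ext C)) => [|[|m]] // _ /=; rewrite -[m.+2]addn2 natrD; lra.
  have xlow u : u \in V1 -> (sgm + n1) * bot <= rho * x u.
    move=> uV; have -> : rho * x u = _ := core_wt C (subsetP (subsetUl V1 V2) u uV).
    have -> : nbr G u :&: V2 = V2.
      by apply/setIidPr/subsetP => w wV; rewrite in_nbr; exact: parts_complete C I2 u w uV wV.
    have : 0 <= wt x (nbr G u :&: V1) by apply: sumr_ge0 => w _; exact: ext_ge0 (cr_ext C) w.
    by rewrite wtV2 wtW_sgm mE; lra.
  have xv2 : (sgm + n1) * bot * (rho + d - 1) <= rho * rho * x v.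
    have -> : rho * rho * x v = rho * (rho * x v) by rewrite mulrA.
    have -> : rho * x v = _ := core_wt C (subsetP (subsetUl V1 V2) v vV).
    have -> : nbr G v :&: V2 = V2.
      by apply/setIidPr/subsetP => w wV; rewrite in_nbr; exact: parts_complete C I2 v w vV wV.
    have h1 : #|nbr G v :&: V1|%:R * ((sgm + n1) * bot) <= rho * wt x (nbr G v :&: V1).
      rewrite /wt mulr_sumr; apply: sum_set_ge => u; rewrite inE => /andP [_ uV]; exact: xlow.
    have snb : 0 <= (sgm + n1) * bot by rewrite mulr_ge0 ?(ltW b0) //; lra.
    have h2 := ler_wpM2r snb degR.
    by rewrite wtV2 wtW_sgm mE; lra.
  have : (sgm + n1) * (rho + d - 1) <= rho * rho * (x v / bot).
    by rewrite mulrA ler_pdivlMr // mulrAC.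
  have rr : 0 < rho * rho by rewrite mulr_gt0.
  have : rho * rho * (x v / bot) <= rho * rho * 1 by rewrite ler_pM2l //; lra.
  by move: key; rewrite expr2; lra.
have hg : (if false then #|V1| = #|V2| + 0 else #|V2| = #|V1| + 0)%N by rewrite addn0 -n12.
have t1 : (0 < 1 <= 2)%N by [].
have par : ~~ odd ((if false then (#|V1| - 1)%N else (#|V1| + 1)%N) * k.-1).
  by move: od; rewrite !oddM oddD => /andP [-> ->].
have [h BE Tbig] := shifted (e := false) t1 hg par; move: h BE Tbig.
set T := sgm + n2 - _; set B := T - _ => h BE Tbig.
have T0 : 0 < T by apply: le_lt_trans Tbig; rewrite mulr_ge0 //; lra.
have rl : n1 - 1 <= rho.
  have := rho_lower (cr_ext C).
  have V0 : (0 < #|V|)%N by rewrite -(core_card C) -n12 -addnA addn_gt0 -(ltr_nat R) (lt_le_trans _ n10).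
  move=> /(_ V0); have : n1 + n2 <= #|V|%:R by rewrite -natrD ler_nat -(core_card C) leq_addr.
  by rewrite mE; lra.
have B0 : 0 <= B.
  have nr : 0 < n1 + (rho - d) by lra.
  rewrite -(pmulr_lge0 _ nr) BE expr0.
  have : 2 * (rho - d) <= (d - 1) * (rho - d) by apply: ler_wpM2r; [exact: ltW | lra].
  by lra.
have h1 : 0 <= sgm * B by rewrite mulr_ge0.
have h2 : 0 < (defect - 1) * T by rewrite mulr_gt0 // subr_gt0.
by move: h; rewrite expr0; lra.
Qed.

(** Odd parity forces a deficient vertex by the handshake lemma. A shift by one vertex towards
    balance restores parity and gains from the defect; parts of equal size are left to
    [balanced_odd]. *)
Lemma parity_ok : ~~ odd (#|V1| * k.-1).
Proof.
apply/negP => od; have [v vV hv] := deficient_vertex od.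
have D9 : 9 / 10 <= defect by apply: le_trans (entry_bot vV) (defect_pos vV hv).
have [h|h|h] := ltngtP #|V1| #|V2|; last exact: balanced_odd.
- apply: (@no_far false 1 (#|V2| - #|V1|)) => //;
    [by rewrite subnKC // ltnW| |by rewrite subn_gt0|by right].
  by move: od; rewrite !oddM oddD => /andP [-> ->].
- apply: (@no_far true 1 (#|V1| - #|V2|)) => //;
    [by rewrite subnKC // ltnW| |by rewrite subn_gt0|by right].
  have V0 : (0 < #|V1|)%N by apply: leq_ltn_trans h.
  by move: od; rewrite !oddM oddB // => /andP [-> ->].
Qed.

(** Against the competitor with parts of the same sizes and a regular graph on the first, the
    inequality reduces to [defect <= 0]. *)
Lemma part_regular : {in V1, forall v, #|nbr G v :&: V1| = k.-1}.
Proof.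
apply: full_degree_of_defect; have [s0 _ D0 big _] := core_num; have [r0 n10] := core_r0.
have kV1 : (k <= #|V1|)%N.
  have := core_V1_big C; apply: leq_trans;
    apply: leq_trans (ltnW (cc_lt (ext_k (cr_ext C)) (ext_t (cr_ext C)))).
  have kk : (0 < k * k)%N by rewrite muln_gt0 andbb; exact: ltn_trans (ext_k (cr_ext C)).
  by apply: leq_trans (leq_pmull _ kk); apply: leq_trans (cc_ge k); exact: leq_pmull.
have := competitor (erefl _) kV1 parity_ok; rewrite defect_eq subrr mulr0 mul0r.
rewrite -/n1 -/n2 opprB addrCA addrN addr0 pmulr_lle0 //.
have d2 := d_ge2; have h : 0 <= sgm * (4 * d + 20) by rewrite mulr_ge0 //; lra.
by lra.
Qed.

(** [tau] is the least shift that preserves the parity of [#|V1| * k.-1]. When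
    [#|V2| = #|V1| + tau], swapping the sizes makes the main term vanish; for [t > 1] the remaining
    term [tau * sgm * B] is positive and excludes this case. *)
Lemma part_sizes_near : let tau := if odd k then 1%N else 2%N in
  [/\ (#|V2| <= #|V1| + tau)%N, (#|V1| <= #|V2| + tau)%N,
      (1 < t -> #|V2| < #|V1| + tau)%N & ~~ odd k -> ~~ odd #|V1|].
Proof.
move=> tau; have k2 := ext_k (cr_ext C).
have tau12 : (0 < tau <= 2)%N by rewrite /tau; case: (odd k).
have par := parity_ok.
have oddk1 : odd k.-1 = ~~ odd k by case: (k) k2 => //= m _; rewrite negbK.
have parP : ~~ odd ((#|V1| + tau) * k.-1).
  by move: par; rewrite !oddM oddk1 oddD /tau; case: (odd k); rewrite ?andbF ?addbF.
have big := core_V1_big C.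
have cc2 : (2 < #|V1|)%N.
  apply: leq_trans big; apply: leq_trans (cc_lt k2 (ext_t (cr_ext C))).
  have kk : (0 < k * k)%N by rewrite muln_gt0 andbb; exact: ltn_trans k2.
  by apply: leqW; apply: leq_trans (leq_pmull _ kk); apply: leq_trans (cc_ge k);
    rewrite (leq_trans _ (leq_pmull k _)).
have tauV : (tau <= #|V1|)%N by apply: leq_trans (ltnW cc2); case/andP: tau12.
have parM : ~~ odd ((#|V1| - tau) * k.-1).
  by move: par; rewrite !oddM oddk1 oddB // /tau; case: (odd k); rewrite ?andbF ?addbF.
split.
- rewrite leqNgt; apply/negP => h.
  have le12 : (#|V1| <= #|V2|)%N by apply: leq_trans (ltnW h); exact: leq_addr.
  have lt : (tau < #|V2| - #|V1|)%N by rewrite ltn_subRL.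
  by apply: (@no_far false tau (#|V2| - #|V1|)) => //; [rewrite subnKC | exact: ltnW | left].
- rewrite leqNgt; apply/negP => h.
  have le12 : (#|V2| <= #|V1|)%N by apply: leq_trans (ltnW h); exact: leq_addr.
  have lt : (tau < #|V1| - #|V2|)%N by rewrite ltn_subRL.
  by apply: (@no_far true tau (#|V1| - #|V2|)) => //; [rewrite subnKC | exact: ltnW | left].
- move=> t1; rewrite ltnNge; apply/negP => h.
  have V2E : #|V2| = (#|V1| + tau)%N.
    apply/eqP; rewrite eqn_leq h andbT leqNgt; apply/negP => h'.
    have le12 : (#|V1| <= #|V2|)%N by apply: leq_trans (ltnW h'); exact: leq_addr.
    have lt : (tau < #|V2| - #|V1|)%N by rewrite ltn_subRL.
    by apply: (@no_far false tau (#|V2| - #|V1|)) => //; [rewrite subnKC | exact: ltnW | left].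
  have [hh BE Tbig] := shifted (e := false) tau12 V2E parP; move: hh BE Tbig.
  set T := sgm + n2 - _; set B := T - _ => hh BE Tbig.
  have [s0 _ D0 _ [bign _]] := core_num; have [r0 n10] := core_r0; have [b0 _] := bot_bounds.
  have D00 : defect = 0.
    by rewrite /defect big1 ?mul0r // => v vV; rewrite part_regular // subnn mul0r.
  have cW : (0 < #|W|)%N by rewrite -ltnS (cr_W C).
  have [w wW] := card_gt0P cW.
  have sp : 0 < sgm.
    rewrite /sgm divr_gt0 // /wt (bigD1 w) //= ltr_wpDr ?(cr_pos C) //.
    by apply: sumr_ge0 => u _; exact: ext_ge0 (cr_ext C) u.
  have taud : tau%:R + 1 <= d.
    rewrite natr1 -predk ler_nat /tau; move: k2; case: (k) => [|[|[|[|m]]]] //= _.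
    by case: (~~ ~~ ~~ odd m).
  have tau0 : 1 <= tau%:R :> R by rewrite ler1n; case/andP: tau12.
  have n2E : n2 = n1 + tau%:R by rewrite /n2 V2E natrD.
  have rl : n1 + tau%:R / 2 <= rho.
    have := rho_lower (cr_ext C).
    have V0 : (0 < #|V|)%N by rewrite -(core_card C) -addnA addn_gt0 (ltn_trans _ cc2).
    move=> /(_ V0); have : n1 + n2 + 1 <= #|V|%:R.
      by rewrite -natrD natr1 ler_nat -(core_card C) -addn1 leq_add2l.
    by rewrite n2E; lra.
  have Bp : 0 < B.
    have nr : 0 < n1 + (rho - d) by lra.
    rewrite -(pmulr_lgt0 _ nr) BE D00 expr0.
    have dd : 0 <= d ^+ 2 by exact: sqr_ge0.
    have e1 : d * n1 <= d * rho by apply: ler_wpM2l; lra.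
    have e2 : (tau%:R + 1) * n1 <= d * n1 by apply: ler_wpM2r; lra.
    have e3 : tau%:R <= 2 :> R by rewrite (ler_nat R _ 2); case/andP: tau12.
    by lra.
  have pos : 0 < tau%:R * sgm * B.
    by apply: mulr_gt0 Bp; apply: mulr_gt0 sp; exact: lt_le_trans tau0.
  move: hh; rewrite D00 (subrr tau%:R) (mulr0 tau%:R) (addr0 0) (mul0r T) addr0 expr0 mul1r.
  by rewrite leNgt pos.
- by move=> ek; move: par; rewrite oddM oddk1 ek andbT.
Qed.

End Sizes.

Lemma part_sizes_mem k t n n1 n2 : (0 < n1)%N -> (0 < t)%N -> (n1 + n2 + t = n.+1)%N ->
  (let tau := if odd k then 1%N else 2%N in
   [/\ (n2 <= n1 + tau)%N, (n1 <= n2 + tau)%N, (1 < t -> n2 < n1 + tau)%N &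
       ~~ odd k -> ~~ odd n1]) -> n1 \in part_sizes t k n.
Proof.
move=> n10 t0 nE /= [h1 h2 h3 h4]; rewrite /part_sizes /part_sizes_one /part_size_many.
case: eqP => t1.
  case: (odd k) h1 h2 h4 => h1 h2 h4.
    case: (boolP (odd n)) => on; rewrite !inE; lia.
  have {}h4 := h4 isT.
  have : (n %% 4 < 4)%N by rewrite ltn_mod.
  case nm: (n %% 4)%N => [|[|[|[|m]]]] // _; rewrite !inE; lia.
have {}h3 := h3 ltac:(lia).
case: (odd k) h1 h2 h3 h4 => h1 h2 h3 h4; first by rewrite inE; lia.
have {}h4 := h4 isT.
have : ((n - t) %% 4 < 4)%N by rewrite ltn_mod.
case nm: ((n - t) %% 4)%N => [|[|[|[|m]]]] // _; rewrite !inE; lia.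
Qed.

Lemma enum_image (T : finType) (S : {set T}) m : #|S| = m ->
  exists2 e : 'I_m -> T, injective e & (forall i, e i \in S) /\ {in S, forall v, exists i, e i = v}.
Proof.
move=> <-; exists (fun i => enum_val i); first exact: enum_val_inj.
split=> [i|v vS]; first exact: enum_valP.
by exists (enum_rank_in vS v); rewrite enum_rankK_in.
Qed.

(** * Reading off the isomorphism and the family from the parts *)

Section Reconstruction.
Variables (V : finType) (G : sgraph V) (k n1 n2 w : nat).
Variables (V1 V2 W : {set V}) (e1 : 'I_n1 -> V) (e2 : 'I_n2 -> V) (e0 : 'I_w -> V).
Hypotheses (cov : V1 :|: V2 = ~: W) (dis : [disjoint V1 & V2]).
Hypotheses (e1i : injective e1) (e2i : injective e2) (e0i : injective e0).
Hypotheses (e1V : forall i, e1 i \in V1) (e2V : forall i, e2 i \in V2) (e0W : forall i, e0 i \in W).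
Hypotheses (e1s : {in V1, forall v, exists i, e1 i = v}) (e2s : {in V2, forall v, exists i, e2 i = v}).
Hypotheses (e0s : {in W, forall v, exists i, e0 i = v}).

Let e12 (u : 'I_n1 + 'I_n2) : V := match u with inl i => e1 i | inr j => e2 j end.
Let e (u : 'I_w + ('I_n1 + 'I_n2)) : V := match u with inl i => e0 i | inr j => e12 j end.

Lemma e12_outside u : e12 u \notin W.
Proof. by rewrite -in_setC -cov inE; case: u => i /=; rewrite (e1V, e2V) ?orbT. Qed.

Lemma e12_inj : injective e12.
Proof.
have no i j : e1 i <> e2 j.
  by move=> E; have := disjointFr dis (e1V i); rewrite E e2V.
move=> [i|i] [j|j] //=; first by move/e1i ->.
- by move/no.
- by move/esym/no.
- by move/e2i ->.
Qed.

Lemma e_bij : bijective e.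
Proof.
have no i u : e0 i <> e12 u.
  by move=> E; have := e12_outside u; rewrite -E e0W.
have ei : injective e.
  move=> [i|i] [j|j] //=; first by move/e0i ->.
  - by move/no.
  - by move/esym/no.
  - by move/e12_inj ->.
have es v : exists u, e u = v.
  case: (boolP (v \in W)) => [/e0s [i <-]|]; first by exists (inl i).
  rewrite -in_setC -cov inE => /orP [/e1s [i <-]|/e2s [i <-]].
    by exists (inr (inl i)).
  by exists (inr (inr i)).
apply: (inj_card_bij ei); rewrite -(card_codom ei); apply: subset_leq_card.
by apply/fintype.subsetP => v _; have [u <-] := es v; exact: codom_f.
Qed.

Lemma giso_of_parts : {in W, forall w v, v != w -> G w v} ->
  giso G (join (complete w) (induced e12 G)).
Proof.
move=> dom; have [g ge eg] := e_bij.
exists g; first by exists e.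
move=> a b; rewrite -{2}(eg a) -{2}(eg b).
case: (g a) (g b) => [i|i] [j|j] //=.
- rewrite /complete_rel; case: eqP => [->|/eqP ne]; first by rewrite adj_irr.
  by rewrite dom // (inj_eq e0i) eq_sym.
- by rewrite dom //; apply/eqP => E; have := e12_outside j; rewrite E e0W.
- by rewrite adj_sym dom //; apply/eqP => E; have := e12_outside i; rewrite E e0W.
Qed.

Lemma bip_family_of_parts : (0 < k)%N -> {in V1 & V2, forall a b, G a b} ->
  {in V2 &, forall a b, ~~ G a b} ->
  (forall p, uniq p -> sorted G p -> {in p, forall v, v \in V1} -> (size p < k.*2)%N) ->
  {in V1, forall v, #|nbr G v :&: V1| = k.-1} ->
  bip_family n1 n2 (k - 1) (pathg (2 * k)) (induced e12 G).
Proof.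
move=> k0 full ind npath reg; split.
- by move=> [i|i] [j|j] //= _; [|rewrite adj_sym]; exact: full.
- by move=> i j; exact: ind (e2V i) (e2V j).
- move=> [f fi fp]; pose p := [seq e1 (f i) | i <- enum 'I_(2 * k)].
  have : (size p < k.*2)%N.
    apply: npath.
    + by rewrite map_inj_uniq ?enum_uniq // => a b /e1i /fi.
    + rewrite /p sorted_map.
      have : sorted (fun a b : nat => a.+1 == b) (map val (enum 'I_(2 * k))).
        by rewrite val_enum_ord; elim: (2 * k)%N {1}0%N => [|[|m] IH] a //=; rewrite eqxx; exact: IH.
      rewrite sorted_map; apply: sub_sorted => a b /= ab; apply: fp.
      by rewrite /= /pathg_rel ab.
    + by move=> v /mapP [i _ ->].
  by rewrite size_map size_enum_ord mul2n ltnn.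
- left=> i; rewrite subn1 -(reg (e1 i)) // /degree -(card_imset _ e1i); apply: eq_card => v.
  rewrite !inE; apply/imsetP/andP => [[j]|[gv vV]].
    by rewrite inE /= => g ->.
  by have [j E] := e1s vV; exists j; rewrite ?inE /= E.
Qed.

End Reconstruction.


Local Open Scope nat_scope.
Local Open Scope classical_set_scope.

Theorem theorem1p4 (R : realType) (t k : nat) (ht : 1 <= t) (hk : 3 <= k) :
  exists N : nat, forall n : nat, N <= n ->
    forall G : sgraph 'I_n,
      Spex R n (copies t (join (pathg 1) (pathg (2 * k)))) G ->
      exists2 n1 : nat, n1 \in part_sizes t k n &
        exists2 H : sgraph ('I_n1 + 'I_(n - n1 - t + 1))%type,
          bip_family n1 (n - n1 - t + 1) (k - 1) (pathg (2 * k)) H &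
          giso G (join (complete (t - 1)) H).
Proof.
have [N HN] := core_exists R hk ht; exists (maxn N 1) => n.
rewrite geq_max => /andP [Nn n0] G SG.
have {}SG : Spex R n (copies t (join (pathg 1) (pathg k.*2))) G by rewrite -mul2n.
have [x ex] := spex_extremal hk ht n0 SG.
have NV : N <= #|{: 'I_n}| by rewrite card_ord.
have [eta [M [V1 [V2 [W C]]]]] := HN _ _ _ _ ex NV.
(* The part carrying the inner edges is named [V1], because the listed sizes refer to it. *)
wlog I2 : V1 V2 C / inner G V2 = 0.
  move=> hw; have [I1|I2] := one_sided C; last exact: hw C I2.
  exact: hw (core_sym C) I1.
have cV := core_card C; have cW := cr_W C; rewrite card_ord in cV.
have ne : (#|V1| + #|V2| + t)%N = n.+1 by rewrite -cW addnS cV.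
have pos (A B : {set 'I_n}) : core k t G (spectral_radius R G) x eta M A B W -> 0 < #|A|.
  move=> /core_V1_big; apply: leq_trans.
  by rewrite !muln_gt0 (ltnW (ltnW hk)) ht.
have V10 := pos _ _ C; have V20 := pos _ _ (core_sym C).
exists #|V1|; first exact: part_sizes_mem V10 ht ne (part_sizes_near C I2).
(* Subtraction is truncated: [n - #|V1| - t] stands for [#|V2| - 1], so [V2] has to be nonempty. *)
have c2 : #|V2| = n - #|V1| - t + 1.
  by move: ne V20; move: #|V1| #|V2| => a b; clear; lia.
have c0 : #|W| = t - 1 by rewrite -cW subn1.
have [e1 e1i [e1V e1s]] := enum_image (erefl #|V1|).
have [e2 e2i [e2V e2s]] := enum_image c2.
have [e0 e0i [e0V e0s]] := enum_image c0.
eexists; last exact: giso_of_parts (cr_cov C) (cr_dis C) e1i e2i e0i e1V e2V e0V e1s e2s e0s (cr_dom C).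
apply: (bip_family_of_parts e1i e1V e2V e1s).
- exact: leq_trans hk.
- exact: parts_complete C I2.
- exact: part_independent I2.
- by move=> p; exact: part_no_path C _.
- exact: part_regular C I2.
Qed.
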